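(* Let $n$ be a positive integer with $n\leq 12$. Then the Singer transfer $$Tr_6^{\mathcal A}: ([QP_{n}^{\otimes 6}]^{GL_6})^{*}\longrightarrow {\rm Ext}_{\mathcal A}^{6, 6+n}(\mathbb Z/2, \mathbb Z/2)$$ is a monomorphism if $n \in \{10, 11\}$, and is a trivial isomorphism (an isomorphism between zero spaces) otherwise.
   Context: $\mathcal A$ is the mod 2 Steenrod algebra and $\overline{\mathcal A}$ its set of positive-degree elements. For $h\ge 1$, $P^{\otimes h}=\mathbb Z/2[t_1,\ldots,t_h]$ with $\deg t_i=1$ is the unstable $\mathcal A$-algebra $H^*((\mathbb RP^\infty)^{h};\mathbb Z/2)$, with degree $n$ part $P^{\otimes h}_n$; $GL_h=GL_h(\mathbb Z/2)$ acts by linear substitutions, commuting with $\mathcal A$. $QP^{\otimes h}=\mathbb Z/2\otimes_{\mathcal A}P^{\otimes h}$, with degree $n$ part $QP_n^{\otimes h}$, and $[QP_n^{\otimes h}]^{GL_h}$ is its subspace of $GL_h$-invariants. The linear dual $([QP_n^{\otimes h}]^{GL_h})^*$ is canonically the space of coinvariants $\mathbb Z/2\otimes_{GL_h}{\rm Ann}_{\overline{\mathcal A}}[P_n^{\otimes h}]^{*}$, where ${\rm Ann}_{\overline{\mathcal A}}[P_n^{\otimes h}]^{*}$ is the subspace of the dual $[P_n^{\otimes h}]^*$ annihilated by all positive-degree Steenrod operations. Singer's (algebraic, or cohomological) transfer: extend the $\mathcal A$-action on $P^{\otimes 1}=\mathbb Z/2[t_1]$ to $\mathbb Z/2[t_1,t_1^{-1}]$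 by $Sq^n(t_1^{-1})=t_1^{n-1}$ for $n\ge1$, and let $\mathcal P$ be the $\mathcal A$-submodule spanned by $t_1^a$, $a\ge -1$. The sequences $0\to P^{\otimes (i+1)}\to P^{\otimes i}\otimes \mathcal P\to \Sigma^{-1}P^{\otimes i}\to 0$ ($i\geq 0$, induced by the inclusion $P^{\otimes 1}\subset\mathcal P$ and the projection $\mathcal P\to\Sigma^{-1}\mathbb Z/2$ sending $t_1^{-1}\mapsto 1$ and $t_1^a\mapsto 0$ for $a\ne-1$) are exact. Composing the associated connecting homomorphisms ${\rm Tor}^{\mathcal A}_{h-i}(\mathbb Z/2,\Sigma^{-h}P^{\otimes i})\to{\rm Tor}^{\mathcal A}_{h-i-1}(\mathbb Z/2,\Sigma^{-h+1}P^{\otimes (i+1)})$ (with the appropriate suspensions) for $i=0,\ldots,h-1$ gives ${\rm Tor}_h^{\mathcal A}(\mathbb Z/2,\Sigma^{-h}\mathbb Z/2)\to QP^{\otimes h}$, whose image lies in the $GL_h$-invariants. Using the isomorphism ${\rm Tor}^{\mathcal A}_{h,n}(\mathbb Z/2,\Sigma^{-h}\mathbb Z/2)\cong{\rm Tor}^{\mathcal A}_{h,h+n}(\mathbb Z/2,\mathbb Z/2)$ one obtains $\varphi_h^{\mathcal A}:{\rm Tor}^{\mathcal A}_{h,h+n}(\mathbb Z/2,\mathbb Z/2)\to[QP_n^{\otimes h}]^{GL_h}$. Its linear dual is the transfer of rank $h$, $Tr_h^{\mathcal A}:([QP_n^{\otimes h}]^{GL_h})^*\to{\rm Ext}_{\mathcal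 A}^{h,h+n}(\mathbb Z/2,\mathbb Z/2)$, in internal degree $n$. *)

(* Defs.v *)
From HB Require Import structures.
From mathcomp Require Import all_boot all_order all_algebra.
From mathcomp Require Import zify mpoly.

Set Implicit Arguments.
Unset Strict Implicit.
Unset Printing Implicit Defensive.
Import Order.TTheory GRing.Theory Num.Theory.

Local Open Scope ring_scope.

(* Everything below is graded and of finite type over Z/2 : each homogeneous
   piece is a [vectType 'F_2], and no signs occur.  In comments, (x) is the
   tensor product over Z/2, A is the mod 2 Steenrod algebra and Abar its
   augmentation ideal. *)

Section LinearAlgebra.

Variable F : fieldType.
Implicit Types U V W : vectType F.

(* V / S, carried by a chosen complement of S; [lker_piq] and [limg_piq] are
   the defining properties of the projection [piq S]. *)
Definition quotv V (S : {vspace V}) : vectType F := subvs_of (S^C)%VS.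

Definition piq V (S : {vspace V}) : 'Hom(V, quotv S) :=
  (linfun (@vsproj _ _ (S^C)%VS) \o daddv_pi (S^C) S)%VF.

Lemma piq_val V (S : {vspace V}) v : vsval (piq S v) = daddv_pi (S^C) S v.
Proof. by rewrite comp_lfunE lfunE vsprojK // memv_pi. Qed.

Lemma lker_piq V (S : {vspace V}) : lker (piq S) = S.
Proof.
have capS : (S^C :&: S = 0)%VS by rewrite capvC capv_compl.
have addS v : daddv_pi (S^C) S v + daddv_pi S (S^C) v = v.
  by apply: daddv_pi_add; rewrite // addvC addv_complf memvf.
apply/vspaceP => v; rewrite memv_ker; apply/eqP/idP => [v0 | Sv].
  have := piq_val S v; rewrite v0 linear0 => pi0.
  by rewrite -[v]addS -pi0 add0r memv_pi.
apply: val_inj; rewrite /= piq_val /=.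
have := addS v; rewrite (daddv_pi_id _ Sv) ?capv_compl //.
by move/eqP; rewrite -subr_eq0 addrK => /eqP.
Qed.

Lemma limg_piq V (S : {vspace V}) : limg (piq S) = fullv.
Proof.
apply/vspaceP => w; rewrite memvf; apply/memv_imgP; exists (vsval w).
  by rewrite memvf.
apply: val_inj; rewrite /= piq_val daddv_pi_id ?subvsP //.
by rewrite capvC capv_compl.
Qed.

Lemma piqK V (S : {vspace V}) : cancel (piq S)^-1%VF (piq S).
Proof. by move=> w; rewrite limg_lfunVK // limg_piq memvf. Qed.

(* ker g / im f for U --f--> V --g--> W with g \o f = 0.  [hcls] sends a cycle
   to its class and [hrep] chooses a cycle in each class. *)
Definition homology U V W (f : 'Hom(U, V)) (g : 'Hom(V, W)) : vectType F :=
  @quotv (subvs_of (lker g)) (linfun (@vsval _ _ (lker g)) @^-1: limg f)%VS.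

Definition hcls U V W (f : 'Hom(U, V)) (g : 'Hom(V, W)) :
    'Hom(V, homology f g) :=
  (piq _ \o linfun (@vsproj _ _ (lker g)))%VF.

Definition hrep U V W (f : 'Hom(U, V)) (g : 'Hom(V, W)) :
    'Hom(homology f g, V) :=
  (linfun (@vsval _ _ (lker g)) \o (piq _)^-1)%VF.

Lemma hrep_cycle U V W (f : 'Hom(U, V)) (g : 'Hom(V, W)) z :
  g (hrep f g z) = 0.
Proof.
by apply/eqP; rewrite -memv_ker comp_lfunE lfunE; apply: subvsP.
Qed.

Lemma hrepK U V W (f : 'Hom(U, V)) (g : 'Hom(V, W)) :
  cancel (hrep f g) (hcls f g).
Proof.
move=> z; rewrite -[RHS](piqK z) comp_lfunE; congr (piq _ _).
by rewrite lfunE /= comp_lfunE lfunE /= vsvalK.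
Qed.

Lemma hcls_eq0 U V W (f : 'Hom(U, V)) (g : 'Hom(V, W)) v :
  v \in lker g -> (hcls f g v == 0) = (v \in limg f).
Proof.
set S := (linfun (@vsval _ _ (lker g)) @^-1: limg f)%VS.
have -> : hcls f g v = piq S (vsproj (lker g) v).
  by rewrite [LHS]comp_lfunE; congr (piq _ _); rewrite lfunE.
move=> gv; rewrite -memv_ker lker_piq -memv_preim lfunE /=.
by rewrite vsprojK.
Qed.

Lemma hrep_cls U V W (f : 'Hom(U, V)) (g : 'Hom(V, W)) v :
  v \in lker g -> v - hrep f g (hcls f g v) \in limg f.
Proof.
move=> gv; rewrite -(@hcls_eq0 _ _ _ f g); last first.
  by rewrite rpredB // memv_ker hrep_cycle.
by rewrite linearB [X in _ - X]hrepK subrr.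
Qed.

Definition dual V : vectType F := 'Hom(V, F^o).

Definition precomp V W (f : 'Hom(V, W)) (u : dual W) : dual V := (u \o f)%VF.

Fact precomp_is_linear V W (f : 'Hom(V, W)) : linear (precomp f).
Proof.
by move=> c u v; rewrite /precomp comp_lfunDl comp_lfunZl.
Qed.
HB.instance Definition _ V W f :=
  GRing.isSemilinear.Build F (dual W) (dual V) _ (@precomp V W f)
    (GRing.semilinear_linear (precomp_is_linear f)).

Definition dualmap V W (f : 'Hom(V, W)) : 'Hom(dual W, dual V) :=
  linfun (precomp f).

(* The natural map from the cohomology of the dual complex
   dual W -> dual V -> dual U to the dual of ker g / im f. *)
Definition pairing U V W (f : 'Hom(U, V)) (g : 'Hom(V, W)) :
    'Hom(homology (dualmap g) (dualmap f), dual (homology f g)) :=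
  (dualmap (hrep f g) \o hrep (dualmap g) (dualmap f))%VF.

End LinearAlgebra.

Lemma pairing_bij (F : fieldType) (U V W : vectType F)
    (f : 'Hom(U, V)) (g : 'Hom(V, W)) :
  (g \o f)%VF = 0 -> bijective (pairing f g).
Proof.
move=> gf0.
have dualE (X Y : vectType F) (k : 'Hom(X, Y)) (u : dual Y) : dualmap k u = (u \o k)%VF.
  by rewrite /dualmap lfunE.
have pairE c : pairing f g c = (hrep (dualmap g) (dualmap f) c \o hrep f g)%VF.
  by rewrite /pairing [LHS]comp_lfunE dualE.
have gf u : f u \in lker g.
  by rewrite memv_ker; have /lfunP/(_ u) := gf0; rewrite comp_lfunE => ->; rewrite lfunE.
have inj : injective (pairing f g).
  apply/lker0P; apply/eqP; apply/vspaceP => e; rewrite memv0 memv_ker.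
  apply/eqP/eqP => [|->]; last by rewrite linear0.
  rewrite pairE; set c := hrep _ _ e => c0.
  have cf : (c \o f)%VF = 0 by rewrite -dualE hrep_cycle.
  have cz v : v \in lker g -> c v = 0.
    move=> gv; have /memv_imgP[y _ Ey] := hrep_cls f gv.
    rewrite -[v](subrK (hrep f g (hcls f g v))) Ey linearD /=.
    have -> : c (f y) = 0 by rewrite -[LHS](comp_lfunE c) cf lfunE.
    have -> : c (hrep f g (hcls f g v)) = 0
      by rewrite -[LHS](comp_lfunE c) c0 lfunE.
    by rewrite addr0.
  apply/eqP; rewrite -[e](@hrepK _ _ _ _ (dualmap g) (dualmap f)) -/c hcls_eq0; last first.
    by rewrite memv_ker dualE cf.
  apply/memv_imgP; exists (c \o g^-1)%VF; first exact: memvf.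
  rewrite dualE -comp_lfunA; apply/lfunP => v; rewrite !comp_lfunE.
  have : c (v - g^-1%VF (g v)) = 0.
    apply: cz; rewrite memv_ker linearB /=.
    by rewrite limg_lfunVK ?subrr // memv_img ?memvf.
  by rewrite linearB /= => /eqP; rewrite subr_eq0 => /eqP.
have sur th : exists e, pairing f g e = th.
  pose c : dual V := (th \o hcls f g)%VF.
  have cf : c \in lker (dualmap f).
    rewrite memv_ker dualE; apply/eqP/lfunP => y.
    rewrite comp_lfunE [LHS]comp_lfunE [RHS]lfunE.
    suff /eqP -> : hcls f g (f y) == 0 by rewrite linear0.
    by rewrite hcls_eq0 ?memv_img ?memvf.
  exists (hcls (dualmap g) (dualmap f) c); rewrite pairE.
  have /memv_imgP[u _] := @hrep_cls _ _ _ _ (dualmap g) _ _ cf.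
  set c' := hrep _ _ _; rewrite dualE => Ec.
  have -> : c' = c - (u \o g)%VF by rewrite -Ec opprB addrC subrK.
  apply/lfunP => z; rewrite comp_lfunE add_lfunE opp_lfunE /=.
  rewrite [X in X - _]comp_lfunE hrepK [X in _ - X]comp_lfunE hrep_cycle.
  by rewrite linear0 subr0.
apply: (Bijective (g := fun th => (pairing f g)^-1%VF th)) => x.
  by apply: inj; rewrite limg_lfunVK // memv_img ?memvf.
have [e <-] := sur x; rewrite limg_lfunVK // memv_img ?memvf //.
Qed.

(* The word [:: k1; ...; kr] stands for Sq^k1 ... Sq^kr. *)
Notation word := (seq nat).

(* The right-hand side of the Adem relation for Sq^a Sq^b, 0 < a < 2b, as a
   formal sum of words, with Sq^0 = 1.  Throughout, a list of basis elements
   stands for their sum mod 2. *)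
Definition adem (a b : nat) : seq word :=
  [seq (if c == 0%N then [:: (a + b)%N] else [:: (a + b - c)%N; c])
  | c <- iota 0 (a./2).+1 & odd 'C((b - c).-1, a - c.*2)].

(* All products u (Sq^a Sq^b + adem a b) v having w = u Sq^a Sq^b v as their
   first term.  The Steenrod algebra is the span of all words in positive
   letters modulo the span of these. *)
Definition adem_relators (w : word) : seq (seq word) :=
  [seq (let a := nth 0%N w i in let b := nth 0%N w i.+1 in
        [seq take i w ++ x ++ drop i.+2 w | x <- [:: a; b] :: adem a b])
  | i <- iota 0 (size w).-1 & (nth 0%N w i < (nth 0%N w i.+1).*2)%N].

(* The monomial t_1^{a_1} ... t_k^{a_k}, with integer exponents. *)
Notation monomial := (seq int).

(* The binomial coefficient (a choose k) for a in Z, up to sign; so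
   Sq^k t^-1 = t^(k-1). *)
Definition binz (a : int) (k : nat) : nat :=
  match a with Posz m => 'C(m, k) | Negz m => 'C(m + k, k) end.

Fixpoint sq (k : nat) (m : monomial) : seq monomial :=
  match m with
  | [::] => if k == 0%N then [:: [::]] else [::]
  | a :: m' => flatten [seq [seq (a + j%:Z) :: x | x <- sq (k - j) m']
                       | j <- iota 0 k.+1 & odd (binz a j)]
  end.

Definition act (w : word) (m : monomial) : seq monomial :=
  foldr (fun k s => flatten (map (sq k) s)) [:: m] w.

(* An A-module spanned by a set of monomials in [nvar] variables. *)
Record monmod := MonMod { nvar : nat; mon : pred monomial }.

(* P^{(x) i} *)
Definition Ppow (i : nat) : monmod := MonMod i (all (fun a => 0 <= a)).

(* P^{(x) i} (x) calP : the last exponent may be -1. *)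
Definition PpowP (i : nat) : monmod :=
  MonMod i.+1
    (fun m => all (fun a => 0 <= a) (take i m) && (-1 <= nth 0 m i)).

(* The bar label ([:: w1; ...; ws], m) stands for [w1|...|ws] m. *)
Notation barlabel := (seq word * monomial)%type.

Definition bardeg (l : barlabel) : int :=
  (sumn (map sumn l.1))%:Z + \sum_(a <- l.2) a.

Definition is_label (M : monmod) (s d : nat) (l : barlabel) : bool :=
  [&& size l.1 == s, all (fun w => (w != [::]) && (0%N \notin w)) l.1,
      size l.2 == nvar M, mon M l.2 & bardeg l == d%:Z].

(* A finite set of codes for the labels of bar length s and degree d : all
   exponents being at least -1 and at most one of them negative, letters and
   word lengths are at most d+1 and exponents lie in [-1, d+1]. *)
Definition barbox (k s d : nat) : finType :=
  (s.-tuple (d.+1.-bseq 'I_d.+2) * k.-tuple 'I_d.+3)%type.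

Definition label_of k s d (x : barbox k s d) : barlabel :=
  (map (fun w : d.+1.-bseq 'I_d.+2 => map val w) x.1,
   map (fun e : 'I_d.+3 => (e : nat)%:Z - 1) x.2).

Definition barbasis (M : monmod) (s d : nat) : finType :=
  {x : barbox (nvar M) s d | is_label M s d (label_of x)}.

Definition label M s d (x : barbasis M s d) : barlabel := label_of (val x).

Lemma label_of_inj k s d : injective (@label_of k s d).
Proof.
move=> [x1 x2] [y1 y2] [E1 E2]; congr pair; apply: val_inj.
  by apply: inj_map E1 => u v E; apply: val_inj; apply: inj_map E; apply: val_inj.
by apply: inj_map E2 => u v /addIr [E]; apply: val_inj.
Qed.

Lemma label_inj M s d : injective (@label M s d).
Proof. by move=> x y /label_of_inj; apply: val_inj. Qed.

Fact mon_bounds M i m : M = Ppow i \/ M = PpowP i ->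
    size m = nvar M -> mon M m ->
  -1 <= \sum_(a <- m) a /\
  {in m, forall a, -1 <= a <= \sum_(a <- m) a + 1}.
Proof.
have pos (r : seq int) : all (fun a => 0 <= a) r ->
    0 <= \sum_(a <- r) a /\ {in r, forall a, 0 <= a <= \sum_(a <- r) a}.
  elim: r => [_|b r IH /= /andP[b0 /IH[]]]; first by rewrite big_nil.
  rewrite big_cons; move: (\sum_(a <- r) a) => S S0 bnd; split=> [|a]; first lia.
  rewrite inE => /orP[/eqP->|/bnd]; lia.
case=> -> /= sz.
  move=> /pos[]; move: (\sum_(a <- m) a) => S S0 bnd.
  by split=> [|a /bnd]; lia.
have [p [b Em]] : exists p b, m = rcons p b.
  by case/lastP: m sz => // p b _; exists p, b.
move: sz; rewrite {}Em size_rcons => -[<-].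
rewrite -cats1 take_size_cat // nth_cat ltnn subnn /= => /andP[/pos[]].
rewrite big_cat big_seq1 /=; move: (\sum_(a <- p) a) => S S0 bnd b1; split=> [|a]; first lia.
by rewrite mem_cat inE => /orP[/bnd|/eqP->]; lia.
Qed.

Lemma label_surj M s d i l : M = Ppow i \/ M = PpowP i ->
  is_label M s d l -> exists x : barbasis M s d, label x = l.
Proof.
move=> EM Hl; have := Hl; case: l Hl => b m Hl /and5P[/= /eqP sb ab /eqP sm mm /eqP].
have [S1 bnd] := mon_bounds EM sm mm; rewrite /bardeg /=.
move: (\sum_(a <- m) a) S1 bnd => S S1 bnd dE.
have: (sumn (map sumn b))%:Z <= d.+1%:Z by lia.
rewrite lez_nat => leb.
have wle w : w \in b -> (sumn w <= d.+1)%N.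
  move=> wb; have: (sumn w <= sumn (map sumn b))%N.
    elim: (b) wb => //= v r IH; rewrite inE => /orP[/eqP->|/IH]; lia.
  by move/leq_trans; apply.
have letter w k : k \in w -> (k <= sumn w)%N.
  elim: w => //= v r IH; rewrite inE => /orP[/eqP->|/IH]; lia.
have len w : 0%N \notin w -> (size w <= sumn w)%N.
  elim: w => //= v r IH; rewrite inE negb_or => /andP[v0 /IH]; lia.
pose cw (w : word) : d.+1.-bseq 'I_d.+2 := insub_bseq d.+1 (map inord w).
pose ce (a : int) : 'I_d.+3 := inord (absz (a + 1)).
have sb' : size (map cw b) == s by rewrite size_map sb.
have sm' : size (map ce m) == nvar M by rewrite size_map sm.
pose x : barbox (nvar M) s d := (Tuple sb', Tuple sm').
have lx : label_of x = (b, m).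
  rewrite /label_of /=; congr pair.
    rewrite -map_comp; apply: map_id_in => w wb /=.
    have /andP[_ w0] := allP ab w wb.
    rewrite /cw /insub_bseq insubdK; last first.
      by rewrite -topredE /= size_map (leq_trans (len w w0)) ?wle.
    rewrite -map_comp; apply: map_id_in => k kw /=.
    by rewrite inordK // ltnS (leq_trans (letter w k kw)) ?wle.
  rewrite -map_comp; apply: map_id_in => a am /=.
  have /andP[a1 a2] := bnd a am; rewrite /ce inordK; lia.
by have Px := Hl; rewrite -lx in Px; exists (exist (fun y => is_label M s d (label_of y)) x Px).
Qed.

(* The degree d part of T^{(x) s} (x) M, where T is the augmentation ideal of
   the free associative algebra on Sq^1, Sq^2, ... *)
Definition prebar (M : monmod) (s d : nat) : vectType 'F_2 :=
  {ffun barbasis M s d -> ('F_2)^o}.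

Definition vec M s d (r : seq barlabel) : prebar M s d :=
  [ffun x => (count_mem (label x) r)%:R].

Section Extend.
Variables (M M' : monmod) (s d s' d' : nat) (f : barlabel -> seq barlabel).

Definition extend_fun (v : prebar M s d) : prebar M' s' d' :=
  \sum_(x : barbasis M s d) v x *: vec M' s' d' (f (label x)).

Fact extend_is_linear : linear extend_fun.
Proof.
move=> c u v; rewrite /extend_fun scaler_sumr -big_split /=.
by apply: eq_bigr => x _; rewrite !ffunE scalerDl scalerA.
Qed.
HB.instance Definition _ :=
  GRing.isSemilinear.Build 'F_2 (prebar M s d) (prebar M' s' d') _ extend_fun
    (GRing.semilinear_linear extend_is_linear).

Definition extend : 'Hom(prebar M s d, prebar M' s' d') := linfun extend_fun.
End Extend.

Definition bar_relators (l : barlabel) : seq (seq barlabel) :=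
  flatten [seq [seq [seq (set_nth [::] l.1 j w, l.2) | w <- r]
               | r <- adem_relators (nth [::] l.1 j)]
          | j <- iota 0 (size l.1)].

Definition bar_relations (M : monmod) (s d : nat) : {vspace prebar M s d} :=
  (\sum_(x : barbasis M s d)
     <<[seq vec M s d r | r <- bar_relators (label x)]>>)%VS.

(* The degree d part of the reduced bar construction Abar^{(x) s} (x) M. *)
Definition bar (M : monmod) (s d : nat) : vectType 'F_2 :=
  quotv (bar_relations M s d).

(* The map of bar constructions induced by f; used only when f sends relations
   to relations, so that the choice of representatives is immaterial. *)
Definition onbar M M' s d s' d' (f : barlabel -> seq barlabel) :
    'Hom(bar M s d, bar M' s' d') :=
  (piq _ \o extend M M' s d s' d' f \o (piq (bar_relations M s d))^-1)%VF.

Fixpoint merges (b : seq word) : seq (seq word) :=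
  match b with
  | w1 :: ((w2 :: b') as t) => ((w1 ++ w2) :: b') :: map (cons w1) (merges t)
  | _ => [::]
  end.

(* d [w1|...|ws] m = sum_j [w1|...|w_j w_{j+1}|...|ws] m
                     + [w1|...|w_{s-1}] (ws m) *)
Definition bardiff (l : barlabel) : seq barlabel :=
  [seq (b, l.2) | b <- merges l.1] ++
  (if l.1 is w :: b then [seq (belast w b, m) | m <- act (last w b) l.2]
   else [::]).

(* Zero for s = 0. *)
Definition bd (M : monmod) (s d : nat) : 'Hom(bar M s d, bar M s.-1 d) :=
  onbar M M s d s.-1 d bardiff.

(* Tor^A_{s,d}(Z/2, M) *)
Definition Tor (M : monmod) (s d : nat) : vectType 'F_2 :=
  homology (bd M s.+1 d) (bd M s d).

(* Ext_A^{s,d}(Z/2, Z/2), from the bar resolution A (x) Abar^{(x) s} of Z/2,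
   for which Hom_A(A (x) Abar^{(x) s}, Z/2) is the dual of Abar^{(x) s}. *)
Definition Ext (s d : nat) : vectType 'F_2 :=
  homology (dualmap (bd (Ppow 0) s d)) (dualmap (bd (Ppow 0) s.+1 d)).

(* The maps of bar constructions induced by P^{(x) i+1} -> P^{(x) i} (x) calP
   and by P^{(x) i} (x) calP -> Sigma^-1 P^{(x) i}.  The degree d part of
   Sigma^-1 P^{(x) i} is the degree d+1 part of P^{(x) i}. *)
Definition bar_incl i s d : 'Hom(bar (Ppow i.+1) s d, bar (PpowP i) s d) :=
  onbar (Ppow i.+1) (PpowP i) s d s d (fun l => [:: l]).

Definition bar_proj i s d : 'Hom(bar (PpowP i) s d, bar (Ppow i) s d.+1) :=
  onbar (PpowP i) (Ppow i) s d s d.+1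
    (fun l => if nth 0 l.2 i == -1 then [:: (l.1, take i l.2)] else [::]).

(* Tor_{s+1}(Z/2, Sigma^-1 P^{(x) i})_d -> Tor_s(Z/2, P^{(x) i+1})_d *)
Definition connecting i s d :
    'Hom(Tor (Ppow i) s.+1 d.+1, Tor (Ppow i.+1) s d) :=
  (hcls _ _ \o (bar_incl i s d)^-1 \o bd (PpowP i) s.+1 d
    \o (bar_proj i s.+1 d)^-1 \o hrep _ _)%VF.

(* P^{(x) h}_n : the bar construction with no bars. *)
Definition Pdeg (h n : nat) : vectType 'F_2 := prebar (Ppow h) 0 n.

Definition Sq h n k : 'Hom(Pdeg h (n - k), Pdeg h n) :=
  extend (Ppow h) (Ppow h) 0 (n - k) 0 n (fun l => [seq ([::], m) | m <- sq k l.2]).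

Definition hit h n : {vspace Pdeg h n} :=
  (\sum_(k < n.+1 | (0 < k)%N) limg (Sq h n k))%VS.

Definition QP (h n : nat) : vectType 'F_2 := quotv (hit h n).

(* Tor_0(Z/2, P^{(x) h})_n = QP^{(x) h}_n *)
Definition Tor0_QP h n : 'Hom(Tor (Ppow h) 0 n, QP h n) :=
  (piq (hit h n) \o (piq (bar_relations (Ppow h) 0 n))^-1 \o hrep _ _)%VF.

(* The composite of k connecting homomorphisms, followed by [Tor0_QP]. *)
Fixpoint connecting_iter h n k : forall i, (k + i)%N = h ->
    'Hom(Tor (Ppow i) k (k + n), QP h n) :=
  match k with
  | 0 => fun i e =>
      match e in _ = h' return 'Hom(Tor (Ppow i) 0 n, QP h' n) with
      | erefl => Tor0_QP i n
      end
  | k'.+1 => fun i e =>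
      (connecting_iter n (etrans (addnS k' i) e)
         \o connecting i k' (k' + n))%VF
  end.

Definition expo h n (x : barbasis (Ppow h) 0 n) : 'X_{1..h} :=
  [multinom absz (nth (0 : int) (label x).2 i) | i < h].

Definition poly_of h n (v : Pdeg h n) : {mpoly 'F_2[h]} :=
  \sum_x v x *: 'X_[expo x].

Section GLaction.
Variables (h n : nat) (g : 'M['F_2]_h).

Definition gl_fun (v : Pdeg h n) : Pdeg h n :=
  [ffun x => (poly_of v \mPo [tuple \sum_(j < h) g i j *: 'X_j | i < h])@_(expo x)].

Fact gl_is_linear : linear gl_fun.
Proof.
have polyD c (u v : Pdeg h n) :
    poly_of (c *: u + v) = c *: poly_of u + poly_of v.
  rewrite /poly_of scaler_sumr -big_split /=.
  by apply: eq_bigr => x _; rewrite !ffunE scalerDl scalerA.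
move=> c u v; apply/ffunP => x.
rewrite ffunE polyD comp_mpolyD comp_mpolyZ mcoeffD mcoeffZ [RHS]ffunE.
congr (_ + _); last by rewrite [RHS]ffunE.
by rewrite [RHS]ffunE; congr (_ * _); rewrite [RHS]ffunE.
Qed.
HB.instance Definition _ :=
  GRing.isSemilinear.Build 'F_2 (Pdeg h n) (Pdeg h n) _ gl_fun
    (GRing.semilinear_linear gl_is_linear).

Definition glQP : 'End(QP h n) :=
  (piq (hit h n) \o linfun gl_fun \o (piq (hit h n))^-1)%VF.
End GLaction.

Definition QPinv h n : {vspace QP h n} :=
  (\bigcap_(g : 'M['F_2]_h | g \in unitmx) fixedSpace (glQP n g))%VS.

(* phi_h, corestricted to the invariants; [vsproj] is the identity on
   [QPinv h n], which contains the image of [connecting_iter] (Singer). *)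
Definition phi h n : 'Hom(Tor (Ppow 0) h (h + n), subvs_of (QPinv h n)) :=
  (linfun (@vsproj _ _ (QPinv h n)) \o connecting_iter n (addn0 h))%VF.

(* The linear dual of phi_h, read in Ext through the natural isomorphism of
   Ext_A^{h,h+n}(Z/2, Z/2) with the dual of Tor^A_{h,h+n}(Z/2, Z/2)
   (see [pairing_bij]). *)
Definition Tr h n : 'Hom(dual (subvs_of (QPinv h n)), Ext h (h + n)) :=
  ((pairing (bd (Ppow 0) h.+1 (h + n)) (bd (Ppow 0) h (h + n)))^-1
     \o dualmap (phi h n))%VF.

(* Main.v *)
Require Import Defs.
From HB Require Import structures.
From mathcomp Require Import all_boot all_order all_algebra all_field.
From mathcomp Require Import cyclic zify ring mpoly.

(** Both cases rest on the vanishing of the GL_6-invariants of QP_n for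
    0 < n <= 12; outside n = 10, 11 one also needs Ext^{6,6+n} = 0.

    Invariants. Over L = F_64, with basis b_0, ..., b_5 over F_2, put
    x_i = sum_j b_j^(2^i) t_j. In these coordinates the total square is
    x_i |-> x_i + x_{i-1}^2, the Singer cycle L^* acts diagonally by
    x_i |-> a^(2^i) x_i, and the linear map 1 + s + s^3 (s the Frobenius) acts
    by x_i |-> x_i + x_{i+1} + x_{i+3}. Averaging an invariant over L^* leaves
    only the monomials x^e with 63 | sum_i e_i 2^i. Modulo hits these are
    combinations of a few of them, and invariance under 1 + s + s^3, tested on
    functionals that vanish on hits, forces their coefficients to be 0.

    Ext. An explicit minimal resolution ... -> A (x) V_1 -> A (x) V_0 of Z/2,
    exact in low degrees, turns a 6-cocycle of the bar complex, by dimension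
    shifting, into functions on the kernels of its differentials; the last of
    these kernels is generated by V_6, whose degrees 6, 16, 17 are avoided, so
    the cocycle is a coboundary. *)

Set Implicit Arguments.
Unset Strict Implicit.
Unset Printing Implicit Defensive.
Import Order.TTheory GRing.Theory.
Local Open Scope ring_scope.

(** * Steenrod squares on polynomials *)

(** The Singer cycle has odd order 63, so averaging over it needs no division in characteristic 2,
    but it becomes diagonal only after extending scalars to [F_64]. The price is small: the total
    square and 1 + s + s^3 have coefficients 0 and 1 in the x_i, so every certificate is a
    computation with exponent lists and parities, and an [F_2]-linear coordinate of [F_64] that is
    nonzero at 1 brings hits back to [F_2]. The map 1 + s + s^3 is not monomial in the x_i: it
    spreads monomials of weight divisible by 63 over other weights, where invariance becomes a
    condition. For Ext, elements of the Steenrod algebra are words modulo relations, so each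
    constructed cochain must be shown to respect the Adem relations; normal forms serve both to
    evaluate such functionals and to build them. Each dimension shift trades one bar for one stage
    of the resolution. A bar costs degree at least 1 and V_i starts in degree i, so the algebra is
    needed only through degree 14 for total degrees up to 18. *)

Fixpoint pascal (n : nat) : seq bool :=
  if n is n'.+1 then
    let r := pascal n' in
    [seq p.1 (+) p.2 | p <- zip (rcons r false) (false :: r)]
  else [:: true].

(** Pascal's triangle mod 2 keeps unary binomial coefficients out of the certificate
    computations. *)
Definition obin (n k : nat) : bool := nth false (pascal n) k.

Lemma size_pascal n : size (pascal n) = n.+1.
Proof. by elim: n => // n IH; rewrite /pascal -/pascal size_map size_zip size_rcons /= IH minnn. Qed.

Lemma obinE n k : obin n k = odd 'C(n, k).
Proof.
elim: n k => [|n IH] [|k]; rewrite /obin //.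
- by case: k.
- have := IH 0%N; rewrite /obin; have := size_pascal n.
  by rewrite /pascal -/pascal; case: (pascal n) => //= b r _ ->; rewrite !bin0.
rewrite /pascal -/pascal.
case: (leqP k n) => kn; last first.
  rewrite nth_default ?bin_small // size_map size_zip /= size_rcons size_pascal minnn.
  by rewrite ltnS.
rewrite (nth_map (false, false)); last by rewrite size_zip /= size_rcons size_pascal minnn.
rewrite nth_zip /=; last by rewrite size_rcons.
rewrite binS oddD -!IH /obin nth_rcons size_pascal ltnS; congr addb.
by case: ltngtP kn => // -> _; rewrite nth_default ?size_pascal // if_same.
Qed.

(* All c with |c| = k and every binomial (e_i choose c_i) odd. *)
Fixpoint cvec (k : nat) (e : seq nat) : seq (seq nat) :=
  if e is a :: e' then
    flatten [seq [seq j :: c | c <- cvec (k - j) e'] |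
              j <- [seq j <- iota 0 (minn k a).+1 | obin a j]]
  else if k is 0%N then [:: [::]] else [::].

Lemma cvec_cons k a e : cvec k (a :: e) =
  flatten [seq [seq j :: c | c <- cvec (k - j) e] |
            j <- [seq j <- iota 0 (minn k a).+1 | obin a j]].
Proof. by []. Qed.

Definition evalm (R : nzRingType) (x : seq R) (e : seq nat) : R :=
  \prod_(p <- zip x e) p.1 ^+ p.2.

Lemma evalm_cons (R : nzRingType) (a : R) x k e :
  evalm (a :: x) (k :: e) = a ^+ k * evalm x e.
Proof. by rewrite /evalm big_cons. Qed.

Section SqTotal.
Variable R : comNzRingType.
Hypothesis R2 : 2%N \in [pchar R].

Lemma natr_odd n : n%:R = (odd n)%:R :> R.
Proof. by rewrite -{1}(odd_double_half n) natrD -muln2 natrM (pcharf0 R2) mulr0 addr0. Qed.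

Lemma coef_linX (x s : R) (a k : nat) :
  ((x%:P + s *: 'X) ^+ a)`_k = if obin a k then x ^+ (a - k) * s ^+ k else 0.
Proof.
rewrite obinE exprDn coef_sum.
rewrite (eq_bigr (fun i : 'I_a.+1 =>
   if i == k :> nat then x ^+ (a - k) * s ^+ k *+ 'C(a, k) else 0)); last first.
  move=> i _; rewrite coefMn -rmorphXn /= exprZn coefCM coefZ coefXn.
  by rewrite eq_sym; case: eqP => [->|_]; rewrite ?mulr1 // !mulr0 mul0rn.
case: (leqP k a) => ka; last first.
  rewrite bin_small // big1 // => i _.
  by case: eqP => // ik; move: (ltn_ord i); rewrite ik ltnS leqNgt ka.
have kb : (k < a.+1)%N by rewrite ltnS.
rewrite (bigD1 (Ordinal kb)) //= eqxx big1 ?addr0; last first.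
  by move=> i; rewrite -val_eqE /= => /negbTE ->.
by rewrite -[LHS]mulr_natr natr_odd; case: odd; rewrite ?mulr1 ?mulr0.
Qed.

(** The Cartan formula: each factor contributes its binomial expansion in the formal variable ['X],
    and [cvec] collects the terms with odd coefficient. *)
Lemma coef_evalm (x s : seq R) (e : seq nat) (k : nat) :
  size x = size e -> size s = size e ->
  (evalm [seq p.1%:P + p.2 *: 'X | p <- zip x s] e)`_k =
  \sum_(c <- cvec k e) evalm x [seq p.1 - p.2 | p <- zip e c]%N * evalm s c.
Proof.
elim: e x s k => [|a e IH] [|x xs] [|s ss] // k.
  by move=> _ _; rewrite /evalm !big_nil coef1; case: k => [|k]; rewrite ?big_nil //= big_seq1 !big_nil mulr1.
move=> [sx] [ss'].
rewrite cvec_cons big_flatten big_map big_filter [zip _ _]/= map_cons evalm_cons coefM.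
rewrite -(big_mkord xpredT (fun j => ((x%:P + s *: 'X) ^+ a)`_j *
   (evalm [seq p.1%:P + p.2 *: 'X | p <- zip xs ss] e)`_(k - j))).
have le : ((minn k a).+1 <= k.+1)%N by rewrite ltnS geq_minl.
rewrite (big_cat_nat (leq0n _) le) /= [X in _ + X]big_nat_cond.
rewrite [X in _ + X]big1 ?addr0; last first.
  move=> j /andP[/andP[j1 j2] _]; rewrite coef_linX obinE bin_small ?mul0r //.
  by rewrite gtn_min in j1; lia.
rewrite /index_iota subn0 [RHS]big_mkcond -[0%N :: iota 1 _]/(iota 0 (minn k a).+1); apply: eq_bigr => j _.
rewrite coef_linX; case: ifP => _; last by rewrite mul0r.
rewrite big_map IH // big_distrr /=; apply: eq_bigr => c _.
by rewrite !evalm_cons mulrACA.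
Qed.
End SqTotal.

Section TotalSquare.
Variables (n : nat) (R : comNzRingType) (s : 'I_n -> {mpoly R[n]}).

(** The total square, with ['X] marking the degree and [s i] in the place of Sq^1 of the i-th
    variable; multiplicativity is the Cartan formula. It is used with [square] for the t_j and with
    [cyclic_square] for the x_i. *)
Definition Stot : {mpoly R[n]} -> {poly {mpoly R[n]}} :=
  mmap (polyC \o @mpolyC n R) (fun i => ('X_i)%:P + s i *: 'X).

HB.instance Definition _ := GRing.RMorphism.on Stot.

Definition Sqc (k : nat) (p : {mpoly R[n]}) : {mpoly R[n]} := (Stot p)`_k.

Fact Sqc_is_additive k : zmod_morphism (Sqc k).
Proof. by move=> p q; rewrite /Sqc rmorphB coefB. Qed.
HB.instance Definition _ k :=
  GRing.isZmodMorphism.Build _ _ (Sqc k) (Sqc_is_additive k).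

Lemma StotC c : Stot c%:MP = (c%:MP)%:P.
Proof. by rewrite /Stot mmapC. Qed.

Lemma StotX i : Stot 'X_i = ('X_i)%:P + s i *: 'X.
Proof. by rewrite /Stot mmapX mmap1U. Qed.

Lemma SqcZ k c p : Sqc k (c *: p) = c *: Sqc k p.
Proof. by rewrite /Sqc -mul_mpolyC rmorphM /= StotC coefCM mul_mpolyC. Qed.

Definition Hit (p : {mpoly R[n]}) : Prop :=
  exists r : seq (nat * {mpoly R[n]}), p = \sum_(x <- r) Sqc x.1.+1 x.2.

Lemma Hit0 : Hit 0.
Proof. by exists [::]; rewrite big_nil. Qed.

Lemma HitD p q : Hit p -> Hit q -> Hit (p + q).
Proof. by move=> [r ->] [r' ->]; exists (r ++ r'); rewrite big_cat. Qed.

Lemma HitZ c p : Hit p -> Hit (c *: p).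
Proof.
move=> [r ->]; exists [seq (x.1, c *: x.2) | x <- r].
by rewrite big_map scaler_sumr; apply: eq_bigr => x _; rewrite SqcZ.
Qed.

Lemma HitN p : Hit p -> Hit (- p).
Proof. by rewrite -scaleN1r; apply: HitZ. Qed.

Lemma HitB p q : Hit p -> Hit q -> Hit (p - q).
Proof. by move=> hp hq; apply: HitD => //; apply: HitN. Qed.

Lemma Hit_sum I (r : seq I) (P : pred I) (F : I -> {mpoly R[n]}) :
  (forall i, P i -> Hit (F i)) -> Hit (\sum_(i <- r | P i) F i).
Proof. by move=> HF; apply: (big_ind Hit) => //; [exact: Hit0 | exact: HitD]. Qed.

Lemma Hit_Sqc k p : (0 < k)%N -> Hit (Sqc k p).
Proof. by case: k => // k _; exists [:: (k, p)]; rewrite big_seq1. Qed.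

End TotalSquare.

Lemma mpoly_rmorph_eq n (R : comNzRingType) (S : comNzRingType)
    (f g : {rmorphism {mpoly R[n]} -> S}) :
  (forall c, f c%:MP = g c%:MP) -> (forall i, f 'X_i = g 'X_i) -> f =1 g.
Proof.
move=> fgC fgX p; rewrite (mpolyE p) !rmorph_sum /=; apply: eq_bigr => m _.
rewrite -mul_mpolyC !rmorphM /= fgC mpolyXE_id; congr (_ * _).
by rewrite !rmorph_prod /=; apply: eq_bigr => i _; rewrite !rmorphXn /= fgX.
Qed.

Section SquareMorphism.
Variables (n m : nat) (R S : comNzRingType).
Variables (s : 'I_n -> {mpoly R[n]}) (s' : 'I_m -> {mpoly S[m]}).
Variable f : {rmorphism {mpoly R[n]} -> {mpoly S[m]}}.
Hypothesis fC : forall c, exists c', f c%:MP = c'%:MP.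
Hypothesis fX : forall i, Stot s' (f 'X_i) = (f 'X_i)%:P + f (s i) *: 'X.

(** Both composites with the total squares are ring morphisms, so variables and constants decide.
    Hypothesis [fC] leaves room for a change of scalars. *)
Lemma Sqc_morph k p : Sqc s' k (f p) = f (Sqc s k p).
Proof.
have E : Stot s' \o f =1 map_poly f \o Stot s.
  apply: mpoly_rmorph_eq => [c|i] /=.
    by rewrite StotC map_polyC /=; have [c' ->] := fC c; rewrite StotC.
  by rewrite StotX fX rmorphD /= map_polyC map_polyZ map_polyX.
by have := E p; rewrite /Sqc /= => ->; rewrite coef_map.
Qed.

Lemma Hit_morph p : Hit s p -> Hit s' (f p).
Proof.
move=> [r ->]; exists [seq (x.1, f x.2) | x <- r].
by rewrite big_map rmorph_sum /=; apply: eq_bigr => x _; rewrite Sqc_morph.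
Qed.
End SquareMorphism.

Section Monomials.
Variable n : nat.

Definition mofs (e : seq nat) : 'X_{1..n} := [multinom nth 0%N e i | i < n].
Definition sofm (m : 'X_{1..n}) : seq nat := [seq m i | i <- enum 'I_n].

Lemma size_sofm m : size (sofm m) = n.
Proof. by rewrite size_map size_enum_ord. Qed.

Lemma nth_sofm m (i : 'I_n) : nth 0%N (sofm m) i = m i.
Proof. by rewrite (nth_map i) ?size_enum_ord // nth_ord_enum. Qed.

Lemma sofmK : cancel sofm mofs.
Proof. by move=> m; apply/mnmP => i; rewrite mnmE nth_sofm. Qed.

Lemma mofsK e : size e = n -> sofm (mofs e) = e.
Proof.
move=> se; apply: (@eq_from_nth _ 0%N) => [|i]; rewrite size_sofm // => i_n.
by rewrite (nth_sofm _ (Ordinal i_n)) mnmE.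
Qed.

Lemma mofs_inj e e' : size e = n -> size e' = n -> mofs e = mofs e' -> e = e'.
Proof. by move=> se se' E; rewrite -(mofsK se) E mofsK. Qed.

Lemma evalm_enum (R : comNzRingType) (F : 'I_n -> R) (e : seq nat) :
  size e = n -> evalm [seq F i | i <- enum 'I_n] e = \prod_(i < n) F i ^+ nth 0%N e i.
Proof.
move=> se.
have E : e = [seq nth 0%N e (val i) | i <- enum 'I_n].
  have sz : size [seq nth 0%N e (val i) | i <- enum 'I_n] = n.
    by rewrite size_map size_enum_ord.
  apply: (@eq_from_nth _ 0%N) => [|i]; rewrite se ?sz // => i_n.
  by rewrite (nth_map (Ordinal i_n)) ?size_enum_ord // [val _]nth_enum_ord.
by rewrite {1}E /evalm zip_map big_map big_enum.
Qed.

Lemma size_cvec k e c : c \in cvec k e -> size c = size e.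
Proof.
elim: e k c => [|a e IH] k c; first by case: k => //=; rewrite inE => /eqP->.
rewrite cvec_cons => /flattenP[_ /mapP[j _ ->] /mapP[c' c'P ->]] /=.
by rewrite (IH _ _ c'P).
Qed.

Lemma cvec_le k e c i : c \in cvec k e -> (nth 0 c i <= nth 0 e i)%N.
Proof.
elim: e k c i => [|a e IH] k c i; first by case: k => //=; rewrite inE => /eqP->; rewrite nth_nil.
rewrite cvec_cons => /flattenP[_ /mapP[j jP ->] /mapP[c' c'P ->]].
case: i => [|i] /=; last exact: IH c'P.
by move: jP; rewrite mem_filter mem_iota => /andP[_]; lia.
Qed.

Variable R : comNzRingType.
Hypothesis R2 : 2%N \in [pchar R].
Lemma mpchar2 : 2%N \in [pchar {mpoly R[n]}].
Proof. by rewrite inE /= -mpolyC_nat (pcharf0 R2) mpolyC0 eqxx. Qed.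

Lemma Sqc_mofs (s : 'I_n -> {mpoly R[n]}) k (e : seq nat) : size e = n ->
  Sqc s k 'X_[mofs e] =
  \sum_(c <- cvec k e) \prod_(i < n) ('X_i ^+ (nth 0 e i - nth 0 c i)%N * s i ^+ nth 0%N c i).
Proof.
move=> se; rewrite /Sqc {1}/Stot mmapX /mmap1.
rewrite (eq_bigr (fun i => (('X_i)%:P + s i *: 'X) ^+ nth 0%N e i)); last first.
  by move=> i _; rewrite mnmE.
rewrite -evalm_enum //.
rewrite (_ : [seq _ | i <- enum 'I_n] = [seq p.1%:P + p.2 *: 'X |
   p <- zip [seq 'X_i : {mpoly R[n]} | i <- enum 'I_n] [seq s i | i <- enum 'I_n]]); last first.
  by rewrite zip_map -[RHS]map_comp.
have sz T (F : 'I_n -> T) : size [seq F i | i <- enum 'I_n] = n.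
  by rewrite size_map size_enum_ord.
rewrite coef_evalm ?sz ?se //; last exact: mpchar2.
apply: eq_big_seq => c cP; have sc := size_cvec cP.
rewrite !evalm_enum ?sc // ?size_map ?size_zip ?sc ?se ?minnn //.
rewrite -big_split /=; apply: eq_bigr => i _.
rewrite (nth_map (0, 0)%N) ?nth_zip //= ?sc //.
by rewrite size_zip sc minnn se.
Qed.

Lemma Sqc_square k (e : seq nat) : size e = n ->
  Sqc (fun i => 'X_i ^+ 2 : {mpoly R[n]}) k 'X_[mofs e] =
  \sum_(c <- cvec k e) 'X_[mofs [seq (p.1 + p.2)%N | p <- zip e c]].
Proof.
move=> se; rewrite Sqc_mofs //; apply: eq_big_seq => c cP.
have sc := size_cvec cP.
rewrite mpolyXE_id; apply: eq_bigr => i _.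
rewrite -exprM -exprD mnmE (nth_map (0, 0)%N) ?nth_zip //= ?sc //; last first.
  by rewrite size_zip sc minnn se.
by congr (_ ^+ _); have := cvec_le i cP; lia.
Qed.

Definition cyclic_square (i : 'I_n) : {mpoly R[n]} := 'X_(ord_pred i) ^+ 2.

Lemma Sqc_cyclic k (e : seq nat) : size e = n ->
  Sqc cyclic_square k 'X_[mofs e] =
  \sum_(c <- cvec k e) 'X_[[multinom (nth 0 e i - nth 0 c i + (nth 0 c (ordS i)).*2)%N | i < n]].
Proof.
move=> se; rewrite Sqc_mofs //; apply: eq_big_seq => c cP.
rewrite mpolyXE_id big_split /=.
(* The index i contributes a power of x_{i-1}; reindexing collects it at the variable it belongs to,
   hence [ordS]. *)
rewrite [X in _ * X](reindex_inj (@ordS_inj n)) -big_split /=.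
apply: eq_bigr => i _; rewrite /cyclic_square ordSK -exprM -exprD mnmE.
by congr (_ ^+ _); rewrite mul2n.
Qed.
End Monomials.

(** * Certificates for hit monomials *)

Fixpoint toggle (T : eqType) (x : T) (l : seq T) : seq T :=
  if l is y :: l' then if x == y then l' else y :: toggle x l' else [:: x].

(** A list is a sum mod 2, so equal terms cancel in pairs and [nilp] becomes a test for zero. *)
Definition norm (T : eqType) (l : seq T) : seq T := foldr (@toggle T) [::] l.

Lemma sum_norm (T : eqType) (V : zmodType) (F : T -> V) (l : seq T) :
  (forall v : V, v + v = 0) -> \sum_(x <- norm l) F x = \sum_(x <- l) F x.
Proof.
move=> V2; elim: l => //= x l IH; rewrite big_cons -{}IH.
elim: (norm l) => [|y r IH] /=; first by rewrite big_seq1 big_nil addr0.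
case: eqP => [->|_]; first by rewrite big_cons addrA V2 add0r.
by rewrite !big_cons IH addrCA.
Qed.

Lemma mem_cvec k e c : (c \in cvec k e) =
  [&& size c == size e, sumn c == k & all (fun p => obin p.1 p.2) (zip e c)].
Proof.
elim: e k c => [|a e IH] k c.
  by case: k => [|k]; case: c => [|x c].
case: c => [|x c].
  apply/negbTE; apply/negP; rewrite cvec_cons.
  by move=> /flattenP[_ /mapP[j _ ->] /mapP[]].
rewrite cvec_cons; set l := [seq j <- _ | obin a j].
have lP y : (y \in l) = obin a y && (y <= minn k a)%N.
  by rewrite mem_filter mem_iota add0n ltnS.
clearbody l; apply/flattenP/and3P => /=.
  case=> [_ /mapP[j jP ->] /mapP[c' c'P [-> ->]]].
  move: jP c'P; rewrite lP IH => /andP[oj jk] /and3P[/eqP-> /eqP-> ->].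
  by rewrite eqxx oj; split=> //; lia.
case=> /eqP[sc] /eqP sk /andP[ox xa].
exists [seq x :: c' | c' <- cvec (k - x) e]; last first.
  by apply: map_f; rewrite IH sc eqxx xa andbT; lia.
apply/mapP; exists x => //; rewrite lP ox leq_min /=.
suff: (x <= a)%N by lia.
by move: ox; rewrite obinE; apply: contraLR; rewrite -ltnNge => ax; rewrite bin_small.
Qed.

Lemma uniq_flatten_cons (l : seq nat) (F : nat -> seq (seq nat)) :
  uniq l -> (forall x, uniq (F x)) ->
  uniq (flatten [seq [seq x :: c | c <- F x] | x <- l]).
Proof.
move=> ul uF; elim: l ul => //= x l IH /andP[xl ul].
rewrite cat_uniq map_inj_uniq ?uF ?IH ?andbT //=; last by move=> ? ? [].
apply/hasPn => c /flattenP[_ /mapP[y yl ->] /mapP[c' _ ->]].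
by apply/negP => /mapP[c'' _ [yx _]]; rewrite yx (negbTE xl) in yl.
Qed.

Lemma uniq_cvec k e : uniq (cvec k e).
Proof.
elim: e k => [|a e IH] k; first by case: k.
by rewrite cvec_cons uniq_flatten_cons // filter_uniq ?iota_uniq.
Qed.

(** The list form of the exponent in [Sqc_cyclic]; [rot 1 c] supplies c_{i+1} at position i. *)
Definition shift_exp (e c : seq nat) : seq nat :=
  [seq (p.1 - p.2.1 + p.2.2.*2)%N | p <- zip e (zip c (rot 1 c))].

Definition cyclic_sqs (k : nat) (e : seq nat) : seq (seq nat) := [seq shift_exp e c | c <- cvec k e].

(** If x^m is the term of Sq^k x^e given by c, then 2 c_{i+1} <= m_i. So [box (rotr 1 m)] is a
    finite search space for c that depends on the target only. *)
Fixpoint box (m : seq nat) : seq (seq nat) :=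
  if m is a :: m' then
    flatten [seq [seq x :: c | c <- box m'] | x <- iota 0 a./2.+1]
  else [:: [::]].

Lemma mem_box m c : (c \in box m) =
  (size c == size m) && all (fun p => p.2 <= p.1./2)%N (zip m c).
Proof.
elim: m c => [|a m IH] [|x c] //; rewrite /box -/box.
  by apply/negbTE/negP => /flattenP[_ /mapP[j _ ->] /mapP[]].
apply/flattenP/andP; rewrite [zip _ _]/= [all _ _]/= [size _]/= [size (a :: m)]/= eqSS.
  case=> [_ /mapP[j jP ->] /mapP[c' c'P [-> ->]]].
  move: jP c'P; rewrite (mem_iota 0 a./2.+1) IH => jk /andP[/eqP-> ->].
  by rewrite eqxx andbT; split=> //; lia.
case=> /eqP[sc] /andP[xa ca].
exists [seq x :: c' | c' <- box m]; last by apply: map_f; rewrite IH sc eqxx ca.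
by apply/mapP; exists x => //; rewrite (mem_iota 0 a./2.+1); lia.
Qed.

Lemma uniq_box m : uniq (box m).
Proof. by elim: m => // a m IH; apply: uniq_flatten_cons => //; rewrite iota_uniq. Qed.

(** The equation [shift_exp e c = m] solved for e; inside the box the truncated subtraction is
    exact. *)
Definition src_exp (m c : seq nat) : seq nat :=
  [seq (p.1 + p.2.1 - p.2.2.*2)%N | p <- zip m (zip c (rot 1 c))].

(* All (k, e), k > 0, such that x^m occurs in Sq^k x^e, with multiplicity. *)
Definition cofaces (m : seq nat) : seq (nat * seq nat) :=
  [seq (sumn c, src_exp m c)
  | c <- box (rotr 1 m) & (0 < sumn c)%N && all (fun p => obin p.1 p.2) (zip (src_exp m c) c)].

Lemma size6P (e : seq nat) : size e = 6%N ->
  exists a0 a1 a2 a3 a4 a5, e = [:: a0; a1; a2; a3; a4; a5].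
Proof.
by case: e => [|a0 [|a1 [|a2 [|a3 [|a4 [|a5 [|]]]]]]] //= _; exists a0, a1, a2, a3, a4, a5.
Qed.

(** Both sides count the same vectors c, so [cofaces] is the transpose of the matrix of the squares.
    It allows a functional to be tested against all sources (k, e) at once. *)
Lemma count_cofaces m k e : size m = 6%N -> size e = 6%N -> (0 < k)%N ->
  count_mem m (cyclic_sqs k e) = count_mem (k, e) (cofaces m).
Proof.
move=> sm se k0; rewrite /cyclic_sqs /cofaces !count_map count_filter -!size_filter.
apply: perm_size; apply: uniq_perm; rewrite ?filter_uniq ?uniq_cvec ?uniq_box //.
move=> c; rewrite !mem_filter mem_cvec mem_box /= size_rotr sm se.
case: (boolP (size c == 6%N)) => [/eqP sc|]; last by rewrite !andbF.
have [a0 [a1 [a2 [a3 [a4 [a5 ->]]]]]] := size6P se.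
have [m0 [m1 [m2 [m3 [m4 [m5 ->]]]]]] := size6P sm.
have [c0 [c1 [c2 [c3 [c4 [c5 ->]]]]]] := size6P sc.
rewrite /shift_exp /src_exp /rot /rotr /= /rot /= !xpair_eqE !eqseq_cons !andbT.
set s := (c0 + _)%N.
have ob a c' : obin a c' -> (c' <= a)%N.
  by rewrite obinE; apply: contraLR; rewrite -ltnNge => ?; rewrite bin_small.
apply/idP/idP.
  move=> /andP[/and5P[/eqP h0 /eqP h1 /eqP h2 /eqP h3 /andP[/eqP h4 /eqP h5]]].
  move=> /and5P[sk o0 o1 o2 /and3P[o3 o4 o5]].
  have := (ob _ _ o0, ob _ _ o1, ob _ _ o2, ob _ _ o3, ob _ _ o4, ob _ _ o5).
  move=> [[[[[l0 l1] l2] l3] l4] l5].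
  rewrite -h0 -h1 -h2 -h3 -h4 -h5.
  rewrite (_ : (a0 - c0 + c1.*2 + c0 - c1.*2 = a0)%N); last lia.
  rewrite (_ : (a1 - c1 + c2.*2 + c1 - c2.*2 = a1)%N); last lia.
  rewrite (_ : (a2 - c2 + c3.*2 + c2 - c3.*2 = a2)%N); last lia.
  rewrite (_ : (a3 - c3 + c4.*2 + c3 - c4.*2 = a3)%N); last lia.
  rewrite (_ : (a4 - c4 + c5.*2 + c4 - c5.*2 = a4)%N); last lia.
  rewrite (_ : (a5 - c5 + c0.*2 + c5 - c0.*2 = a5)%N); last lia.
  by rewrite !eqxx sk o0 o1 o2 o3 o4 o5 (eqP sk) k0 /=; repeat (apply/andP; split); lia.
case/andP=> /andP[/andP[sk /and5P[/eqP h0 /eqP h1 /eqP h2 /eqP h3 /andP[/eqP h4 /eqP h5]]] /andP[_]].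
rewrite h0 h1 h2 h3 h4 h5 => os /and5P[b0 b1 b2 b3 /andP[b4 b5]].
rewrite sk os /= andbT.
move: os => /and5P[o0 o1 o2 o3 /andP[o4 o5]].
have := (ob _ _ o0, ob _ _ o1, ob _ _ o2, ob _ _ o3, ob _ _ o4, ob _ _ o5).
move=> [[[[[l0 l1] l2] l3] l4] l5].
by repeat (apply/andP; split); lia.
Qed.

(* The sum of the coefficients of the monomials in lam vanishes on all hits. *)
Definition kills (lam : seq (seq nat)) : bool :=
  nilp (norm (flatten [seq cofaces m | m <- lam])).

(* The coefficient of x^m in the product of K and (sum of the x_i, i in I)^e. *)
Fixpoint coef_powM (K : seq nat -> bool) (I : seq nat) (e : nat) (m : seq nat) : bool :=
  if I is i :: I' then
    foldr (fun c b =>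
      if obin e c then
        addb (coef_powM K I' (e - c)%N (set_nth 0%N m i (nth 0%N m i - c)%N)) b else b) false
      (iota 0 (minn e (nth 0%N m i)).+1)
  else if e is 0%N then K m else false.

Definition coef_pows (fs : seq (seq nat * nat)) : seq nat -> bool :=
  foldr (fun f K => coef_powM K f.1 f.2) (all (pred1 0%N)) fs.

(* x_i |-> x_i + x_{i+1} + x_{i+3}. *)
Definition subst_rows : seq (seq nat) :=
  [:: [:: 0; 1; 3]; [:: 1; 2; 4]; [:: 2; 3; 5]; [:: 3; 4; 0]; [:: 4; 5; 1]; [:: 5; 0; 2]]%N.

Definition coefsum_subst (lam : seq (seq nat)) (q : seq nat) : bool :=
  foldr (fun m b => addb (coef_pows (zip subst_rows q) m) b) false lam.

Fixpoint expvecs (k n : nat) : seq (seq nat) :=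
  if k is k'.+1 then
    flatten [seq [seq a :: e | e <- expvecs k' (n - a)] | a <- iota 0 n.+1]
  else if n is 0%N then [:: [::]] else [::].

Lemma mem_expvecs k n e : size e = k -> sumn e = n -> e \in expvecs k n.
Proof.
elim: k n e => [|k IH] n [|a e] //; first by move=> _ <-.
move=> [se] sn; rewrite [sumn _]/= in sn; rewrite /expvecs -/expvecs; apply/flattenP; exists [seq a :: e' | e' <- expvecs k (n - a)].
  by apply/mapP; exists a => //; rewrite (mem_iota 0 n.+1); lia.
by apply: map_f; apply: IH => //; lia.
Qed.

(** Horner's rule for sum_i e_i 2^i: the element a of L^* multiplies x^e by a to this power. *)
Definition wt (e : seq nat) : nat := foldr (fun a w => (a + w.*2)%N) 0%N e.

(* Each (e, g) rewrites x^e as a sum of known monomials, modulo the hit which is the sum of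
   the Sq^k x^e' over the (k, e') in g. *)
Fixpoint steps_ok (known : seq (seq nat)) (st : seq (seq nat * seq (nat * seq nat))) : bool :=
  if st is (e, g) :: st' then
    [&& size e == 6%N, all (fun x => (0 < x.1)%N && (size x.2 == 6%N)) g,
        all (mem known) (norm (e :: flatten [seq cyclic_sqs x.1 x.2 | x <- g])) &
        steps_ok (e :: known) st']
  else true.

(* For each (q, lam), summing the coefficients at lam gives a functional that vanishes on hits and
   on qs, and whose value on the image under 1 + s + s^3 of x^q, resp. x^q' for a later q', is 1,
   resp. 0. Such a triangular system has no nonzero invariant combination of qs. *)
Fixpoint rows_ok (qs : seq (seq nat)) (sel : seq (seq nat * seq (seq nat))) : bool :=
  if sel is (q, lam) :: sel' then
    [&& all (fun m => (size m == 6%N) && (m \notin qs)) lam, kills lam, coefsum_subst lam q,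
        all (fun x => ~~ coefsum_subst lam x.1) sel' & rows_ok qs sel']
  else true.

(** Monomials of weight not divisible by 63 disappear in the average over L^*, so only the others
    must be reduced to the representatives [qs]. *)
Definition cert_ok (n : nat) (st : seq (seq nat * seq (nat * seq nat)))
    (sel : seq (seq nat * seq (seq nat))) : bool :=
  let qs := map fst sel in
  let known := map fst st ++ qs in
  [&& uniq qs, all (fun q => size q == 6%N) qs,
      all (fun e => (63 %| wt e)%N ==> (e \in known)) (expvecs 6 n),
      steps_ok qs st & rows_ok qs sel].

(** * Invariants over the field with 64 elements *)

Section Core.
Variable L : finFieldType.
Hypothesis L2 : 2%N \in [pchar L].
Hypothesis cardL : #|L| = 64%N.

Local Notation PL := {mpoly L[6]}.
Local Notation Xe e := ('X_[mofs 6 e] : PL).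
Local Notation cHit := (Hit (@cyclic_square 6 L)).

Lemma PL2 (p : PL) : p + p = 0.
Proof. by rewrite -mulr2n -mulr_natl -mpolyC_nat (pcharf0 L2) mpolyC0 mul0r. Qed.

Lemma L2D (x : L) : x + x = 0.
Proof. by rewrite -mulr2n -mulr_natl (pcharf0 L2) mul0r. Qed.

Lemma oppPL (p : PL) : - p = p.
Proof. by apply/eqP; rewrite eq_sym -addr_eq0 PL2. Qed.

Lemma mofs_shift_exp e c : size e = 6%N -> size c = 6%N ->
  mofs 6 (shift_exp e c) =
  [multinom (nth 0%N e i - nth 0%N c i + (nth 0%N c (ordS i)).*2)%N | i < 6].
Proof.
move=> se sc.
have [a0 [a1 [a2 [a3 [a4 [a5 ->]]]]]] := size6P se.
have [c0 [c1 [c2 [c3 [c4 [c5 ->]]]]]] := size6P sc.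
by apply/mnmP => i; rewrite !mnmE; case: i => [[|[|[|[|[|[|]]]]]] //].
Qed.

Lemma size_shift_exp e c : size e = 6%N -> size c = 6%N -> size (shift_exp e c) = 6%N.
Proof. by move=> se sc; rewrite size_map !size_zip size_rot se sc. Qed.

Lemma size_cyclic_sqs k e x : size e = 6%N -> x \in cyclic_sqs k e -> size x = 6%N.
Proof. by move=> se /mapP[c cP ->]; apply: size_shift_exp => //; rewrite (size_cvec cP). Qed.

Lemma Sqc_cyclic_sqs k e : size e = 6%N -> Sqc (@cyclic_square 6 L) k (Xe e) = \sum_(x <- cyclic_sqs k e) Xe x.
Proof.
move=> se; rewrite Sqc_cyclic // big_map; apply: eq_big_seq => c cP.
by rewrite mofs_shift_exp // (size_cvec cP).
Qed.

Definition inspan (qs : seq (seq nat)) (p : PL) : Prop :=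
  exists a : seq nat -> L, cHit (p - \sum_(q <- qs) a q *: Xe q).

Lemma inspan_q qs q : uniq qs -> q \in qs -> inspan qs (Xe q).
Proof.
move=> uq qin; exists (fun q' => (q' == q)%:R).
rewrite (bigD1_seq q) //= eqxx scale1r big1 ?addr0 ?subrr; first exact: Hit0.
by move=> q' /negbTE->; rewrite scale0r.
Qed.

Lemma inspanD qs p p' : inspan qs p -> inspan qs p' -> inspan qs (p + p').
Proof.
move=> [a Ha] [a' Ha']; exists (fun q => a q + a' q).
rewrite (eq_bigr _ (fun _ _ => scalerDl _ _ _)) big_split /= opprD addrACA.
exact: HitD.
Qed.

Lemma inspanZ qs c p : inspan qs p -> inspan qs (c *: p).
Proof.
move=> [a Ha]; exists (fun q => c * a q).
rewrite (eq_bigr (fun q => c *: (a q *: Xe q))); last by move=> *; rewrite scalerA.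
by rewrite -scaler_sumr -scalerBr; apply: HitZ.
Qed.

Lemma inspan_hit qs p : cHit p -> inspan qs p.
Proof. by move=> Hp; exists (fun=> 0); rewrite big1 ?subr0 // => i _; rewrite scale0r. Qed.

Lemma inspan_sum qs I (r : seq I) (P : pred I) (F : I -> PL) :
  (forall i, P i -> inspan qs (F i)) -> inspan qs (\sum_(i <- r | P i) F i).
Proof.
move=> HF; apply: (big_ind (inspan qs)) => //; last exact: inspanD.
by apply: inspan_hit; exact: Hit0.
Qed.

Lemma steps_okP qs known st : steps_ok known st ->
  (forall e, e \in known -> inspan qs (Xe e)) ->
  forall e, e \in map fst st ++ known -> inspan qs (Xe e).
Proof.
elim: st known => [|[e0 g] st IH] known /=; first by move=> _ H e /H.
case/and4P=> /eqP se0 /allP gP /allP nP stP Hk e.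
rewrite inE => eP; apply: (IH _ stP); last first.
  by move: eP; rewrite !mem_cat inE orbCA.
move=> {eP}e; rewrite inE => /orP[/eqP-> {e}|]; last exact: Hk.
have /(sum_norm (fun e => Xe e) (e0 :: flatten [seq cyclic_sqs x.1 x.2 | x <- g])) := PL2.
rewrite big_cons big_flatten big_map /= => E.
(* The hit terms of the certificate are added and taken away again: with them, x^e0 is a sum of
   known monomials. *)
rewrite -[Xe e0](addrK (\sum_(x <- g) \sum_(y <- cyclic_sqs x.1 x.2) Xe y)) -E oppPL.
apply: inspanD.
  by rewrite big_seq; apply: inspan_sum => x /nP; apply: Hk.
apply: inspan_hit; rewrite big_seq; apply: Hit_sum => x /gP /andP[x0 /eqP sx].
by rewrite -Sqc_cyclic_sqs //; apply: Hit_Sqc.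
Qed.

Definition coefsum (lam : seq (seq nat)) (p : PL) : L := \sum_(m <- lam) p@_(mofs 6 m).

Fact coefsum_is_additive lam : zmod_morphism (coefsum lam).
Proof. by move=> p q; rewrite /coefsum -sumrB; apply: eq_bigr => m _; rewrite mcoeffB. Qed.
HB.instance Definition _ lam := GRing.isZmodMorphism.Build _ _ (coefsum lam) (coefsum_is_additive lam).

Lemma coefsumZ lam c p : coefsum lam (c *: p) = c * coefsum lam p.
Proof. by rewrite /coefsum big_distrr; apply: eq_bigr => m _; rewrite mcoeffZ. Qed.

Lemma coefsum_X lam e : size e = 6%N -> all (fun m => size m == 6%N) lam ->
  coefsum lam (Xe e) = (count_mem e lam)%:R.
Proof.
move=> se; elim: lam => [|m lam IH] /=; first by rewrite /coefsum big_nil.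
move=> /andP[/eqP sm /IH IHl]; rewrite /coefsum big_cons -/(coefsum lam _) IHl natrD mcoeffX.
congr (_%:R + _); congr (nat_of_bool _).
by apply/eqP/eqP => [/(mofs_inj se sm)->|->].
Qed.

Lemma mofs_cover (m : 'X_{1..6}) : exists2 e, size e = 6%N & m = mofs 6 e.
Proof. by exists (sofm m); rewrite ?size_sofm ?sofmK. Qed.

(** By transposition, the value on Sq^k x^e is the number of occurrences of (k, e) among the cofaces
    of [lam], and [kills] makes each of these numbers even. *)
Lemma coefsum_hit lam p : all (fun m => size m == 6%N) lam -> kills lam ->
  cHit p -> coefsum lam p = 0.
Proof.
move=> sl kl [r ->]; rewrite raddf_sum big1 //= => [[k q]] _ /=.
rewrite (mpolyE q) !raddf_sum big1 //= => m _.
rewrite SqcZ coefsumZ; have [e se ->] := mofs_cover m.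
suff ->: coefsum lam (Sqc (@cyclic_square 6 L) k.+1 (Xe e)) = 0 by rewrite mulr0.
rewrite Sqc_cyclic_sqs // raddf_sum /=.
rewrite (eq_big_seq (fun x => \sum_(m <- lam) (x == m)%:R)); last first.
  move=> x /size_cyclic_sqs - /(_ se) sx; rewrite coefsum_X // -sum1_count natr_sum big_mkcond.
  by apply: eq_bigr => m' _ /=; rewrite eq_sym; case: eqP.
rewrite exchange_big /=.
rewrite (eq_big_seq (fun m => \sum_(x <- cofaces m) ((x == (k.+1, e))%:R : L))); last first.
  move=> m' /(allP sl) /eqP sm'.
  have := count_cofaces sm' se (ltn0Sn k).
  rewrite -!sum1_count => /(congr1 (fun x => x%:R : L)); rewrite !natr_sum !big_mkcond /= => E.
  transitivity (\sum_(i <- cyclic_sqs k.+1 e) (if i == m' then 1 else 0 : L)).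
    by apply: eq_bigr => i _; case: eqP.
  by rewrite E big_mkcond; apply: eq_bigr => i _; case: eqP.
rewrite -(big_map _ xpredT (fun r => \sum_(x <- r) ((x == (k.+1, e))%:R : L))) -big_flatten /=.
rewrite -(sum_norm _ _ L2D).
by move: kl; rewrite /kills => /nilP ->; rewrite big_nil.
Qed.

Definition varsum (I : seq nat) : PL := \sum_(i <- I) 'X_(inord i).

Lemma coefXnM (i : 'I_6) c (p : PL) m : size m = 6%N ->
  ('X_i ^+ c * p)@_(mofs 6 m) =
  if (c <= nth 0 m i)%N then p@_(mofs 6 (set_nth 0%N m i (nth 0 m i - c)%N)) else 0.
Proof.
move=> sm; case: leqP => cm.
  rewrite (_ : mofs 6 m = (U_(i) *+ c + mofs 6 (set_nth 0%N m i (nth 0%N m i - c)%N))%MM); last first.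
    apply/mnmP => j; rewrite mnmDE mulmnE mnm1E !mnmE nth_set_nth /=.
    by rewrite -val_eqE /= [nat_of_ord j == _]eq_sym; case: eqP => [<-|_]; lia.
  by rewrite mpolyXn mulrC mcoeffMX.
rewrite mcoeffM big1 // => /= [[m1 m2]] /= /eqP E.
rewrite mpolyXn mcoeffX.
case: eqP => [E1|]; last by rewrite mul0r.
have := congr1 (fun m : 'X_{1..6} => m i) E; rewrite -E1 mnmDE mulmnE mnm1E eqxx mnmE.
by lia.
Qed.

Lemma coef_powM_cons K i I e m : coef_powM K (i :: I) e m =
  foldr (fun c b => if obin e c then
      addb (coef_powM K I (e - c) (set_nth 0%N m i (nth 0%N m i - c)%N)) b else b) false
    (iota 0 (minn e (nth 0%N m i)).+1).
Proof. by []. Qed.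

(** The binomial theorem peels off one variable of [I] at a time; [coef_powM] runs the same
    recursion on parities. *)
Lemma coef_powMP (K : seq nat -> bool) (p : PL) I e m :
  (forall m, size m = 6%N -> p@_(mofs 6 m) = (K m)%:R) ->
  all (fun i => i < 6)%N I -> size m = 6%N ->
  (varsum I ^+ e * p)@_(mofs 6 m) = (coef_powM K I e m)%:R.
Proof.
move=> pK; elim: I e m => [|i I IH] e m.
  rewrite /varsum big_nil => _ sm; rewrite /coef_powM; case: e => [|e]; first by rewrite mul1r pK.
  by rewrite expr0n mul0r mcoeff0.
case/andP=> i6 I6 sm; have := coef_powM_cons K i I e m; move: (coef_powM K (i :: I) e m) => b Eb.
have iE : (inord i : 'I_6) = i :> nat by rewrite inordK.
rewrite /varsum big_cons -/(varsum I) addrC exprDn mulr_suml raddf_sum /=.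
rewrite (eq_bigr (fun c : 'I_e.+1 =>
  if (c <= nth 0 m i)%N && obin e c
  then ((coef_powM K I (e - c) (set_nth 0%N m i (nth 0%N m i - c)%N))%:R : L) else 0)); last first.
  move=> c _; rewrite mulrnAl mcoeffMn -mulrA mulrCA coefXnM // iE; case: leqP => cm /=; last by rewrite mul0rn.
  rewrite IH // ?size_set_nth ?sm; last by apply/maxn_idPr.
  by rewrite -[LHS]mulr_natr (natr_odd L2 'C(_, _)) -obinE; case: obin; rewrite ?mulr1 ?mulr0.
rewrite -(big_mkord xpredT (fun c => if (c <= nth 0 m i)%N && obin e c then
   ((coef_powM K I (e - c) (set_nth 0%N m i (nth 0%N m i - c)%N))%:R : L) else 0)).
have le : ((minn e (nth 0%N m i)).+1 <= e.+1)%N by rewrite ltnS geq_minl.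
rewrite (big_cat_nat (leq0n _) le) /= [X in _ + X]big_nat_cond.
rewrite [X in _ + X]big1 ?addr0; last first.
  by move=> c /andP[/andP[c1 c2] _]; rewrite ifF //; apply/negbTE; rewrite negb_and; lia.
rewrite /index_iota subn0 {b}Eb.
have: all (fun c => c <= nth 0 m i)%N (iota 0 (minn e (nth 0%N m i)).+1).
  by apply/allP => c; rewrite (mem_iota 0 (minn e (nth 0%N m i)).+1); lia.
elim: (iota _ _) => [|c r IHr] /=; first by rewrite big_nil.
case/andP=> cm rm; rewrite big_cons IHr // cm /=.
case: obin; rewrite ?add0r //; case: coef_powM; case: (foldr _ _ _) => //=.
- by rewrite L2D.
- by rewrite addr0.
- by rewrite add0r.
by rewrite addr0.
Qed.

Lemma coef_powsP fs m : all (fun f => all (fun i => i < 6)%N f.1) fs -> size m = 6%N ->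
  (\prod_(f <- fs) varsum f.1 ^+ f.2)@_(mofs 6 m) = (coef_pows fs m)%:R.
Proof.
elim: fs m => [|[I e] fs IH] m /=.
  move=> _ sm; rewrite big_nil mcoeff1; congr (nat_of_bool _)%:R.
  apply/eqP/allP => [E x xm|H].
    have := nth_index 0%N xm => <-.
    have xi : (index x m < 6)%N by rewrite -sm index_mem.
    have := congr1 (fun m : 'X_{1..6} => m (Ordinal xi)) E.
    by rewrite mnmE mnm0E => /= ->.
  by apply/mnmP => i; rewrite mnmE mnm0E; apply/eqP/H/mem_nth; rewrite sm.
by case/andP=> I6 fs6 sm; rewrite big_cons; apply: coef_powMP => // m' sm'; apply: IH.
Qed.

Definition uX (i : 'I_6) : PL := 'X_i + 'X_(ordS i) + 'X_(ordS (ordS (ordS i))).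
Definition usub : PL -> PL := comp_mpoly [tuple uX i | i < 6].
HB.instance Definition _ := GRing.RMorphism.on usub.

Lemma usubX i : usub 'X_i = uX i.
Proof. by rewrite /usub comp_mpolyXU -tnth_nth tnth_mktuple. Qed.

(** Squaring is additive, and the substitution commutes with the cyclic shift of the indices that
    defines [cyclic_square]. *)
Lemma usub_hit p : cHit p -> cHit (usub p).
Proof.
apply: Hit_morph => [c|i]; first by exists c; exact: comp_mpolyC.
rewrite /cyclic_square rmorphXn /= !usubX /uX !rmorphD /= !StotX ?polyCD !ord_predK.
have sqD (a b : PL) : (a + b) ^+ 2 = a ^+ 2 + b ^+ 2.
  by rewrite sqrrD mulr2n PL2 addr0.
rewrite !sqD /cyclic_square !ordSK !scalerDl.
have sum3 (V : zmodType) (a A b B c C : V) :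
    a + A + (b + B) + (c + C) = a + b + c + (A + B + C).
  by rewrite (addrACA a A b B) (addrACA (a + b) (A + B) c C).
exact: sum3.
Qed.

Lemma uX_subst_rows (i : 'I_6) : uX i = varsum (nth [::] subst_rows i).
Proof.
rewrite (_ : nth _ _ _ = [seq val j | j <- [:: i; ordS i; ordS (ordS (ordS i))]]).
  by rewrite /varsum big_map !big_cons big_nil !inord_val addr0 addrA.
by case: i => [[|[|[|[|[|[|]]]]]] //].
Qed.

Lemma coefsum_substE lam q : size q = 6%N -> all (fun m => size m == 6%N) lam ->
  coefsum lam (usub (Xe q)) = (coefsum_subst lam q)%:R.
Proof.
move=> sq; elim: lam => [|m lam IH] /=; first by rewrite /coefsum big_nil.
case/andP=> /eqP sm sl; rewrite /coefsum big_cons -/(coefsum lam _) IH //.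
have -> : (usub (Xe q))@_(mofs 6 m) = (coef_pows (zip subst_rows q) m)%:R.
  rewrite -coef_powsP //; last first.
    by have [a0 [a1 [a2 [a3 [a4 [a5 ->]]]]]] := size6P sq.
  congr (_@__); rewrite /usub comp_mpolyX (big_nth ([::], 0%N)) big_mkord size_zip sq /=.
  apply: eq_bigr => i _; rewrite tnth_mktuple nth_zip ?sq //= mnmE uX_subst_rows //.
by rewrite /coefsum_subst /=; case: coef_pows; case: foldr; rewrite //= ?addr0 ?add0r ?L2D.
Qed.

Lemma rows_okP qs sel (a : seq nat -> L) :
  rows_ok qs sel -> all (fun q => size q == 6%N) (map fst sel) -> uniq (map fst sel) ->
  {subset map fst sel <= qs} ->
  cHit (\sum_(q <- map fst sel) a q *: (usub (Xe q) - Xe q)) ->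
  forall q, q \in map fst sel -> a q = 0.
Proof.
elim: sel => [|[q lam] sel IH] //= /and5P[lP kl lq ls rs] /andP[/eqP sq ss] /andP[nq us] sub.
have sl : all (fun m => size m == 6%N) lam by apply: sub_all lP => m /andP[].
have lX x : size x = 6%N -> x \in qs -> coefsum lam (Xe x) = 0.
  move=> sx xq; rewrite coefsum_X //.
  suff -> : count_mem x lam = 0%N by [].
  apply/count_memPn/negP => xl.
  by have /andP[_ /negP] := allP lP _ xl.
move=> H.
(* [lam] avoids [qs], so it vanishes on all the x^q; among the images it sees only that of the first
   q, which isolates its coefficient. *)
have aq : a q = 0.
  have := coefsum_hit sl kl H; rewrite raddf_sum big_cons /= coefsumZ raddfB /=.
  rewrite coefsum_substE // lq lX ?sub ?mem_head // subr0 mulr1.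
  rewrite big_map big_seq big1 ?addr0 // => x xs.
  have xm : x.1 \in map fst sel by apply: map_f.
  have /eqP sx := allP ss _ xm.
  rewrite coefsumZ raddfB /= coefsum_substE // (negbTE (allP ls x xs)) lX ?subr0 ?mulr0 //.
  by apply: sub; rewrite inE xm orbT.
move=> x; rewrite inE => /orP[/eqP->//|]; apply: IH => //.
  by move=> y ys; apply: sub; rewrite inE ys orbT.
by move: H; rewrite big_cons aq scale0r add0r.
Qed.

(** Orthogonality of characters of the cyclic group L^*: the sum is fixed by multiplication by z^w,
    for z a generator. When the character is trivial the value is 63, which is 1 in [L]. *)
Lemma sum_expf_nz (w : nat) :
  \sum_(a : L | a != 0) a ^+ w = (63 %| w)%N%:R.
Proof.
have c63 : #|[pred a : L | a != 0]| = 63%N by rewrite cardC1 cardL.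
case: (boolP (63 %| w)%N) => [/dvdnP[k ->]|nw] /=.
  rewrite (eq_bigr (fun=> 1)) => [|a a0].
    by rewrite sumr_const c63 (natr_odd L2).
  rewrite mulnC exprM; have := expf_card a; rewrite cardL => E.
  have -> : a ^+ 63 = 1; last by rewrite expr1n.
  by apply: (mulfI a0); rewrite mulr1 -exprS.
have /hasP[z _ zP] : has 63.-primitive_root (enum [pred a : L | a != 0]).
  apply: has_prim_root; rewrite ?enum_uniq // -?cardE ?c63 //.
  apply/allP => a; rewrite mem_enum inE => a0; apply/unity_rootP.
  have := expf_card a; rewrite cardL => E.
  by apply: (mulfI a0); rewrite mulr1 -exprS.
have z0 : z != 0.
  apply/eqP => z0; have := prim_expr_order zP.
  by rewrite z0 expr0n /= => /esym /eqP; rewrite oner_eq0.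
have zw : z ^+ w != 1 by rewrite -(prim_order_dvd zP).
set S := LHS.
have : z ^+ w * S = S.
  rewrite /S mulr_sumr [RHS](reindex_inj (mulfI z0)).
  by apply: eq_big => [a|a _]; rewrite ?mulf_eq0 ?(negbTE z0) // exprMn.
move/eqP; rewrite -subr_eq0 -{2}[S]mul1r -mulrBl mulf_eq0 subr_eq0 (negbTE zw) /=.
by move/eqP.
Qed.

Definition diag (a : L) : 6.-tuple PL := [tuple a ^+ (2 ^ i)%N *: 'X_i | i < 6].

Lemma diag_X a e : size e = 6%N -> Xe e \mPo diag a = a ^+ wt e *: Xe e.
Proof.
move=> se; rewrite comp_mpolyX.
rewrite (eq_bigr (fun i : 'I_6 => (a ^+ (2 ^ i * mofs 6 e i)%N) *: ('X_i ^+ mofs 6 e i))); last first.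
  by move=> i _; rewrite tnth_mktuple exprZn exprM.
rewrite scaler_prod -mpolyXE_id -expr_sum; congr (_ ^+ _ *: _).
have [a0 [a1 [a2 [a3 [a4 [a5 ->]]]]]] := size6P se.
rewrite !big_ord_recl big_ord0 !mnmE /= /bump /= !add1n !expnS expn0; lia.
Qed.

Lemma hit_of_cyclic_invariant n st sel (f : PL) : cert_ok n st sel ->
  (forall m, f@_m != 0 -> mdeg m = n) ->
  (forall a, a != 0 -> cHit ((f \mPo diag a) - f)) -> cHit (usub f - f) -> cHit f.
Proof.
case/and5P=> uq /allP sq /allP wq stok rok homf Hdiag Hu.
have st_in := steps_okP stok (fun e => @inspan_q _ e uq).
set qs := map fst sel in uq sq wq stok rok st_in.
have : inspan qs f.
  pose g := \sum_(m <- msupp f) (63 %| wt (sofm m))%N%:R *: (f@_m *: 'X_[m] : PL).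
  have gs : inspan qs g.
    rewrite /g big_seq; apply: inspan_sum => m; rewrite mcoeff_msupp => /homf dm.
    case: (boolP (63 %| _)%N) => wm; last by rewrite scale0r; apply: inspan_hit; apply: Hit0.
    rewrite scale1r; apply: inspanZ; rewrite -{1}(sofmK m); apply: st_in.
    have me : sofm m \in expvecs 6 n.
      apply: mem_expvecs; first exact: size_sofm.
      by rewrite -dm /sofm sumnE big_map big_enum /= mdegE.
    by have /implyP/(_ wm) := wq _ me.
  suff : cHit (g - f).
    move/HitN; rewrite opprB => Hgf.
    by rewrite -(subrK g f); apply: inspanD => //; apply: inspan_hit.
  have : cHit (\sum_(a : L | a != 0) ((f \mPo diag a) - f)) by apply: Hit_sum.
  have c63 : #|[pred a : L | a != 0]| = 63%N by rewrite cardC1 cardL.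
  (* Since 63 is odd, the sum of 63 copies of f is f itself: the sum over L^* already is the
     average. *)
  rewrite sumrB sumr_const c63 -[f *+ 63]mulr_natl -mpolyC_nat (natr_odd L2 63) mpolyC1 mul1r.
  rewrite (_ : \sum_(a : L | a != 0) _ = g) //.
  rewrite (eq_bigr (fun a => \sum_(m <- msupp f) a ^+ wt (sofm m) *: (f@_m *: 'X_[m] : PL))).
    rewrite exchange_big /=; apply: eq_bigr => m _.
    by rewrite -scaler_suml sum_expf_nz.
  move=> a _; rewrite {1}(mpolyE f) raddf_sum /=; apply: eq_bigr => m _.
  rewrite comp_mpolyZ; have := diag_X a (size_sofm m); rewrite sofmK => ->.
  by rewrite !scalerA mulrC.
case=> a Ha; rewrite -/qs in Ha.
have : cHit (\sum_(q <- qs) a q *: (usub (Xe q) - Xe q)).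
  move: Ha; set s := \sum_(q <- qs) _ => Ha.
  (* Here f - s is hit, and hits are stable under [usub]; subtracting its defect of invariance from
     that of f leaves the defect of s. *)
  rewrite (_ : \sum_(q <- qs) _ = usub f - f - (usub (f - s) - (f - s))).
    exact: HitB Hu (HitB (usub_hit Ha) Ha).
  transitivity (usub s - s); last by rewrite (raddfB usub); ring.
  rewrite /s raddf_sum -sumrB; apply: eq_bigr => q _.
  by rewrite scalerBr; congr (_ - _); apply/esym/comp_mpolyZ.
have sq' : all (fun q => size q == 6%N) qs by apply/allP.
move/(rows_okP rok sq' uq) => /(_ (fun q => id)) a0.
by move: Ha; rewrite big_seq big1 ?subr0 // => q /a0 ->; rewrite scale0r.
Qed.
End Core.

(** * Coordinates that diagonalise the Singer cycle *)

Definition square (n : nat) (R : comNzRingType) (i : 'I_n) : {mpoly R[n]} := 'X_i ^+ 2.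

Definition glsub (n : nat) (R : comNzRingType) (g : 'M[R]_n) : n.-tuple {mpoly R[n]} :=
  [tuple \sum_(j < n) g i j *: 'X_j | i < n].

Lemma glsubX n (R : comNzRingType) (g : 'M[R]_n) i :
  'X_i \mPo glsub g = \sum_j g i j *: 'X_j.
Proof. by rewrite comp_mpolyXU -tnth_nth tnth_mktuple. Qed.

Lemma glsub_lin n (R : comNzRingType) (g : 'M[R]_n) (F : 'I_n -> R) :
  (\sum_i F i *: 'X_i) \mPo glsub g = \sum_j (\sum_i F i * g i j) *: 'X_j.
Proof.
rewrite raddf_sum /= (eq_bigr (fun i => \sum_j (F i * g i j) *: 'X_j)); last first.
  by move=> i _; rewrite comp_mpolyZ glsubX scaler_sumr; apply: eq_bigr => j _; rewrite scalerA.
by rewrite exchange_big /=; apply: eq_bigr => j _; rewrite scaler_suml.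
Qed.

Section Coordinates.
Variable L : finFieldType.
Hypothesis L2 : 2%N \in [pchar L].
Hypothesis cardL : #|L| = 64%N.
Variable iota : {rmorphism 'F_2 -> L}.
Variables (b : 'I_6 -> L) (co : 'I_6 -> L -> 'F_2).
Hypothesis co_lin : forall j c y z, co j (iota c * y + z) = c * co j y + co j z.
Hypothesis co_b : forall j k, co j (b k) = (j == k)%:R.
Hypothesis b_co : forall y, y = \sum_j iota (co j y) * b j.

Local Notation PL := {mpoly L[6]}.

Lemma expD2 i (x y : L) : (x + y) ^+ (2 ^ i) = x ^+ (2 ^ i) + y ^+ (2 ^ i).
Proof. by apply: exprDn_pchar; rewrite pnatX pnatE ?L2. Qed.

Lemma exp_sum2 i (I : finType) (F : I -> L) :
  (\sum_k F k) ^+ (2 ^ i) = \sum_k F k ^+ (2 ^ i).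
Proof.
apply: (big_morph (fun x => x ^+ (2 ^ i))); first exact: expD2.
by rewrite expr0n expn_eq0.
Qed.

Lemma iota_exp i c : iota c ^+ (2 ^ i) = iota c.
Proof.
rewrite -rmorphXn; congr (iota _); elim: i => // i IH.
by rewrite expnS mulnC exprM IH; have := expf_card c; rewrite card_Fp.
Qed.

(** The wrap-around from 5 to 0 is the identity y^64 = y, which is why the square in the x_i is
    cyclic. *)
Lemma exp_ordS (i : 'I_6) (y : L) : y ^+ (2 ^ ordS i) = (y ^+ (2 ^ i)) ^+ 2.
Proof.
rewrite -exprM -expnSr; case: i => [[|[|[|[|[|[|]]]]]] //= _].
by have := expf_card y; rewrite cardL expr1.
Qed.

(** Row i holds the coefficients of x_i in the variables t_j. *)
Definition moore : 'M[L]_6 := \matrix_(i, j) b j ^+ (2 ^ i).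

(** A relation v between the rows makes the linearised polynomial sum_i v_i X^(2^i) vanish on the
    basis, hence on all 64 elements of [L]; its degree is at most 32, so it is zero. *)
Lemma moore_unit : moore \in unitmx.
Proof.
rewrite -row_free_unit; apply: inj_row_free => v vM.
have root y : \sum_i v 0 i * y ^+ (2 ^ (i : 'I_6)) = 0.
  rewrite [y]b_co (eq_bigr (fun i : 'I_6 => \sum_j iota (co j y) * (v 0 i * b j ^+ (2 ^ i)))); last first.
    move=> i _; rewrite exp_sum2 mulr_sumr; apply: eq_bigr => j _.
    by rewrite exprMn iota_exp mulrCA.
  rewrite exchange_big big1 //= => j _; rewrite -mulr_sumr.
  have := congr1 (fun A : 'rV[L]_6 => A 0 j) vM; rewrite !mxE => E.
  rewrite (eq_bigr (fun i => v 0 i * moore i j)) ?E ?mulr0 // => i _.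
  by rewrite mxE.
pose p : {poly L} := \sum_i v 0 i *: 'X^(2 ^ (i : 'I_6)).
have p0 : p = 0.
  apply: (@roots_geq_poly_eq0 _ _ (enum L)); rewrite ?enum_uniq //.
    apply/allP => y _; rewrite /poly.root /p horner_sum.
    by rewrite (eq_bigr (fun i : 'I_6 => v 0 i * y ^+ (2 ^ i))) ?root // => i _; rewrite hornerZ hornerXn.
  rewrite -cardE cardL; apply: (leq_trans (size_sum _ _ _)).
  apply/bigmax_leqP => i _; apply: (leq_trans (size_scale_leq _ _)); rewrite size_polyXn.
  by apply: (@leq_trans (2 ^ 5).+1); rewrite // ltnS leq_exp2l // -ltnS.
apply/rowP => k; rewrite mxE -[RHS](coef0 _ (2 ^ k)) -p0 /p coef_sum.
rewrite (bigD1 k) //= coefZ coefXn eqxx mulr1 big1 ?addr0 // => i ik.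
by rewrite coefZ coefXn eqn_exp2l // eq_sym (inj_eq val_inj) (negbTE ik) mulr0.
Qed.

Let B := invmx moore.

Lemma moore_frob i j : moore (ord_pred i) j ^+ 2 = moore i j.
Proof. by rewrite !mxE -exp_ordS ord_predK. Qed.

(** Frobenius carries row i-1 of [moore] to row i. Applied to the identity B M = 1 for M = [moore],
    it shows that the shifted Frobenius image of B is again a left inverse of M. *)
Lemma B_frob j i : B j (ord_pred i) ^+ 2 = B j i.
Proof.
pose C : 'M[L]_6 := \matrix_(j, i) (B j (ord_pred i) ^+ 2).
suff E : B = C by rewrite {2}E mxE.
have CM : C *m moore = 1%:M.
  apply/matrixP => x y; rewrite mxE.
  rewrite (eq_bigr (fun k => (B x (ord_pred k) * moore (ord_pred k) y) ^+ 2)); last first.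
    by move=> k _; rewrite mxE exprMn moore_frob.
  rewrite -(exp_sum2 1).
  have := mulVmx moore_unit => /matrixP/(_ x y).
  rewrite mxE (reindex_inj (@ord_pred_inj 6)) /= => ->.
  by rewrite mxE; case: eqP => _ /=; rewrite ?expr1n ?expr0n.
by rewrite -[RHS]mulmx1 -(mulmxV moore_unit) mulmxA CM mul1mx.
Qed.

(** The variables of the target are the x_i: each t_j is rewritten in them, and scalars are extended
    along [iota]. [B_frob] and [moore_frob] say that [theta] and [back] exchange the two total
    squares. *)
Definition theta : {mpoly 'F_2[6]} -> PL :=
  mmap (@mpolyC 6 L \o iota) (fun j => \sum_i B j i *: 'X_i).
HB.instance Definition _ := GRing.RMorphism.on theta.

Lemma thetaX j : theta 'X_j = \sum_i B j i *: 'X_i.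
Proof. by rewrite /theta mmapX mmap1U. Qed.

Lemma thetaC c : theta c%:MP = (iota c)%:MP.
Proof. by rewrite /theta mmapC. Qed.

Lemma sq_lin n (F : 'I_n -> L) :
  (\sum_i F i *: 'X_i) ^+ 2 = \sum_i F i ^+ 2 *: 'X_i ^+ 2 :> {mpoly L[n]}.
Proof.
rewrite (big_morph (fun x : {mpoly L[n]} => x ^+ 2) (id1 := 0) (op1 := +%R)).
- by apply: eq_bigr => i _; rewrite exprZn.
- move=> x y; rewrite sqrrD [_ *+ 2](_ : _ = 0) ?addr0 //.
  by rewrite -mulr_natl -mpolyC_nat (pcharf0 L2) mpolyC0 mul0r.
by rewrite expr0n.
Qed.

Lemma Stot_lin n (s : 'I_n -> {mpoly L[n]}) (F : 'I_n -> L) :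
  Stot s (\sum_i F i *: 'X_i) = (\sum_i F i *: 'X_i)%:P + (\sum_i F i *: s i) *: 'X.
Proof.
rewrite !rmorph_sum /= scaler_suml -big_split /=; apply: eq_bigr => i _.
rewrite -!mul_mpolyC !rmorphM /= StotC StotX mulrDr; congr (_ + _).
by rewrite -!mul_polyC polyCM mulrA.
Qed.

Lemma theta_hit p : Hit (@square 6 _) p -> Hit (@cyclic_square 6 L) (theta p).
Proof.
apply: Hit_morph => [c|j]; first by exists (iota c); exact: thetaC.
rewrite /= thetaX Stot_lin; congr (_ + _ *: _).
rewrite /square rmorphXn /= thetaX sq_lin [RHS](reindex_inj (@ord_pred_inj 6)) /=.
by apply: eq_bigr => i _; rewrite B_frob.
Qed.

Definition back : PL -> PL := comp_mpoly (glsub moore).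
HB.instance Definition _ := GRing.RMorphism.on back.

Lemma back_hit p : Hit (@cyclic_square 6 L) p -> Hit (@square 6 L) (back p).
Proof.
apply: Hit_morph => [c|i]; first by exists c; apply: comp_mpolyC.
have bX k : back 'X_k = \sum_j moore k j *: 'X_j by apply: glsubX.
rewrite /= bX Stot_lin; congr (_ + _ *: _).
by rewrite /cyclic_square rmorphXn /= bX sq_lin; apply: eq_bigr => j _; rewrite moore_frob.
Qed.

Lemma back_theta p : back (theta p) = map_mpoly iota p.
Proof.
apply: (mpoly_rmorph_eq (f := back \o theta) (g := map_mpoly iota)) => [c|j] /=.
  by rewrite thetaC map_mpolyC; apply: comp_mpolyC.
rewrite thetaX map_mpolyX /back glsub_lin.
have := mulVmx moore_unit => /matrixP/(_ j) E.
rewrite (bigD1 j) //= [X in _ + X]big1 ?addr0 => [|k kj].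
  by move: (E j); rewrite [LHS]mxE [RHS]mxE eqxx -/B => ->; rewrite scale1r.
by have := E k; rewrite [LHS]mxE [RHS]mxE -/B eq_sym (negbTE kj) => ->; rewrite scale0r.
Qed.

(* G is the matrix of phi in the basis b, and U the matrix of phi in the coordinates x_i. *)
Lemma theta_gl (G : 'M['F_2]_6) (U : 'M[L]_6) p :
  moore *m map_mx iota G = U *m moore ->
  theta (p \mPo glsub G) = theta p \mPo glsub U.
Proof.
move=> E.
have {}E : map_mx iota G *m B = B *m U.
  by rewrite -[LHS]mul1mx -(mulVmx moore_unit) -/B -!mulmxA (mulmxA moore) E
             -!mulmxA mulmxV ?moore_unit // mulmx1.
apply: (mpoly_rmorph_eq (f := theta \o comp_mpoly (glsub G))
  (g := comp_mpoly (glsub U) \o theta)) => [c|j] /=.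
  by rewrite comp_mpolyC !thetaC comp_mpolyC.
rewrite glsubX thetaX glsub_lin rmorph_sum /=.
rewrite (eq_bigr (fun k => \sum_i (iota (G j k) * B k i) *: 'X_i)); last first.
  move=> k _; rewrite -mul_mpolyC rmorphM /= thetaC thetaX mul_mpolyC scaler_sumr.
  by apply: eq_bigr => i _; rewrite scalerA.
rewrite exchange_big /=; apply: eq_bigr => i _; rewrite -scaler_suml; congr (_ *: _).
by have := E => /matrixP/(_ j i); rewrite [LHS]mxE [RHS]mxE => <-; apply: eq_bigr => k _; rewrite mxE.
Qed.

Lemma co0 j : co j 0 = 0.
Proof.
have := co_lin j 1 0 0; rewrite rmorph1 !mul1r addr0 => E.
by apply: (addrI (co j 0)); rewrite addr0 -E.
Qed.

Lemma co_sum j (c : 'I_6 -> 'F_2) : co j (\sum_k iota (c k) * b k) = c j.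
Proof.
have -> : co j (\sum_k iota (c k) * b k) = \sum_k c k * (j == k)%:R.
  elim/big_rec2: _ => [|k y x _ <-]; first exact: co0.
  by rewrite co_lin co_b.
by rewrite (bigD1 j) //= eqxx mulr1 big1 ?addr0 // => k kj; rewrite eq_sym (negbTE kj) mulr0.
Qed.

(** An additive map is [F_2]-linear, because scalars of [F_2] act as integers. Its matrix has the
    coordinates of [phi (b k)] as column k. *)
Lemma linear_gl (phi : {additive L -> L}) : injective phi ->
  exists2 G : 'M['F_2]_6, G \in unitmx &
    forall k, \sum_j iota (G j k) * b j = phi (b k).
Proof.
move=> inj; have phiZ c y : phi (iota c * y) = iota c * phi y.
  by rewrite -(natr_Zp c) rmorph_nat !mulr_natl raddfMn.
exists (\matrix_(j, k) co j (phi (b k))); last first.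
  by move=> k; rewrite [RHS]b_co; apply: eq_bigr => j _; rewrite mxE.
rewrite -unitmx_tr -row_free_unit; apply: inj_row_free => v vG.
have v0 : \sum_k iota (v 0 k) * b k = 0.
  apply: inj; rewrite raddf0 raddf_sum /=.
  rewrite (eq_bigr (fun k => \sum_j iota (v 0 k * co j (phi (b k))) * b j)); last first.
    move=> k _; rewrite phiZ {1}[phi _]b_co mulr_sumr.
    by apply: eq_bigr => j _; rewrite mulrA rmorphM.
  rewrite exchange_big big1 //= => j _; rewrite -mulr_suml -rmorph_sum.
  have := congr1 (fun A : 'rV_6 => A 0 j) vG; rewrite !mxE => E.
  rewrite (_ : \sum_i _ = 0) ?rmorph0 ?mul0r // -[RHS]E.
  by apply: eq_bigr => k _; rewrite !mxE.
by apply/rowP => k; rewrite mxE -(co_sum k) v0 co0.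
Qed.

(** The entry (i, j) of both sides is [phi (b j) ^+ (2 ^ i)], expanded along the basis on the left
    and as a linearised polynomial on the right. *)
Lemma moore_gl (G : 'M['F_2]_6) (U : 'M[L]_6) (phi : L -> L) :
  (forall k, \sum_j iota (G j k) * b j = phi (b k)) ->
  (forall i y, \sum_k U i k * y ^+ (2 ^ (k : 'I_6)) = phi y ^+ (2 ^ i)) ->
  moore *m map_mx iota G = U *m moore.
Proof.
move=> GP UP; apply/matrixP => i j; rewrite !mxE.
rewrite [RHS](eq_bigr (fun k => U i k * b j ^+ (2 ^ (k : 'I_6)))); last first.
  by move=> k _; rewrite mxE.
rewrite UP -GP exp_sum2; apply: eq_bigr => k _.
by rewrite !mxE exprMn iota_exp mulrC.
Qed.

Lemma theta_homog m : theta 'X_[m] \is (mdeg m).-homog.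
Proof.
rewrite mpolyXE_id rmorph_prod mdegE.
elim/big_rec2: _ => [|i d p _ hp]; first exact: dhomog1.
apply: dhomogM hp; rewrite rmorphXn /= thetaX.
suff : (\sum_k B i k *: 'X_k) ^+ m i \is (1 * m i).-homog by rewrite mul1n.
apply: dhomogMn.
by apply: rpred_sum => k _; apply: rpredZ; rewrite dhomogX /= mdeg1.
Qed.

Definition mulL (a y : L) : L := a * y.
Fact mulL_is_additive a : zmod_morphism (mulL a).
Proof. by move=> x y; rewrite /mulL mulrBr. Qed.
HB.instance Definition _ a := GRing.isZmodMorphism.Build _ _ (mulL a) (mulL_is_additive a).

Definition uphi (y : L) : L := y ^+ (2 ^ 0) + y ^+ (2 ^ 1) + y ^+ (2 ^ 3).

Fact uphi_is_additive : zmod_morphism uphi.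
Proof.
move=> x y; rewrite !(oppr_pchar2 L2) /uphi !expD2.
by rewrite (addrACA (x ^+ _)) (addrACA (x ^+ _ + _)).
Qed.
HB.instance Definition _ := GRing.isZmodMorphism.Build _ _ uphi uphi_is_additive.

(* In the group algebra of Gal(L / F_2) = <s>, (1 + s + s^3)^2 = s^2 because s^6 = 1. *)
Lemma uphi_inj : injective uphi.
Proof.
apply: raddf_inj => x x0; have : uphi (uphi x) = x ^+ 4.
  rewrite /uphi !expD2 -!exprM -!expnD.
  have -> : x ^+ (2 ^ (3 + 3)) = x by have := expf_card x; rewrite cardL.
  have D y : y + y = 0 :> L by rewrite -[X in X + _](oppr_pchar2 L2) addNr.
  transitivity (x ^+ 4 + (x + x) + (x ^+ 2 + x ^+ 2) + (x ^+ 8 + x ^+ 8) + (x ^+ 16 + x ^+ 16)).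
    by ring.
  by rewrite !D !addr0.
by rewrite x0 raddf0 => /esym/eqP; rewrite expf_eq0 => /eqP.
Qed.

Lemma hit_of_invariant n st sel (f : {mpoly 'F_2[6]}) :
  cert_ok n st sel -> (forall m, f@_m != 0 -> mdeg m = n) ->
  (forall G : 'M['F_2]_6, G \in unitmx -> Hit (@square 6 _) (f \mPo glsub G - f)) ->
  Hit (@square 6 L) (map_mpoly iota f).
Proof.
move=> ok homf Hf; rewrite -back_theta; apply: back_hit.
(* Applied to two kinds of maps: the multiplications by a, with U diagonal, and [uphi], with U
   circulant. *)
have Hphi (phi : {additive L -> L}) (U : 'M[L]_6) : injective phi ->
    (forall i y, \sum_k U i k * y ^+ (2 ^ (k : 'I_6)) = phi y ^+ (2 ^ i)) ->
    Hit (@cyclic_square 6 L) (theta f \mPo glsub U - theta f).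
  move=> inj UP; have [G Gu GP] := linear_gl inj.
  rewrite -(theta_gl _ (moore_gl GP UP)) -rmorphB; apply: theta_hit.
  exact: Hf.
apply: (hit_of_cyclic_invariant L2 cardL ok).
- move=> m; apply: contraNeq => dm; apply/eqP.
  rewrite (mpolyE f) rmorph_sum raddf_sum big1_seq //= => m'.
  rewrite mcoeff_msupp => /homf dm'.
  rewrite -mul_mpolyC rmorphM /= thetaC mcoeffCM.
  suff ->: (theta 'X_[m'])@_m = 0 by rewrite mulr0.
  apply/eqP; apply: contraNT dm; rewrite -mcoeff_msupp => mX.
  by have /dhomogP/(_ _ mX) -> := theta_homog m'; rewrite dm'.
- move=> a a0; have := Hphi (mulL a) (diag_mx (\row_i (a ^+ (2 ^ i)%N))) (mulfI a0).
  rewrite (_ : glsub _ = diag a); last first.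
    apply/eq_from_tnth => i; rewrite !tnth_mktuple (bigD1 i) //= big1 ?addr0.
      by rewrite !mxE eqxx mulr1n.
    by move=> j ji; rewrite !mxE eq_sym (negbTE ji) mulr0n scale0r.
  apply=> i y; rewrite (bigD1 i) //= big1 ?addr0 => [|j ji].
    by rewrite !mxE eqxx mulr1n exprMn.
  by rewrite !mxE eq_sym (negbTE ji) mulr0n mul0r.
pose U : 'M[L]_6 := \matrix_(i, k)
  ((k == i)%:R + (k == ordS i)%:R + (k == ordS (ordS (ordS i)))%:R).
have pick (V : lmodType L) (F : 'I_6 -> V) j : \sum_k (k == j)%:R *: F k = F j.
  rewrite (bigD1 j) //= eqxx scale1r big1 ?addr0 // => k /negbTE ->.
  by rewrite scale0r.
have Usum (V : lmodType L) (F : 'I_6 -> V) i :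
    \sum_k U i k *: F k = F i + F (ordS i) + F (ordS (ordS (ordS i))).
  rewrite (eq_bigr (fun k => (k == i)%:R *: F k + (k == ordS i)%:R *: F k +
      (k == ordS (ordS (ordS i)))%:R *: F k)); last by move=> k _; rewrite mxE !scalerDl.
  by rewrite !big_split /= !pick.
have := Hphi uphi U uphi_inj.
rewrite (_ : _ \mPo glsub U = usub (theta f)).
  apply=> i y; apply: (etrans (Usum L^o (fun k => y ^+ (2 ^ k)) i)); cbv beta.
  by rewrite /uphi !expD2 !exp_ordS -!exprM -!expnD mulnA -!expnSr.
rewrite /usub; congr (_ \mPo _); apply/eq_from_tnth => i; rewrite !tnth_mktuple.
exact: Usum.
Qed.
End Coordinates.

(** * The quotient by hit elements *)

(** An existential package keeps the construction of the field opaque: only the embedding [iota], a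
    basis and its coordinate forms are used afterwards. *)
Lemma F64_data : exists (L : finFieldType) (iota : {rmorphism 'F_2 -> L})
    (b : 'I_6 -> L) (co : 'I_6 -> L -> 'F_2),
  [/\ (2%N \in [pchar L]) /\ #|L| = 64%N,
      forall j c y z, co j (iota c * y + z) = c * co j y + co j z,
      forall j k, co j (b k) = (j == k)%:R &
      forall y, y = \sum_j iota (co j y) * b j].
Proof.
have [L0 L2 cardL] := @pPrimePowerField 2 6 isT isT.
pose L : finFieldType := pPrimeCharType L2.
have dimL : \dim {: (pPrimeCharType L2 : vectType 'F_2)} = 6%N.
  by rewrite pprimeChar_dimf cardL.
have [X bX] : exists X : 6.-tuple (pPrimeCharType L2),
    basis_of {: (pPrimeCharType L2 : vectType 'F_2)} X.
  have := vbasisP {: (pPrimeCharType L2 : vectType 'F_2)}.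
  by move: (vbasis _); rewrite dimL => Y bY; exists Y.
exists L, (GRing.in_alg (pPrimeCharType L2)), (fun j => X`_j), (fun j => coord X j).
split.
- by split.
- by move=> j c y z; rewrite mulr_algl linearP.
- move=> j k; rewrite (coord_free _ _ (basis_free bX)) eq_sym; reflexivity.
move=> y; rewrite {1}(coord_basis bX (memvf y)).
by apply: eq_bigr => j _; rewrite mulr_algl.
Qed.

Section PolynomialVectors.
Variable h : nat.

Lemma barbasis_P n (x : barbasis (Ppow h) 0 n) :
  exists2 e : seq nat, label x = ([::], map Posz e) & size e = h /\ sumn e = n.
Proof.
have := valP x; rewrite -/(label x); case: (label x) => [ws m] /and5P[/= /nilP -> _ /eqP sm mon /eqP].
rewrite /bardeg /= add0r => dE.
have mE : m = map Posz (map absz m).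
  by rewrite -map_comp -[LHS]map_id; apply/eq_in_map => a /(allP mon) a0 /=; lia.
exists (map absz m); first by rewrite -mE.
rewrite size_map sm; split=> //; apply/eqP; rewrite -eqz_nat -dE {2}mE; apply/eqP.
elim: (map absz m) => [|a r IH] /=; first by rewrite big_nil.
by rewrite big_cons -IH.
Qed.

Lemma expo_label n (x : barbasis (Ppow h) 0 n) e :
  label x = ([::], map Posz e) -> size e = h -> expo x = mofs h e.
Proof.
move=> lx se; apply/mnmP => i; rewrite !mnmE lx /=.
by rewrite (nth_map 0%N) ?se.
Qed.

Lemma label_expo n (x : barbasis (Ppow h) 0 n) : label x = ([::], map Posz (sofm (expo x))).
Proof. by have [e lx [se _]] := barbasis_P x; rewrite (expo_label lx se) mofsK. Qed.

Lemma mdeg_sofm (m : 'X_{1..h}) : mdeg m = sumn (sofm m).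
Proof. by rewrite mdegE /sofm sumnE big_map big_enum. Qed.

Lemma mdeg_expo n (x : barbasis (Ppow h) 0 n) : mdeg (expo x) = n.
Proof.
have [e lx [se sn]] := barbasis_P x; rewrite (expo_label lx se).
by rewrite mdeg_sofm mofsK.
Qed.

Lemma expo_inj n : injective (@expo h n).
Proof. by move=> x y E; apply: label_inj; rewrite !label_expo E. Qed.

Lemma expo_surj n (m : 'X_{1..h}) : mdeg m = n -> exists x : barbasis (Ppow h) 0 n, expo x = m.
Proof.
move=> dm; have [|x lx] := @label_surj (Ppow h) 0 n h ([::], map Posz (sofm m)) (or_introl erefl).
  apply/and5P; split=> //=; first by rewrite size_map size_sofm.
    by apply/allP => _ /mapP[a _ ->].
  rewrite /bardeg /= add0r -dm mdeg_sofm; apply/eqP.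
  by elim: (sofm m) => [|a r IH] /=; rewrite ?big_nil // big_cons IH.
by exists x; rewrite (expo_label lx) ?size_sofm // sofmK.
Qed.

Lemma poly_of_coef n (v : Pdeg h n) x : (poly_of v)@_(expo x) = v x.
Proof.
rewrite /poly_of raddf_sum (bigD1 x) //= mcoeffZ mcoeffX eqxx mulr1 big1 ?addr0 // => y yx.
by rewrite mcoeffZ mcoeffX (inj_eq (@expo_inj n)) (negbTE yx) mulr0.
Qed.

Lemma poly_of_homog n (v : Pdeg h n) m : (poly_of v)@_m != 0 -> mdeg m = n.
Proof.
apply: contraNeq => dm; rewrite /poly_of raddf_sum big1 //= => x _.
rewrite mcoeffZ mcoeffX; case: eqP => [E|]; last by rewrite mulr0.
by rewrite -E mdeg_expo eqxx in dm.
Qed.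

(** Coefficients are read through [ell]: the identity for polynomials over [F_2], a coordinate form
    for polynomials over the field [L]. *)
Definition tovec (R : comNzRingType) (ell : R -> 'F_2) n (q : {mpoly R[h]}) : Pdeg h n :=
  [ffun x => ell q@_(expo x)].

Lemma tovecK n (p : {mpoly 'F_2[h]}) :
  (forall m, p@_m != 0 -> mdeg m = n) -> poly_of (tovec id n p) = p.
Proof.
move=> hp; apply/mpolyP => m; case: (eqVneq (mdeg m) n) => dm.
  by have [x <-] := expo_surj dm; rewrite poly_of_coef ffunE.
have -> : p@_m = 0 by apply/eqP; apply: contraNT dm => /hp ->.
by apply/eqP; apply: contraNT dm => /poly_of_homog ->.
Qed.

Lemma poly_ofK n (v : Pdeg h n) : tovec id n (poly_of v) = v.
Proof. by apply/ffunP => x; rewrite ffunE poly_of_coef. Qed.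

Lemma odd_binz_nat (a : nat) k : odd (binz a%:Z k) = obin a k.
Proof. by rewrite obinE. Qed.

Lemma sq_cons k a m : sq k (a :: m) =
  flatten [seq [seq (a + j%:Z) :: x | x <- sq (k - j) m]
          | j <- [seq j <- iota 0 k.+1 | odd (binz a j)]].
Proof. by []. Qed.

(** For non-negative exponents [binz] is the ordinary binomial, so the range of j can be cut at the
    exponent. *)
Lemma sq_cvec k (e : seq nat) :
  sq k (map Posz e) = [seq map Posz [seq (p.1 + p.2)%N | p <- zip e c] | c <- cvec k e].
Proof.
elim: e k => [|a e IH] k; first by case: k.
rewrite cvec_cons map_flatten map_cons sq_cons -map_comp.
have -> : [seq j <- iota 0 k.+1 | odd (binz a%:Z j)] = [seq j <- iota 0 (minn k a).+1 | obin a j].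
  have -> : (k.+1 = (minn k a).+1 + (k - minn k a))%N by lia.
  rewrite iotaD filter_cat (eq_filter (odd_binz_nat a)).
  rewrite [X in _ ++ X](_ : _ = [::]) ?cats0 //.
  rewrite -(filter_pred0 (iota (0 + (minn k a).+1) (k - minn k a))).
  apply: eq_in_filter => j; rewrite mem_iota => /andP[j1 j2].
  by rewrite /= bin_small //; lia.
congr flatten; apply: eq_map => j; rewrite [in LHS]IH -map_comp [RHS]/= -map_comp; apply: eq_map => c /=.
by rewrite PoszD.
Qed.

Section SqVec.
Variables (R : comNzRingType) (R2 : 2%N \in [pchar R]) (ell : {additive R -> 'F_2}).

Lemma tovec_add n : zmod_morphism (tovec ell n).
Proof. by move=> p q; apply/ffunP => x; rewrite !ffunE mcoeffB raddfB. Qed.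
HB.instance Definition _ n := GRing.isZmodMorphism.Build _ _ (tovec ell n) (@tovec_add n).

Lemma sumn_cvec k e c : c \in cvec k e ->
  sumn [seq (p.1 + p.2)%N | p <- zip e c] = (sumn e + k)%N.
Proof.
rewrite mem_cvec => /and3P[/eqP sc /eqP <- _].
elim: e c sc => [|a e IH] [|x c] //= [sc]; rewrite IH //; lia.
Qed.

Lemma Sqc_square_homog k (m m' : 'X_{1..h}) :
  (Sqc (@square h R) k 'X_[m])@_m' != 0 -> mdeg m' = (mdeg m + k)%N.
Proof.
rewrite -{1}(sofmK m) Sqc_square ?size_sofm // => /eqP H.
apply/eqP; apply: contra_notT H => dm.
rewrite raddf_sum big1_seq //= => c cP; rewrite mcoeffX.
case: eqP => // E; move: dm; rewrite -E mdeg_sofm mofsK ?(sumn_cvec cP) -?mdeg_sofm ?eqxx //.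
by rewrite size_map size_zip (size_cvec cP) size_sofm minnn.
Qed.

(** Additivity of [ell] is enough, since in the monomial basis the squares have integer
    coefficients. *)
Lemma tovec_Sqc n k (q : {mpoly R[h]}) : (k <= n)%N ->
  tovec ell n (Sqc (@square h R) k q) = Sq h n k (tovec ell (n - k) q).
Proof.
move=> kn; rewrite (mpolyE q) !raddf_sum /=; apply: eq_bigr => m _.
set c := q@_m; rewrite SqcZ.
case: (eqVneq (mdeg m) (n - k)%N) => dm; last first.
  have -> : tovec ell (n - k) (c *: 'X_[m]) = 0.
    apply/ffunP => x; rewrite !ffunE mcoeffZ mcoeffX; case: eqP => [E|]; last by rewrite mulr0 raddf0.
    by rewrite E mdeg_expo eqxx in dm.
  rewrite linear0; apply/ffunP => x; rewrite !ffunE mcoeffZ.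
  case: (eqVneq (Sqc (@square h R) k 'X_[m])@_(expo x) 0) => [->|/Sqc_square_homog]; first by rewrite mulr0 raddf0.
  by rewrite mdeg_expo => E; rewrite E addnK eqxx in dm.
have [y Ey] := expo_surj dm.
have -> : tovec ell (n - k) (c *: 'X_[m]) = ell c *: [ffun x => (x == y)%:R].
  apply/ffunP => x; rewrite !ffunE mcoeffZ mcoeffX -Ey (inj_eq (@expo_inj _)) eq_sym.
  by case: eqP => _; rewrite ?mulr1 ?mulr0 ?raddf0 // [RHS]mulr1.
rewrite linearZ /=.
have -> : Sq h n k [ffun x => (x == y)%:R] =
    vec (Ppow h) 0 n [seq ([::], x) | x <- sq k (label y).2].
  transitivity (\sum_(x : barbasis (Ppow h) 0 (n - k)) ((x == y)%:R : 'F_2) *: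
      vec (Ppow h) 0 n [seq ([::], z) | z <- sq k (label x).2]).
    by rewrite /Sq /extend lfunE; apply: eq_bigr => x _; rewrite ffunE.
  rewrite (bigD1 y) //= eqxx scale1r big1 ?addr0 // => x /negbTE ->.
  by rewrite scale0r.
rewrite label_expo Ey [(_, _).2]/= sq_cvec -map_comp.
have E := Sqc_square R2 k (size_sofm m); rewrite sofmK in E.
apply/ffunP => x; rewrite !ffunE mcoeffZ {}E raddf_sum /= count_map.
have -> : \sum_(c <- cvec k (sofm m))
    ('X_[mofs h [seq (p.1 + p.2)%N | p <- zip (sofm m) c]] : {mpoly R[h]})@_(expo x) =
  (count (preim (fun c => ([::], [seq Posz i | i <- [seq (p.1 + p.2)%N | p <- zip (sofm m) c]]))
     (pred1 (label x))) (cvec k (sofm m)))%:R.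
  rewrite -sum1_count natr_sum [RHS]big_mkcond /=; apply: eq_big_seq => d dP.
  rewrite mcoeffX label_expo xpair_eqE eqxx /= (inj_eq (inj_map _)); last by move=> ? ? [].
  rewrite -[expo x in LHS]sofmK.
  have sz : size [seq (p.1 + p.2)%N | p <- zip (sofm m) d] = h.
    by rewrite size_map size_zip (size_cvec dP) size_sofm minnn.
  case: eqP => [/mofs_inj -> //|]; rewrite ?size_sofm ?eqxx //.
  by case: eqP => // ->.
rewrite mulr_natr raddfMn /=; set N := count _ _.
by rewrite -[LHS]mulr_natr.
Qed.
End SqVec.
End PolynomialVectors.

Lemma F2_char : 2%N \in [pchar 'F_2].
Proof. exact: pchar_Fp. Qed.

Lemma Sqc_homog h n k (p : {mpoly 'F_2[h]}) : (k <= n)%N ->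
  (forall m, p@_m != 0 -> mdeg m = (n - k)%N) ->
  forall m, (Sqc (@square h _) k p)@_m != 0 -> mdeg m = n.
Proof.
move=> kn hp m; apply: contraNeq => dm; rewrite (mpolyE p) !raddf_sum big1_seq //= => m' /=.
rewrite mcoeff_msupp => /hp dm'; rewrite SqcZ mcoeffZ.
have H := @Sqc_square_homog h _ F2_char k m' m.
rewrite [X in _ * X](_ : _ = 0) ?mulr0 //.
by apply/eqP; apply: contraNT dm => /H ->; rewrite dm' subnK.
Qed.

Lemma hit_Hit h n (v : Pdeg h n) : v \in hit h n -> Hit (@square h _) (poly_of v).
Proof.
move=> /memv_sumP[vs vsP ->].
have polyD : zmod_morphism (@poly_of h n).
  move=> u w; rewrite /poly_of -sumrB; apply: eq_bigr => x _.
  by rewrite !ffunE scalerBl.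
pose pA : {additive Pdeg h n -> {mpoly 'F_2[h]}} :=
  HB.pack (@poly_of h n) (GRing.isZmodMorphism.Build _ _ (@poly_of h n) polyD).
rewrite -[poly_of _]/(pA _) raddf_sum; apply: Hit_sum => k k0.
have /memv_imgP[w _ ->] := vsP k k0.
have kn : (k <= n)%N by rewrite -ltnS.
have := tovec_Sqc F2_char (idfun : {additive 'F_2 -> 'F_2}) (poly_of w) kn.
rewrite poly_ofK => <-; rewrite /= tovecK; first exact: Hit_Sqc.
by apply: Sqc_homog => // m; apply: poly_of_homog.
Qed.

Lemma Hit_hit h n (R : comNzRingType) (R2 : 2%N \in [pchar R])
    (ell : {additive R -> 'F_2}) (q : {mpoly R[h]}) :
  Hit (@square h R) q -> tovec ell n q \in hit h n.
Proof.
case=> r ->; rewrite raddf_sum /=; apply: rpred_sum => -[k p] _ /=.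
(* A square of degree above n has no component in degree n, which matches the range of the sum
   defining [hit]. *)
case: (leqP k.+1 n) => kn; last first.
  rewrite (_ : tovec _ _ _ = 0) ?mem0v //; apply/ffunP => x; rewrite !ffunE.
  rewrite (mpolyE p) !raddf_sum big1 //= => m _; rewrite SqcZ mcoeffZ.
  have H := @Sqc_square_homog h _ R2 k.+1 m (expo x).
  rewrite [X in _ * X](_ : _ = 0) ?mulr0 ?raddf0 //; apply/eqP.
  by apply: contraTT kn => /H; rewrite mdeg_expo -leqNgt => ->; rewrite leq_addl.
rewrite (tovec_Sqc R2 _ _ kn).
have k' : (k.+1 < n.+1)%N by [].
rewrite /hit; apply: (subvP (sumv_sup (Ordinal k') _ (subvv _))) => //.
by rewrite memv_img ?memvf.
Qed.

Lemma comp_glsub_homog h n (g : 'M['F_2]_h) (p : {mpoly 'F_2[h]}) :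
  (forall m, p@_m != 0 -> mdeg m = n) ->
  forall m, (p \mPo glsub g)@_m != 0 -> mdeg m = n.
Proof.
move=> hp m; apply: contraNeq => dm; rewrite comp_mpolyEX raddf_sum big1_seq //= => m' /=.
rewrite mcoeff_msupp => /hp dm'; rewrite mcoeffZ.
suff -> : ('X_[m'] \mPo glsub g)@_m = 0 by rewrite mulr0.
apply/eqP; apply: contraNT dm; rewrite -mcoeff_msupp => mX.
have hX : 'X_[m'] \mPo glsub g \is (mdeg m').-homog.
  rewrite comp_mpolyX mdegE; elim/big_rec2: _ => [|i d q _ hq]; first exact: dhomog1.
  apply: dhomogM hq; rewrite tnth_mktuple.
  suff : (\sum_k g i k *: 'X_k : {mpoly 'F_2[h]}) ^+ m' i \is (1 * m' i).-homog by rewrite mul1n.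
  by apply: dhomogMn; apply: rpred_sum => k _; apply: rpredZ; rewrite dhomogX /= mdeg1.
by have /dhomogP/(_ _ mX) -> := hX; rewrite dm'.
Qed.

Lemma QPinv_eq0 n st sel : cert_ok n st sel -> QPinv 6 n = 0%VS.
Proof.
move=> ok; apply/eqP; rewrite -subv0; apply/subvP => q qinv; rewrite memv0.
pose v := (piq (hit 6 n))^-1%VF q.
have vq : piq (hit 6 n) v = q by apply: piqK.
rewrite -vq -memv_ker lker_piq.
have [L [iota [b [co [[L2 cardL] co_lin co_b b_co]]]]] := F64_data.
have Hv : Hit (@square 6 L) (map_mpoly iota (poly_of v)).
  apply: (hit_of_invariant L2 cardL co_lin co_b b_co ok) => [m|G Gu].
    exact: poly_of_homog.
  have -> : poly_of v \mPo glsub G - poly_of v = poly_of (gl_fun G v - v).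
    rewrite -(tovecK (@comp_glsub_homog 6 n G _ (@poly_of_homog _ _ v))).
    rewrite /poly_of -sumrB; apply: eq_bigr => x _.
    by rewrite -scalerBl; congr (_ *: _); rewrite !ffunE.
  apply: hit_Hit; rewrite -[hit _ _]lker_piq memv_ker (linearB (piq (hit 6 n))) /= vq subr_eq0.
  have /subv_bigcapP/(_ G Gu) := subvv (QPinv 6 n).
  move/subvP/(_ q qinv)/fixedSpaceP.
  have -> : glQP n G q = piq (hit 6 n) (gl_fun G v).
    transitivity (piq (hit 6 n) (linfun (@gl_fun 6 n G) v)); last by congr (piq _ _); apply: lfunE.
    by rewrite [LHS]comp_lfunE [LHS]comp_lfunE.
  by move/eqP.
(* Descent to [F_2]: some coordinate form is nonzero at 1, hence equal to 1 there. Applied to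
   coefficients it maps hits over [L] to hits and gives v back. *)
have [j cj] : exists j, co j 1 != 0.
  apply/existsP; apply: contraT; rewrite negb_exists => /forallP co1.
  have := b_co 1; rewrite big1 => [/eqP|j _]; first by rewrite oner_eq0.
  by have := co1 j; rewrite negbK => /eqP ->; rewrite rmorph0 mul0r.
have coD : zmod_morphism (co j).
  move=> x y; rewrite (oppr_pchar2 L2) (oppr_pchar2 F2_char) -[x]mul1r -(rmorph1 iota).
  by rewrite co_lin mul1r rmorph1 mul1r.
pose ell : {additive L -> 'F_2} := HB.pack (co j) (GRing.isZmodMorphism.Build _ _ (co j) coD).
have cj1 : co j 1 = 1.
  by case: (co j 1) cj => [[|[|]]] //= ? _; apply: val_inj.
have := Hit_hit n L2 ell Hv.
rewrite (_ : tovec _ _ _ = v) //; apply/ffunP => x; rewrite ffunE mcoeff_map_mpoly poly_of_coef /=.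
have := co_lin j (v x) 1 0; rewrite !addr0 mulr1 cj1 mulr1 => ->.
by rewrite (co0 co_lin) addr0.
Qed.

(** * Admissible words and resolutions *)

(** The form of [adem] that is evaluated in the certificates, with the parities taken from
    [obin]. *)
Definition ademf (a b : nat) : seq word :=
  [seq (if c == 0%N then [:: (a + b)%N] else [:: (a + b - c)%N; c])
  | c <- iota 0 (a./2).+1 & obin (b - c).-1 (a - c.*2)].

Lemma ademE a b : adem a b = ademf a b.
Proof. by congr map; apply: eq_filter => c; rewrite obinE. Qed.

(* A normal form of Sq^k a for a admissible; the identity in the Steenrod algebra holds whatever
   the fuel f, and [closed_ok] tests that the fuel was enough. *)
Fixpoint mulw (f k : nat) (a : word) : seq word :=
  if f is f'.+1 then
    if a is b :: a' then
      if (b.*2 <= k)%N then [:: k :: a] else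
      norm (flatten [seq foldr (fun l r => flatten [seq mulw f' l z | z <- r]) [:: a'] x
                    | x <- ademf k b])
    else [:: [:: k]]
  else [:: k :: a].

Definition sqmul := mulw 30.

Definition actw (x t : word) : seq word :=
  foldr (fun l r => norm (flatten [seq sqmul l z | z <- r])) [:: t] x.

Definition nf (w : word) : seq word := actw w [::].

Definition nfe (l : seq (word * nat)) : seq (word * nat) :=
  norm (flatten [seq [seq (x, y.2) | x <- nf y.1] | y <- l]).

(* Admissible words of sum e with first letter at most m, for fuel f >= e. *)
Fixpoint basl (f e m : nat) : seq word :=
  if e is 0%N then [:: [::]] else
  if f is f'.+1 then
    flatten [seq [seq k :: t | t <- basl f' (e - k) k./2] | k <- iota 1 (minn e m)]
  else [::].

Definition bas (e : nat) : seq word := basl e e e.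

Definition closed_ok (B : nat) : bool :=
  all (fun e => all (fun z => all (fun l =>
    all (mem (bas (l + e))) (sqmul l z)) (iota 1 (B - e))) (bas e)) (iota 0 B.+1).

(** Adem relators act as zero on the formal span of the admissible words. Together with [closed_ok],
    this makes that span a module over the Steenrod algebra in degrees up to [B], so [nf] respects
    the relations. *)
Definition adem_ok (B : nat) : bool :=
  all (fun e => all (fun t =>
    all (fun a => all (fun b => (a < b.*2)%N ==>
      nilp (norm (flatten [seq actw x t | x <- [:: a; b] :: ademf a b])))
      (iota 1 (B - e - a))) (iota 1 (B - e))) (bas e)) (iota 0 B.+1).

Definition gen_map := seq (seq (word * nat)).

(* In a free module on generators numbered by v, a list of pairs (a, v) stands for the sum of the
   a (x) v; the v-th entry of a [gen_map] is the image of the v-th generator. *)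
Definition dap (dg : gen_map) (l : seq (word * nat)) : seq (word * nat) :=
  flatten [seq [seq (x.1 ++ y.1, y.2) | y <- nth [::] dg x.2] | x <- l].

(* A Z/2-linear map of free modules: the v-th entry lists the basis elements a (x) v with nonzero
   image. *)
Definition table := seq (seq (word * seq (word * nat))).

Fixpoint lookup (a : word) (t : seq (word * seq (word * nat))) : seq (word * nat) :=
  if t is (a', r) :: t' then if a == a' then r else lookup a t' else [::].

Definition tap (h : table) (x : word * nat) : seq (word * nat) :=
  lookup x.1 (nth [::] h x.2).

Definition gens_ok (g0 g1 : seq nat) (d1 : gen_map) : bool :=
  (size d1 == size g1) && all (fun x => all (fun y : word * nat =>
    [&& 0%N \notin y.1, y.2 < size g0 & sumn y.1 + nth 0 g0 y.2 == x.1]%N) x.2) (zip g1 d1).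

Definition table_ok (g0 g1 : seq nat) (h : table) : bool :=
  (size h == size g0) && all (fun x => all (fun z : word * seq (word * nat) =>
    all (fun y : word * nat =>
    [&& 0%N \notin y.1, y.2 < size g1 & sumn y.1 + nth 0 g1 y.2 == sumn z.1 + x.1]%N) z.2) x.2)
     (zip g0 h).

Definition dd_ok (d1 d2 : gen_map) : bool :=
  all (fun x => nilp (nfe (dap d1 x))) d2.

(* h0 d1 + d2 h1 = 1 in degrees at most B. *)
Definition exact_ok (B : nat) (g1 : seq nat) (d1 d2 : gen_map) (h0 h1 : table) : bool :=
  all (fun v => all (fun e => all (fun a =>
     nilp (nfe ((a, v) :: flatten [seq tap h0 x | x <- nfe (dap d1 [:: (a, v)])]
                ++ dap d2 (tap h1 (a, v)))))
     (bas e)) (iota 0 (B.+1 - nth 0 g1 v))) (iota 0 (size g1)).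

Arguments merges _ : simpl never.

Lemma F2D (x : 'F_2) : x + x = 0.
Proof. by rewrite -mulr2n -mulr_natl (pcharf0 (pchar_Fp _)) ?mul0r. Qed.

Lemma F2_add0 (x y : 'F_2) : x + y = 0 -> x = y.
Proof. by move=> E; rewrite -[x](addrK y) E add0r -[LHS]addr0 -(F2D y) addrA addNr add0r. Qed.

Lemma sum_normF (T : eqType) (l : seq T) (F : T -> 'F_2) :
  \sum_(x <- norm l) F x = \sum_(x <- l) F x.
Proof. exact: sum_norm F2D. Qed.

Lemma mem_norm (T : eqType) (l : seq T) : {subset norm l <= l}.
Proof.
elim: l => //= x l IH y.
have: {subset toggle x (norm l) <= x :: norm l}.
  elim: (norm l) => [|z r IHr] //= t; case: eqP => [->|_].
    by move=> tr; rewrite !inE tr !orbT.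
  rewrite !inE => /orP[->|/IHr]; first by rewrite orbT.
  by rewrite inE => /orP[->|->]; rewrite ?orbT.
move=> H /H; rewrite !inE => /orP[->//|/IH ->]; by rewrite orbT.
Qed.

Lemma sum_flat (S T : Type) (l : seq S) (G : S -> seq T) (F : T -> 'F_2) :
  \sum_(y <- flatten [seq G x | x <- l]) F y = \sum_(x <- l) \sum_(y <- G x) F y.
Proof. by rewrite big_flatten big_map. Qed.

Lemma sum_nilp (T : eqType) (l : seq T) (F : T -> 'F_2) :
  nilp (norm l) -> \sum_(x <- l) F x = 0.
Proof. by move=> /nilP E; rewrite -sum_normF E big_nil. Qed.

(** * Functionals on the Steenrod algebra and normal forms *)

Lemma adem_good a b x : (0 < a)%N -> (0 < b)%N -> (a < b.*2)%N -> x \in adem a b ->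
  0%N \notin x /\ sumn x = (a + b)%N.
Proof.
move=> a0 b0 ab /mapP[c]; rewrite mem_filter mem_iota => /andP[_ /andP[_ ca]] ->.
case: (eqVneq c 0%N) => c0 /=; last first.
  by rewrite !inE negb_or; split; [apply/andP; split; lia | lia].
by rewrite inE; split; [lia | lia].
Qed.

Definition positive (w : word) : bool := 0%N \notin w.

Lemma positive_cat u w : positive (u ++ w) = positive u && positive w.
Proof. by rewrite /positive mem_cat negb_or. Qed.

Lemma positive_cons a w : positive (a :: w) = (0 < a)%N && positive w.
Proof. by rewrite /positive inE negb_or lt0n eq_sym. Qed.

Lemma ademP a b x : positive [:: a; b] -> (a < b.*2)%N -> x \in adem a b ->
  positive x /\ sumn x = (a + b)%N.
Proof. by rewrite !positive_cons => /and3P[a0 b0 _]; apply: adem_good. Qed.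

(** Functions of words that descend to the degree k part of the Steenrod algebra. *)
Definition ademinv (k : nat) (phi : word -> 'F_2) : Prop :=
  forall u a b w, positive (u ++ [:: a, b & w]) -> sumn (u ++ [:: a, b & w]) = k ->
  (a < b.*2)%N -> \sum_(x <- adem a b) phi (u ++ x ++ w) = phi (u ++ [:: a, b & w]).

Section Fold.
Variables (g : nat -> word -> seq word) (N : seq word -> seq word).
Hypothesis Nsum : forall l (F : word -> 'F_2), \sum_(x <- N l) F x = \sum_(x <- l) F x.
Hypothesis Nsub : forall l, {subset N l <= l}.
Hypothesis g_good : forall l z y, positive (l :: z) -> y \in g l z ->
  positive y /\ sumn y = (l + sumn z)%N.

Let act (x a : word) := foldr (fun l r => N (flatten [seq g l z | z <- r])) [:: a] x.

Lemma fold_good x a y : positive x -> positive a -> y \in act x a ->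
  positive y /\ sumn y = (sumn x + sumn a)%N.
Proof.
move=> px pa; elim: x y px => [|k x IH] y /=; first by rewrite inE => _ /eqP->.
rewrite positive_cons => /andP[k0 px] /Nsub/flattenP[_ /mapP[s sx ->]] ys.
have [ps ss] := IH _ px sx.
have [|py sy] := g_good _ ys; first by rewrite positive_cons k0.
by rewrite sy ss addnA.
Qed.

(** Multiplying on the left letter by letter does not change an invariant functional. [g] and [N]
    stay abstract, because the same loop occurs inside the recursion of [mulw] and, with [norm], in
    [actw]. *)
Lemma fold_sum k (phi : word -> 'F_2) u x a :
  (forall u l z, positive (u ++ l :: z) -> sumn (u ++ l :: z) = k ->
     \sum_(y <- g l z) phi (u ++ y) = phi (u ++ l :: z)) ->
  positive (u ++ x ++ a) -> sumn (u ++ x ++ a) = k ->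
  \sum_(y <- act x a) phi (u ++ y) = phi (u ++ x ++ a).
Proof.
move=> gsum; elim: x u => [|m x IH] u pu su /=; first by rewrite big_seq1.
have E : rcons u m ++ x ++ a = u ++ (m :: x) ++ a by rewrite cat_rcons.
have := pu; rewrite !positive_cat positive_cons => /and3P[pu' /andP[m0 px] pa].
have F : \sum_(y <- act x a) phi (rcons u m ++ y) = phi (u ++ m :: x ++ a).
  by rewrite IH ?E.
rewrite Nsum sum_flat -F; apply: eq_big_seq => z zx.
have [pz sz] := fold_good px pa zx.
rewrite cat_rcons; apply: gsum; first by rewrite positive_cat pu' positive_cons m0.
by rewrite -su !sumn_cat /= ?sumn_cat sz; lia.
Qed.
End Fold.

Lemma mulw_good f l a y : positive (l :: a) -> y \in mulw f l a ->
  positive y /\ sumn y = (l + sumn a)%N.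
Proof.
elim: f l a y => [|f IH] l a y la /=; first by rewrite inE => /eqP->.
case: a la => [|b a] la; first by rewrite inE => /eqP->.
case: ifP => bl; first by rewrite inE => /eqP->.
move=> /mem_norm /flattenP[_ /mapP[x xl ->]].
have [pb pa] : positive [:: l; b] /\ positive a.
  by move: la; rewrite !positive_cons => /and3P[-> -> ->].
have lb : (l < b.*2)%N by rewrite ltnNge bl.
rewrite -ademE in xl; have [px sx] := ademP pb lb xl.
move=> /(fold_good (N := id) (fun _ _ => id) IH px pa) [py ->].
by rewrite sx addnA.
Qed.

(** Every call either returns the word unchanged, as when the fuel is spent, or applies one Adem
    relation and recurses; so the amount of fuel does not matter here. *)
Lemma mulw_inv k phi f u l a : ademinv k phi -> positive (u ++ l :: a) ->
  sumn (u ++ l :: a) = k ->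
  \sum_(x <- mulw f l a) phi (u ++ x) = phi (u ++ l :: a).
Proof.
move=> inv; elim: f u l a => [|f IH] u l a pu su /=; first by rewrite big_seq1.
case: a pu su => [|b a] pu su; first by rewrite big_seq1.
case: ifP => bl; first by rewrite big_seq1.
have lb : (l < b.*2)%N by rewrite ltnNge bl.
rewrite sum_normF sum_flat -ademE -(inv u l b a) //.
apply: eq_big_seq => x xl.
have [pb [pu' pa]] : positive [:: l; b] /\ positive u /\ positive a.
  by move: pu; rewrite positive_cat !positive_cons => /and4P[-> -> -> ->].
have [px sx] := ademP pb lb xl.
apply: (fold_sum (N := id) (fun _ _ => erefl) (fun _ _ => id) (@mulw_good f) IH).
  by rewrite !positive_cat pu' px.
by rewrite -su !sumn_cat sx /= !addnA.
Qed.

Lemma sqmul_good l a y : positive (l :: a) -> y \in sqmul l a ->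
  positive y /\ sumn y = (l + sumn a)%N.
Proof. exact: mulw_good. Qed.

Lemma actw_good x t y : positive x -> positive t -> y \in actw x t ->
  positive y /\ sumn y = (sumn x + sumn t)%N.
Proof. exact: (fold_good (@mem_norm _) sqmul_good). Qed.

Lemma nf_good w y : positive w -> y \in nf w -> positive y /\ sumn y = sumn w.
Proof. by move=> pw /actw_good [] // py ->; rewrite addn0. Qed.

Lemma nf_inv k phi u w : ademinv k phi -> positive (u ++ w) -> sumn (u ++ w) = k ->
  \sum_(x <- nf w) phi (u ++ x) = phi (u ++ w).
Proof.
move=> inv pu su; rewrite -[in RHS](cats0 w).
apply: (fold_sum (@sum_normF _) (@mem_norm _) sqmul_good (k := k)); rewrite ?cats0 //.
by move=> u' l z; apply: mulw_inv.
Qed.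

Lemma sum_actw_cat (psi : word -> 'F_2) x w t :
  \sum_(y <- actw (x ++ w) t) psi y = \sum_(z <- actw w t) \sum_(y <- actw x z) psi y.
Proof.
elim: x psi => [|l x IH] psi /=; first by apply: eq_bigr => z _; rewrite big_seq1.
rewrite sum_normF sum_flat IH; apply: eq_bigr => z _.
by rewrite sum_normF sum_flat.
Qed.

Section Bounded.
Variable B : nat.
Hypothesis clo : closed_ok B.
Hypothesis ado : adem_ok B.

Lemma sqmul_bas l z e : (0 < l)%N -> (l + e <= B)%N -> z \in bas e -> {subset sqmul l z <= bas (l + e)%N}.
Proof.
move=> l0 le ze; have e_in : e \in iota 0 B.+1 by rewrite mem_iota; lia.
have l_in : l \in iota 1 (B - e) by rewrite mem_iota; lia.
by move/allP/(_ e e_in)/allP/(_ z ze)/allP/(_ l l_in)/allP: clo.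
Qed.

Lemma nf_bas w : positive w -> (sumn w <= B)%N -> {subset nf w <= bas (sumn w)}.
Proof.
elim: w => [|l w IH] /=; first by move=> _ _ y; rewrite inE => /eqP->.
rewrite positive_cons => /andP[l0 pw] lw y /mem_norm /flattenP[_ /mapP[z zw ->]].
by apply: sqmul_bas => //; apply: IH => //; lia.
Qed.

(** The converse of [nf_inv]: any function of the normal form respects the relations. The word w is
    first brought to admissible words t, on which [adem_ok] has tested the relator; then u acts on
    equal results. *)
Lemma nf_adem (psi : word -> 'F_2) u a b w : positive (u ++ [:: a, b & w]) ->
  (sumn (u ++ [:: a, b & w]) <= B)%N -> (a < b.*2)%N ->
  \sum_(x <- adem a b) \sum_(y <- nf (u ++ x ++ w)) psi y =
  \sum_(y <- nf (u ++ [:: a, b & w])) psi y.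
Proof.
move=> pu su ab.
have -> : u ++ [:: a, b & w] = u ++ [:: a; b] ++ w by [].
rewrite /nf sum_actw_cat.
rewrite (eq_bigr (fun x => \sum_(z <- actw (x ++ w) [::]) \sum_(y <- actw u z) psi y)); last first.
  by move=> x _; rewrite sum_actw_cat.
pose chi z := \sum_(y <- actw u z) psi y.
rewrite sum_actw_cat.
rewrite (eq_bigr (fun x => \sum_(z <- nf w) \sum_(y <- actw x z) chi y)); last first.
  by move=> x _; rewrite sum_actw_cat.
rewrite exchange_big; apply: eq_big_seq => t shift_exp.
move: pu; rewrite positive_cat !positive_cons => /and4P[pu a0 b0 pw].
move: su; rewrite sumn_cat /= => su.
have tb : t \in bas (sumn w) by apply: nf_bas shift_exp => //; lia.
have e_in : sumn w \in iota 0 B.+1 by rewrite mem_iota; lia.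
have a_in : a \in iota 1 (B - sumn w) by rewrite mem_iota; lia.
have b_in : b \in iota 1 (B - sumn w - a) by rewrite mem_iota; lia.
have := ado => /allP/(_ _ e_in)/allP/(_ t tb)/allP/(_ a a_in)/allP/(_ b b_in)/implyP/(_ ab).
move/(sum_nilp chi); rewrite sum_flat big_cons => /F2_add0 ->.
by rewrite ademE.
Qed.

Lemma nf_ademinv k (psi : word -> 'F_2) v : (k + sumn v <= B)%N -> positive v ->
  ademinv k (fun w => \sum_(y <- nf (w ++ v)) psi y).
Proof.
move=> kB pv u a b w pu su ab.
have -> : (u ++ [:: a, b & w]) ++ v = u ++ [:: a, b & w ++ v] by rewrite -catA.
rewrite -nf_adem //.
- by apply: eq_bigr => x _; rewrite -!catA.
- by move: pu; rewrite !positive_cat /= !positive_cons positive_cat pv andbT.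
by move: su; rewrite !sumn_cat /= sumn_cat; lia.
Qed.
End Bounded.

(** * Cochains with values in a resolution *)

(* A cochain is a function of the bar words followed by a possibly empty word,
   gathered in one nonempty list, and of a generator. *)
Definition cochain := seq word -> nat -> 'F_2.

Definition wf_args (g : seq nat) (d s : nat) (L : seq word) (v : nat) : bool :=
  [&& size L == s.+1, all positive L, [::] \notin take s L, v < size g &
      sumn (map sumn L) + nth 0 g v == d]%N.

Definition is_coch g d s (c : cochain) : Prop :=
  forall l1 l2 u a b w v, wf_args g d s (l1 ++ (u ++ [:: a, b & w]) :: l2) v ->
  (a < b.*2)%N ->
  \sum_(x <- adem a b) c (l1 ++ (u ++ x ++ w) :: l2) v = c (l1 ++ (u ++ [:: a, b & w]) :: l2) v.

(** The last merge lets the last bar act on the coefficient. There is no face at the other end,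
    since positive degrees act as zero on Z/2. *)
Definition cobd (c : cochain) : cochain := fun L v => \sum_(L' <- merges L) c L' v.

(** Right multiplication of the coefficient, the side on which maps of free left modules act. *)
Fixpoint apl (L : seq word) (y : word) : seq word :=
  if L is w :: L' then if L' is [::] then [:: w ++ y] else w :: apl L' y else [::].

Definition pull (dg : gen_map) (c : cochain) : cochain :=
  fun L v => \sum_(y <- nth [::] dg v) c (apl L y.1) y.2.

Lemma apl_rcons L a y : apl (rcons L a) y = rcons L (a ++ y).
Proof. by elim: L => //= w L ->; case: L. Qed.

Lemma merges_cons2 w1 w2 t : merges (w1 :: w2 :: t) = ((w1 ++ w2) :: t) :: map (cons w1) (merges (w2 :: t)).
Proof. by []. Qed.

(** Separates the merge into the coefficient from the merges among the bars. *)
Lemma merges_rcons2 l w a : merges (rcons (rcons l w) a) =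
  rcons (map (rcons^~ a) (merges (rcons l w))) (rcons l (w ++ a)).
Proof.
elim: l => [//|w1 l IH]; rewrite 3!rcons_cons.
case E: (rcons l w) IH => [|w2 t] IH; first by have := size_rcons l w; rewrite E.
rewrite merges_cons2 map_cons [RHS]rcons_cons.
rewrite [LHS](_ : _ = ((w1 ++ w2) :: rcons t a) :: map (cons w1) (merges (rcons (w2 :: t) a))) //.
by rewrite IH map_rcons -!map_comp.
Qed.

Lemma merges_apl L y : merges (apl L y) = [seq apl L' y | L' <- merges L].
Proof.
case/lastP: L => // L a; rewrite apl_rcons.
case/lastP: L => // L w; rewrite !merges_rcons2 map_rcons apl_rcons -catA; congr (rcons _ _).
by rewrite -map_comp; apply: eq_map => L' /=; rewrite apl_rcons.
Qed.

Lemma size_merges L L' : L' \in merges L -> size L = (size L').+1.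
Proof.
elim: L L' => // w [|w2 t] IH L' //; rewrite merges_cons2 inE => /orP[/eqP->//|].
by case/mapP => M /IH /= -> ->.
Qed.

Lemma sum_merges_cons2 (F : seq word -> 'F_2) w1 w2 t :
  \sum_(L <- merges (w1 :: w2 :: t)) F L =
  F ((w1 ++ w2) :: t) + \sum_(N <- merges (w2 :: t)) F (w1 :: N).
Proof. by rewrite merges_cons2 big_cons big_map. Qed.

(** Merges cancel in pairs by associativity of concatenation alone; the Adem relations do not
    enter. *)
Lemma cobd_cobd (c : cochain) L v : cobd (cobd c) L v = 0.
Proof.
rewrite /cobd; elim: L c => [|w1 [|w2 t] IH] c; rewrite ?big_nil //.
case: t IH => [|w3 t] IH; first by rewrite /= big_seq1 big_nil.
rewrite merges_cons2 big_cons big_map.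
rewrite [X in X + _](_ : _ = c ((w1 ++ w2 ++ w3) :: t) v +
    \sum_(N <- merges (w3 :: t)) c ((w1 ++ w2) :: N) v); last first.
  by rewrite merges_cons2 big_cons big_map -catA.
rewrite [X in _ + X](_ : _ = c ((w1 ++ w2 ++ w3) :: t) v +
    \sum_(N <- merges (w3 :: t)) c ((w1 ++ w2) :: N) v); first exact: F2D.
have E := IH (fun L => c (w1 :: L)); rewrite merges_cons2 !big_cons !big_map in E.
rewrite (merges_cons2 w2) big_cons big_map (merges_cons2 w1) big_cons big_map (F2_add0 E).
rewrite -addrA; congr (_ + _).
rewrite -big_split; apply: eq_big_seq => N Nm; have := size_merges Nm.
case: N Nm => [|n N _ _]; first by case: t {IH E} => // ? ? _ [].
rewrite (sum_merges_cons2 _ w1).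
by apply: (etrans (addrCA _ _ _)); rewrite F2D addr0.
Qed.

(** The merges are sorted by their position relative to W. Those that touch W turn a relation inside
    W into one inside a longer word, and the others leave it in place; this is why [cobd] preserves
    invariance. *)
Lemma sum_merges_cat (F : seq word -> 'F_2) l1 W l2 :
  \sum_(L <- merges (l1 ++ W :: l2)) F L =
  \sum_(l <- merges l1) F (l ++ W :: l2) +
  ((if l1 is p :: l then F (belast p l ++ (last p l ++ W) :: l2) else 0) +
  ((if l2 is q :: l then F (l1 ++ (W ++ q) :: l) else 0) +
  \sum_(l <- merges l2) F (l1 ++ W :: l))).
Proof.
have base (G : seq word -> 'F_2) : \sum_(L <- merges (W :: l2)) G L =
    (if l2 is q :: l then G ((W ++ q) :: l) else 0) + \sum_(l <- merges l2) G (W :: l).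
  case: l2 => [|q l]; last exact: (sum_merges_cons2 G).
  by rewrite /= /merges !big_nil; apply/esym/addr0.
elim: l1 F => [|p [|p' l1] IH] F; first by rewrite big_nil !add0r base.
  by rewrite sum_merges_cons2 base big_nil add0r.
rewrite !cat_cons !sum_merges_cons2 -cat_cons IH -!addrA; congr (_ + (_ + (_ + _))).
Qed.

Section WfArgs.
Variables (g : seq nat) (d : nat).

Lemma wf_args_rcons s ws a v : wf_args g d s (rcons ws a) v =
  [&& size ws == s, all positive ws, positive a, [::] \notin ws, (v < size g)%N &
      (sumn (map sumn ws) + sumn a + nth 0 g v == d)%N].
Proof.
rewrite /wf_args size_rcons eqSS all_rcons map_rcons sumn_rcons.
case: eqP => //= sw; rewrite -cats1 take_size_cat //.
by rewrite [positive a && _]andbC -andbA.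
Qed.

Lemma wf_argsP s L v : wf_args g d s L v -> exists ws a, L = rcons ws a.
Proof. by case/lastP: L => [|ws a]; rewrite /wf_args // => _; exists ws, a. Qed.

Lemma sumn_merges L L' : L' \in merges L ->
  sumn (map sumn L') = sumn (map sumn L).
Proof.
elim: L L' => // w [|w2 t] IH L' //; rewrite merges_cons2 inE => /orP[/eqP->|].
  by rewrite /= sumn_cat addnA.
by case/mapP => M /IH /= E ->; rewrite /= E.
Qed.

Lemma positive_merges L L' : L' \in merges L -> all positive L -> all positive L'.
Proof.
elim: L L' => // w [|w2 t] IH L' //; rewrite merges_cons2 inE => /orP[/eqP->|].
  by rewrite /= positive_cat => /and3P[-> -> ->].
by case/mapP => M /IH H -> /= /andP[-> /H].
Qed.

Lemma nonempty_merges ws ws' : ws' \in merges ws -> [::] \notin ws -> [::] \notin ws'.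
Proof.
elim: ws ws' => // w [|w2 t] IH ws' //; rewrite merges_cons2 inE => /orP[/eqP->|].
  rewrite !inE !negb_or => /and3P[w0 _ ->]; rewrite andbT.
  by case: w w0.
case/mapP => M /IH H ->; rewrite in_cons negb_or => /andP[w0 /H nM].
by rewrite in_cons negb_or w0.
Qed.

Lemma wf_args_merges s L L' v : wf_args g d s.+1 L v -> L' \in merges L ->
  wf_args g d s L' v.
Proof.
move=> aL; have [ws [a E]] := wf_argsP aL; move: aL; rewrite {}E.
case/lastP: ws => [|ws w]; first by rewrite wf_args_rcons.
move=> aL mL; have := sumn_merges mL; have := positive_merges mL.
have := size_merges mL; move: mL aL.
rewrite merges_rcons2 mem_rcons in_cons => /orP[/eqP->|/mapP[ws' wm ->]];
  rewrite !wf_args_rcons !size_rcons !all_rcons !map_rcons !sumn_rcons.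
  move=> /and5P[s1 /andP[pw pws] pa nw /andP[vg dg]] _ H sE.
  have /andP[-> _] := H (introT and3P (And3 pa pw pws)).
  rewrite eqSS in s1; rewrite s1 pws vg sE dg /= andbT.
  by move: nw; rewrite mem_rcons inE negb_or => /andP[_ ->].
move=> /and5P[s1 /andP[pw pws] pa nw /andP[vg dg]] [s2] H sE.
have := nonempty_merges wm nw => ->.
have /andP[-> ->] := H (introT and3P (And3 pa pw pws)).
have := size_merges wm; rewrite size_rcons => -[<-].
by rewrite eqSS in s1; rewrite s1 vg sE dg.
Qed.

End WfArgs.

Lemma mem_merges_l l l1 M : l \in merges l1 -> l ++ M \in merges (l1 ++ M).
Proof.
elim: l1 l => // p [|p' l1] IH l //; rewrite !cat_cons !merges_cons2 !in_cons.
case/orP=> [/eqP->|/mapP[N NP ->]]; first by rewrite cat_cons eqxx.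
by rewrite cat_cons; apply/orP; right; apply: map_f; apply: (IH _ NP).
Qed.

Lemma mem_merges_r l l1 W l2 : l \in merges (W :: l2) -> l1 ++ l \in merges (l1 ++ W :: l2).
Proof.
elim: l1 => // p l1 IH /IH {}IH; rewrite !cat_cons.
by case: l1 IH => [|p' l1] IH; rewrite merges_cons2 in_cons; apply/orP; right; apply: map_f.
Qed.

Lemma mem_merges_at l1 W q l : l1 ++ (W ++ q) :: l \in merges (l1 ++ W :: q :: l).
Proof. by apply: mem_merges_r; rewrite merges_cons2 mem_head. Qed.

Lemma mem_merges_cons W l l2 : l \in merges l2 -> W :: l \in merges (W :: l2).
Proof. by case: l2 => // q l2 H; rewrite merges_cons2 in_cons; apply/orP; right; apply: map_f. Qed.

Section Cochains.
Variables (g : seq nat) (d : nat).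

Lemma coch_cobd s c : is_coch g d s c -> is_coch g d s.+1 (cobd c).
Proof.
move=> Ic l1 l2 u a b w v aL ab; rewrite /cobd.
set W := u ++ [:: a, b & w] in aL *.
rewrite sum_merges_cat.
rewrite (eq_bigr _ (fun x _ => sum_merges_cat _ _ _ _)) !big_split /=.
have aM L : L \in merges (l1 ++ W :: l2) -> wf_args g d s L v.
  by move=> LP; apply: wf_args_merges LP.
congr (_ + (_ + (_ + _))).
- rewrite exchange_big; apply: eq_big_seq => l lP; apply: Ic => //.
  by apply: aM; apply: mem_merges_l.
- case: l1 aL aM => [|p l1] aL aM; first by rewrite big1.
  rewrite (eq_bigr (fun x => c (belast p l1 ++ ((last p l1 ++ u) ++ x ++ w) :: l2) v)).
    rewrite Ic //; first by rewrite /W catA.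
    apply: aM; have := mem_merges_at (belast p l1) (last p l1) W l2.
    by rewrite -[belast p l1 ++ last p l1 :: _]cat_rcons -lastI /W catA.
  by move=> x _; rewrite -!catA.
- case: l2 aL aM => [|q l2] aL aM; first by rewrite big1.
  rewrite (eq_bigr (fun x => c (l1 ++ (u ++ x ++ (w ++ q)) :: l2) v)).
    rewrite Ic //; first by rewrite /W -catA.
    by apply: aM; have := mem_merges_at l1 W q l2; rewrite /W -catA.
  by move=> x _; rewrite -!catA.
rewrite exchange_big; apply: eq_big_seq => l lP; apply: Ic => //.
by apply: aM; apply: mem_merges_r; apply: mem_merges_cons.
Qed.

Lemma coch_sub s c c' : is_coch g d s c -> is_coch g d s c' ->
  is_coch g d s (fun L v => c L v - c' L v).
Proof.
by move=> Ic Ic' l1 l2 u a b w v aL ab; rewrite sumrB Ic ?Ic'.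
Qed.

Lemma ademinv_last s c ws v k : is_coch g d s c -> size ws = s -> all positive ws ->
  [::] \notin ws -> (v < size g)%N -> (sumn (map sumn ws) + k + nth 0%N g v = d)%N ->
  ademinv k (fun a => c (rcons ws a) v).
Proof.
move=> Ic sw pw nw vg dk u a b w pu su ab.
rewrite -!cats1; rewrite -(Ic ws [::]) //; last first.
  by rewrite cats1 wf_args_rcons sw eqxx pw pu nw vg su dk eqxx.
by apply: eq_bigr => x _; rewrite cats1.
Qed.

(** The contracting homotopy for free coefficients: the coefficient becomes a bar, followed by the
    new coefficient 1. Bars are reduced, hence the value 0 when the coefficient is empty. *)
Definition contr (c : cochain) : cochain :=
  fun L v => if last [::] L is [::] then 0 else c (rcons L [::]) v.

Lemma wf_args_contr s L v : wf_args g d s L v -> last [::] L != [::] ->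
  wf_args g d s.+1 (rcons L [::]) v.
Proof.
move=> aL; have [ws [a E]] := wf_argsP aL; move: aL; rewrite {}E last_rcons.
rewrite !wf_args_rcons size_rcons all_rcons map_rcons sumn_rcons mem_rcons in_cons negb_or eqSS.
by case/and5P=> -> pw pa nw /andP[vg dL] a0; rewrite pw pa nw vg addn0 dL eq_sym a0.
Qed.

Lemma coch_contr s c : is_coch g d s.+1 c -> is_coch g d s (contr c).
Proof.
move=> Ic l1 l2 u a b w v aL ab; rewrite /contr !last_cat /=.
case/lastP: l2 aL => [|l2 z] aL.
  rewrite (eq_big_seq (fun x => c (l1 ++ (u ++ x ++ w) :: [:: [::]]) v)).
    rewrite Ic //; last by have := wf_args_contr aL; rewrite last_cat rcons_cat; apply; case: (u).
    by rewrite rcons_cat /=; case: (u).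
  move=> x xP /=; rewrite rcons_cat /=.
  have : x != [::].
    apply/eqP => x0; move: aL xP; rewrite x0 => /and3P[_ + _].
    rewrite all_cat /= positive_cat !positive_cons => /and3P[_ /and4P[_ a0 b0 _] _].
    case/(adem_good a0 b0 ab) => _ /=; lia.
  by case: x {xP} => // k x _; rewrite last_cat; case: (u).
rewrite !last_rcons; case: z aL => [|k z] aL.
  by rewrite big1 // => x _; rewrite last_cat /= last_rcons.
have aL' := wf_args_contr aL; rewrite last_cat /= last_rcons in aL'.
rewrite (eq_bigr (fun x => c (l1 ++ (u ++ x ++ w) :: rcons (rcons l2 (k :: z)) [::]) v)).
  rewrite Ic //; first by rewrite -rcons_cons -rcons_cat.
  by have := aL' isT; rewrite rcons_cat rcons_cons.
by move=> x _; rewrite last_cat /= last_rcons -!rcons_cons -!rcons_cat.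
Qed.

(** The identity d h + h d = 1, where the hypothesis removes the second term. For an empty
    coefficient only the last merge survives, and [contr] undoes it. *)
Lemma cobd_contr s c L v : wf_args g d s.+1 L v ->
  (last [::] L != [::] -> cobd c (rcons L [::]) v = 0) -> cobd (contr c) L v = c L v.
Proof.
move=> aL; have [ws [a E]] := wf_argsP aL; move: aL; rewrite {}E last_rcons.
case/lastP: ws => [|ws w]; first by rewrite wf_args_rcons.
move=> aL c0; rewrite /cobd merges_rcons2 big_rcons /= big_map.
have w0 : w != [::].
  move: aL; rewrite wf_args_rcons => /and5P[_ _ _ + _].
  by rewrite mem_rcons in_cons negb_or eq_sym => /andP[].
case: a aL c0 => [|k a] aL c0.
  rewrite big1 ?add0r => [|M _]; last by rewrite /contr last_rcons.
  by rewrite /contr last_rcons cats0; case: (w) w0.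
have := c0 isT; rewrite /cobd merges_rcons2 big_rcons /= big_map cats0 => /F2_add0 <-.
rewrite merges_rcons2 big_rcons big_map /=.
rewrite [X in _ + X](_ : _ = c (rcons (rcons ws (w ++ k :: a)) [::]) v); last first.
  by rewrite /contr last_rcons; case: (w).
by congr (_ + _); apply: eq_bigr => M _; rewrite /contr last_rcons.
Qed.
End Cochains.

(** * Maps of free modules and dimension shifting *)

Section Pull.
Variables (g0 g1 : seq nat) (dg : gen_map) (d : nat).
Hypothesis gok : gens_ok g0 g1 dg.

Lemma gens_okP v y : (v < size g1)%N -> y \in nth [::] dg v ->
  [/\ positive y.1, (y.2 < size g0)%N & (sumn y.1 + nth 0 g0 y.2 = nth 0 g1 v)%N].
Proof.
move: gok => /andP[/eqP sz /allP H] vg yv.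
have vz : (v < size (zip g1 dg))%N by rewrite size_zip sz minnn.
have := H _ (mem_nth (0%N, [::]) vz); rewrite nth_zip //= => /allP/(_ y yv)/and3P[py yg /eqP E].
by split.
Qed.

Lemma wf_args_apl s L v y : wf_args g1 d s L v -> y \in nth [::] dg v ->
  wf_args g0 d s (apl L y.1) y.2.
Proof.
move=> aL yv; have [ws [a E]] := wf_argsP aL; move: aL; rewrite {}E apl_rcons !wf_args_rcons.
case/and5P=> -> -> pa -> /andP[vg /eqP dL]; have [py yg sy] := gens_okP vg yv.
by rewrite positive_cat pa py yg /= -dL sumn_cat -sy !addnA.
Qed.

Lemma coch_pull s c : is_coch g0 d s c -> is_coch g1 d s (pull dg c).
Proof.
move=> Ic l1 l2 u a b w v aL ab; rewrite /pull exchange_big; apply: eq_big_seq => y yv.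
have := wf_args_apl aL yv.
case/lastP: l2 aL => [|l2 z] aL.
  rewrite cats1 apl_rcons -cats1 => aL'.
  rewrite (eq_bigr (fun x => c (l1 ++ [:: u ++ x ++ (w ++ y.1)]) y.2)).
    by rewrite Ic -?catA //; move: aL'; rewrite -catA.
  by move=> x _; rewrite cats1 apl_rcons -cats1 -!catA.
rewrite -rcons_cons -rcons_cat apl_rcons rcons_cat rcons_cons => aL'.
rewrite -(Ic _ _ _ _ _ _ _ aL' ab); apply: eq_bigr => x _.
by rewrite -rcons_cons -rcons_cat apl_rcons rcons_cat rcons_cons.
Qed.

Lemma cobd_pull c L v : cobd (pull dg c) L v = pull dg (cobd c) L v.
Proof.
rewrite /cobd /pull exchange_big; apply: eq_bigr => y _.
by rewrite merges_apl big_map.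
Qed.
End Pull.

Definition front (L : seq word) : seq word := take (size L).-1 L.

Lemma front_rcons ws a : front (rcons ws a) = ws.
Proof. by rewrite /front size_rcons /= -cats1 take_size_cat. Qed.

(* The functional e with pull d1 e = c, for c vanishing on the image of d2. *)
Definition descend (h : table) (c : cochain) : cochain := fun L v =>
  \sum_(a <- nf (last [::] L)) \sum_(y <- tap h (a, v)) c (rcons (front L) y.1) y.2.

Lemma lookup_mem a t : lookup a t = [::] \/ (a, lookup a t) \in t.
Proof.
elim: t => [|[a' r] t [IH|IH]] /=; [by left | |]; case: eqP => [->|_]; rewrite ?IH ?mem_head;
  by [right | left | right; rewrite in_cons IH orbT].
Qed.

Lemma table_okP g0 g1 h0 v a y : table_ok g0 g1 h0 -> (v < size g0)%N -> y \in tap h0 (a, v) ->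
  [/\ positive y.1, (y.2 < size g1)%N & (sumn y.1 + nth 0 g1 y.2 = sumn a + nth 0 g0 v)%N].
Proof.
move=> /andP[/eqP sz /allP H] vg; rewrite /tap /= => yv.
have vz : (v < size (zip g0 h0))%N by rewrite size_zip sz minnn.
have := H _ (mem_nth (0%N, [::]) vz); rewrite nth_zip //= => /allP Hv.
case: (lookup_mem a (nth [::] h0 v)) => [E|/Hv /allP/(_ y yv)/and3P[py yg /eqP E]].
  by rewrite E in yv.
by split.
Qed.

(** Nonempty bars use up degree, which bounds the coefficient and so the range in which the algebra
    must be known. *)
Lemma sumn_ge ws : [::] \notin ws -> all positive ws -> (size ws <= sumn (map sumn ws))%N.
Proof.
elim: ws => //= w ws IH; rewrite in_cons negb_or => /andP[w0 nw] /andP[pw pws].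
have := IH nw pws; suff : (0 < sumn w)%N by lia.
case: w w0 pw => //= k w _; rewrite positive_cons => /andP[k0 _]; lia.
Qed.

Section Descend.
Variables (B : nat).
Hypotheses (clo : closed_ok B) (ado : adem_ok B).
Variables (g0 g1 : seq nat) (h0 : table).
Hypothesis tok : table_ok g0 g1 h0.

Variables (d s : nat).
Hypothesis bound : forall v, (v < size g0)%N -> (d <= B + s + nth 0 g0 v)%N.

Lemma wf_args_bound ws a v : wf_args g0 d s (rcons ws a) v -> (sumn a <= B)%N.
Proof.
rewrite wf_args_rcons => /and5P[/eqP sw pws _ nw /andP[vg /eqP dL]].
have := sumn_ge nw pws; have := bound vg; rewrite sw; lia.
Qed.

Lemma wf_args_tap ws a v a' y : wf_args g0 d s (rcons ws a) v -> a' \in nf a ->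
  y \in tap h0 (a', v) -> wf_args g1 d s (rcons ws y.1) y.2.
Proof.
rewrite !wf_args_rcons => /and5P[-> -> pa -> /andP[vg /eqP dL]] aP yP.
have [_ sa] := nf_good pa aP; have [-> -> sy] := table_okP tok vg yP.
by rewrite /= -dL -sa -!addnA sy.
Qed.

(** A relation in the coefficient is absorbed by the normal form, a relation in a bar by the
    invariance of c. *)
Lemma coch_descend c : is_coch g1 d s c -> is_coch g0 d s (descend h0 c).
Proof.
move=> Ic l1 l2 u a b w v; rewrite /descend.
case/lastP: l2 => [|l2 z] aL ab.
  rewrite cats1 in aL; rewrite cats1 last_rcons front_rcons.
  rewrite (eq_bigr (fun x => \sum_(a' <- nf (u ++ x ++ w)) \sum_(y <- tap h0 (a', v)) c (rcons l1 y.1) y.2)).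
    apply: (nf_adem clo ado) => //; last exact: wf_args_bound aL.
    by move: aL; rewrite wf_args_rcons => /and5P[].
  by move=> x _; rewrite cats1 last_rcons front_rcons.
rewrite -rcons_cons -rcons_cat in aL *; rewrite last_rcons front_rcons.
rewrite (eq_bigr (fun x => \sum_(a' <- nf z) \sum_(y <- tap h0 (a', v)) c (rcons (l1 ++ (u ++ x ++ w) :: l2) y.1) y.2)); last first.
  by move=> x _; rewrite -rcons_cons -rcons_cat last_rcons front_rcons.
rewrite exchange_big; apply: eq_big_seq => a' aP.
rewrite exchange_big; apply: eq_big_seq => y yP.
have := wf_args_tap aL aP yP; rewrite rcons_cat rcons_cons => aL'.
by rewrite -(Ic _ _ _ _ _ _ _ aL' ab); apply: eq_bigr => x _; rewrite rcons_cat rcons_cons.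
Qed.

Variables (g2 : seq nat) (d1 d2 : gen_map) (h1 : table) (B1 : nat).
Hypotheses (gok1 : gens_ok g0 g1 d1) (gok2 : gens_ok g1 g2 d2).
Hypothesis tok1 : table_ok g1 g2 h1.
Hypothesis exa : exact_ok B1 g1 d1 d2 h0 h1.
Hypothesis dB1 : (d <= B1 + s)%N.
Hypothesis B1B : forall v, (v < size g1)%N -> (B1 <= B + nth 0 g1 v)%N.

(** By the homotopy, c (h0 d1 x) = c x + c (d2 h1 x), and c vanishes on the image of d2. The
    homotopy identity is certified on admissible words only, so both sides are reduced to the words
    of [nf a]. *)
Lemma pull_descend c : is_coch g1 d s c ->
  (forall L v, wf_args g2 d s L v -> pull d2 c L v = 0) ->
  forall L v, wf_args g1 d s L v -> pull d1 (descend h0 c) L v = c L v.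
Proof.
move=> Ic c0 L v aL; have [ws [a E]] := wf_argsP aL; move: aL; rewrite {}E => aL.
have := aL; rewrite wf_args_rcons => /and5P[/eqP sw pws pa nw /andP[vg /eqP dL]].
have sB : (sumn a + nth 0%N g1 v <= B1)%N by move: (sumn_ge nw pws) dB1; rewrite -dL sw; clear; lia.
pose beta (x : word * nat) := c (rcons ws x.1) x.2.
have beta_inv u k : (u < size g1)%N -> (sumn (map sumn ws) + k + nth 0%N g1 u = d)%N ->
    ademinv k (fun a => beta (a, u)) by move=> ug dk; apply: (ademinv_last Ic).
pose psi x := \sum_(y <- tap h0 x) beta y.
have psiE t : \sum_(y <- nth [::] d1 v) \sum_(a' <- nf (t ++ y.1)) psi (a', y.2) =
    \sum_(x <- nfe (dap d1 [:: (t, v)])) psi x.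
  rewrite /nfe sum_normF sum_flat /dap /= cats0 big_map.
  by apply: eq_bigr => y _; rewrite big_map.
have basic t : t \in nf a -> \sum_(y <- nth [::] d1 v) \sum_(a' <- nf (t ++ y.1)) psi (a', y.2) = beta (t, v).
  move=> tP; have [pt st] := nf_good pa tP.
  have aLt : wf_args g1 d s (rcons ws t) v.
    by rewrite wf_args_rcons sw eqxx pws pt nw vg st dL eqxx.
  have vB := B1B vg.
  have aB : (sumn a <= B)%N by rewrite -(leq_add2r (nth 0%N g1 v)); apply: leq_trans sB vB.
  have tb : t \in bas (sumn a) by apply: (nf_bas clo ado pa aB tP).
  have v_in : v \in iota 0 (size g1) by rewrite mem_iota.
  have e_in : sumn a \in iota 0 (B1.+1 - nth 0%N g1 v).
    by rewrite mem_iota add0n ltn_subRL /= addnC ltnS.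
  have := exa => /allP/(_ v v_in)/allP/(_ _ e_in)/allP/(_ t tb).
  set l := (t, v) :: _ => nl.
  pose wf (x : word * nat) := [/\ positive x.1, (x.2 < size g1)%N &
     (sumn (map sumn ws) + sumn x.1 + nth 0 g1 x.2 = d)%N].
  have nfeE r : {in r, forall x, wf x} -> \sum_(x <- nfe r) beta x = \sum_(x <- r) beta x.
    move=> wr; rewrite /nfe sum_normF sum_flat; apply: eq_big_seq => x /wr [px xg xd].
    rewrite big_map; case: x px xg xd => x u /= px xg xd.
    exact: (nf_inv (beta_inv u (sumn x) xg xd) (u := [::])).
  have wl : {in l, forall x, wf x}.
    move=> x; rewrite /l in_cons mem_cat => /or3P[/eqP->|/flatten_mapP[z]|].
    - by split; rewrite ?st.
    - rewrite /nfe /dap /= cats0 => /mem_norm /flattenP[_ /mapP[_ /mapP[y yv ->] ->]] /mapP[a' aP ->] xP.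
      have [py yg sy] := gens_okP gok1 vg yv; have [|_ sa] := nf_good _ aP.
        by rewrite positive_cat pt.
      have [px xg sx] := table_okP tok yg xP; split=> //.
      by rewrite -addnA sx sa sumn_cat st -dL -sy !addnA.
    move=> /flatten_mapP[z zP /mapP[y yP ->]] /=.
    have [pz zg sz] := table_okP tok1 vg zP; have [py yg sy] := gens_okP gok2 zg yP.
    split=> //=; first by rewrite positive_cat pz.
    by rewrite sumn_cat -!addnA sy sz st addnA.
  have : \sum_(x <- nfe l) beta x = 0 by move/nilP: nl => ->; rewrite big_nil.
  rewrite nfeE // big_cons big_cat /= sum_flat -psiE.
  rewrite [X in _ + (_ + X) = _](_ : _ = 0); last first.
    rewrite /dap sum_flat big1_seq // => z /= zP.
    have [pz zg sz] := table_okP tok1 vg zP.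
    rewrite big_map /beta /= -[RHS](c0 (rcons ws z.1) z.2).
      by apply: eq_bigr => y _; rewrite apl_rcons.
    by rewrite wf_args_rcons sw eqxx pws pz nw zg -addnA sz st addnA dL eqxx.
  by rewrite addr0 => /F2_add0.
rewrite /pull -[RHS](nf_inv (u := [::]) (beta_inv v (sumn a) vg dL) pa erefl).
rewrite -(eq_big_seq _ basic) exchange_big; apply: eq_big_seq => y yv.
rewrite apl_rcons /descend last_rcons front_rcons.
have [py yg sy] := gens_okP gok1 vg yv.
have := wf_args_apl gok1 aL yv; rewrite apl_rcons => /wf_args_bound; rewrite sumn_cat => yB.
exact/esym/(nf_inv (u := [::]) (nf_ademinv clo ado (fun a' => psi (a', y.2)) yB py)).
Qed.
End Descend.

Lemma pull_pull g0 g1 g2 d1 d2 d s b :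
  gens_ok g0 g1 d1 -> gens_ok g1 g2 d2 -> dd_ok d1 d2 -> is_coch g0 d s b ->
  forall L v, wf_args g2 d s L v -> pull d2 (pull d1 b) L v = 0.
Proof.
move=> ok1 ok2 dd Ib L v aL; have [ws [a E]] := wf_argsP aL; move: aL; rewrite {}E => aL.
have := aL; rewrite wf_args_rcons => /and5P[/eqP sw pws pa nw /andP[vg /eqP dL]].
pose psi (x : word * nat) := b (rcons ws (a ++ x.1)) x.2.
have vd : nth [::] d2 v \in d2 by case/andP: ok2 => /eqP sz _; rewrite mem_nth // sz.
have := allP dd _ vd => /(sum_nilp psi).
rewrite sum_flat /dap sum_flat => E.
rewrite -[RHS]E; apply: eq_big_seq => y yv.
have [py yg sy] := gens_okP ok2 vg yv.
rewrite big_map apl_rcons; apply: eq_big_seq => z zy /=.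
have [pz zg sz] := gens_okP ok1 yg zy.
rewrite apl_rcons -catA big_map.
have inv : ademinv (sumn a + sumn (y.1 ++ z.1)) (fun w => b (rcons ws w) z.2).
  apply: (ademinv_last Ib) => //.
  by rewrite sumn_cat -!addnA sz sy !addnA.
rewrite -(nf_inv inv) //; first by rewrite !positive_cat pa py.
by rewrite !sumn_cat.
Qed.

Lemma eq_pull g0 g1 d1 d s c c' : gens_ok g0 g1 d1 ->
  (forall L v, wf_args g0 d s L v -> c L v = c' L v) ->
  forall L v, wf_args g1 d s L v -> pull d1 c L v = pull d1 c' L v.
Proof. by move=> ok E L v aL; apply: eq_big_seq => y yv; apply/E/(wf_args_apl ok aL yv). Qed.

Lemma eq_cobd g d s c c' : (forall L v, wf_args g d s L v -> c L v = c' L v) ->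
  forall L v, wf_args g d s.+1 L v -> cobd c L v = cobd c' L v.
Proof. by move=> E L v aL; apply: eq_big_seq => M ML; apply/E/(wf_args_merges aL ML). Qed.

(* Exactness, in cohomological degree s + 1 and degree d, of the cochains on
   the kernel of the differential dg of a resolution. *)
Definition kernel_exact (g g' : seq nat) (dg : gen_map) (d s : nat) : Prop := forall c,
  is_coch g d s.+1 c -> (forall L v, wf_args g d s.+2 L v -> cobd c L v = 0) ->
  (forall L v, wf_args g' d s.+1 L v -> pull dg c L v = 0) ->
  exists b, [/\ is_coch g d s b, forall L v, wf_args g d s.+1 L v -> cobd b L v = c L v
            & forall L v, wf_args g' d s L v -> pull dg b L v = 0].

(** The primitive is [contr c]. On a nonempty word its pullback equals that of c by the cocycle
    identity, hence is 0; on the empty word it would lie in the degree of a generator of g', which d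
    is not. *)
Lemma kernel_exact0 g g' dg d : gens_ok g g' dg -> d \notin g' -> kernel_exact g g' dg d 0.
Proof.
move=> ok dg' c Ic zc pc; exists (contr c); split; first exact: coch_contr.
  by move=> L v aL; apply: (cobd_contr aL) => nL; apply/zc/(wf_args_contr aL).
move=> L v aL; have [ws [a E]] := wf_argsP aL; move: aL; rewrite {}E => aL.
have := aL; rewrite wf_args_rcons => /and5P[/eqP sw pws pa nw /andP[vg /eqP dL]].
case: ws sw pws nw dL aL => //= _ _ _ dL aL.
have a0 : a != [::].
  apply/eqP => a0; case/negP: dg'; rewrite -dL a0 /=; exact: mem_nth.
rewrite -[RHS](pc [:: a; [::]] v); last first.
  by rewrite /wf_args /= pa vg inE eq_sym a0 !addn0 in dL *; rewrite dL eqxx.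
apply: eq_big_seq => y yv; have [py yg sy] := gens_okP ok vg yv.
rewrite /= /contr /=; case E: (a ++ y.1) => [|k w]; first by case: (a) a0 E.
rewrite -E; case: (eqVneq y.1 [::]) => [->|y0]; first by rewrite cats0.
have := zc [:: a; y.1; [::]] y.2; rewrite /cobd !merges_cons2 /= !big_cons big_nil addr0 cats0.
move=> H; apply/F2_add0/H.
rewrite /wf_args /= pa py yg !inE negb_or !(eq_sym [::]) a0 y0 /= addn0.
by rewrite add0n in dL; rewrite -dL -sy addn0 addnA.
Qed.

(** The connecting map made explicit. With b = [contr c], the cocycle [pull d1 b] belongs to the
    next kernel, so it is the coboundary of some b'; exactness gives e with [pull d1 e] = b', and b
    - [cobd e] is the wanted primitive. *)
Lemma kernel_exactS B B1 g0 g1 g2 d1 d2 h0 h1 d s :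
  closed_ok B -> adem_ok B -> table_ok g0 g1 h0 -> table_ok g1 g2 h1 ->
  gens_ok g0 g1 d1 -> gens_ok g1 g2 d2 -> dd_ok d1 d2 -> exact_ok B1 g1 d1 d2 h0 h1 ->
  (forall v, (v < size g0)%N -> (d <= B + s + nth 0 g0 v)%N) ->
  (d <= B1 + s)%N ->
  (forall v, (v < size g1)%N -> (B1 <= B + nth 0 g1 v)%N) ->
  kernel_exact g1 g2 d2 d s -> kernel_exact g0 g1 d1 d s.+1.
Proof.
move=> clo ado tok0 tok1 ok1 ok2 dd exa bound dB1 B1B IH c Ic zc pc.
pose b := contr c.
have Ib : is_coch g0 d s.+1 b by apply: coch_contr.
have cb L v : wf_args g0 d s.+2 L v -> cobd b L v = c L v.
  by move=> aL; apply: (cobd_contr aL) => nL; apply/zc/(wf_args_contr aL).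
have [|L v aL|L v aL|b' [Ib' cb' pb']] := IH (pull d1 b).
- exact: coch_pull Ib.
- by rewrite cobd_pull -(pc _ _ aL); apply: eq_pull ok1 cb _ _ aL.
- exact: (pull_pull ok1 ok2 dd Ib aL).
pose e := descend h0 b'.
have Ie : is_coch g0 d s e by apply: (coch_descend clo ado tok0 bound).
exists (fun L v => b L v - cobd e L v); split.
- by apply: coch_sub => //; apply: coch_cobd.
- move=> L v aL; rewrite -cb // /cobd sumrB [X in _ - X]cobd_cobd subr0 //.
move=> L v aL; rewrite /pull sumrB.
have -> : \sum_(y <- nth [::] d1 v) cobd e (apl L y.1) y.2 = pull d1 b L v.
  rewrite -cb' // -[LHS]/(pull d1 (cobd e) L v) -cobd_pull; apply: eq_cobd aL.
  exact: (pull_descend clo ado tok0 bound ok1 ok2 tok1 exa dB1 B1B Ib' pb').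
by rewrite subrr.
Qed.

(** * From free coefficients to trivial coefficients *)

Definition bar_word (d s : nat) (ws : seq word) : bool :=
  [&& size ws == s, all positive ws, [::] \notin ws & sumn (map sumn ws) == d].

Definition bar_cochain (d s : nat) (c : seq word -> 'F_2) : Prop :=
  forall l1 l2 u a b w, bar_word d s (l1 ++ (u ++ [:: a, b & w]) :: l2) -> (a < b.*2)%N ->
  \sum_(x <- adem a b) c (l1 ++ (u ++ x ++ w) :: l2) = c (l1 ++ (u ++ [:: a, b & w]) :: l2).

(** Exactness at the bottom: [h0] writes each admissible word of positive degree as an element of
    the left ideal generated by the entries of [d1]. *)
Definition aug_ok (B : nat) (d1 : gen_map) (h0 : table) : bool :=
  all (fun e => all (fun a => nilp (nfe ((a, 0%N) :: dap d1 (tap h0 (a, 0%N))))) (bas e)) (iota 1 B).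

Section Augmentation.
Variables (d : nat).

Lemma wf_args_unit s ws a v : wf_args [:: 0%N] d s (rcons ws a) v ->
  v = 0%N /\ (a = [::] -> bar_word d s ws).
Proof.
rewrite wf_args_rcons /bar_word => /and5P[-> -> _ -> /andP[]].
by rewrite ltnS leqn0 => /eqP -> /= /eqP E; split=> // a0; move: E; rewrite a0 /= !addn0 => ->.
Qed.

Lemma bar_word_wf_args s ws : bar_word d s ws -> wf_args [:: 0%N] d s (rcons ws [::]) 0.
Proof. by rewrite wf_args_rcons /bar_word => /and4P[-> -> -> E]; rewrite /= !addn0. Qed.

(** The pullback along the augmentation of A, zero on coefficients of positive degree. *)
Definition coaug (c : seq word -> 'F_2) : cochain :=
  fun L _ => if last [::] L is [::] then c (front L) else 0.

Lemma coaug_rcons c ws a v : coaug c (rcons ws a) v = if a is [::] then c ws else 0.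
Proof. by rewrite /coaug last_rcons front_rcons. Qed.

Lemma coch_coaug s c : bar_cochain d s c -> is_coch [:: 0%N] d s (coaug c).
Proof.
move=> Ic l1 l2 u a b w v; case/lastP: l2 => [|l2 z] aL ab.
  have pW := aL; move: pW; rewrite !cats1 wf_args_rcons => /and5P[_ _ pW _ _].
  rewrite coaug_rcons; transitivity (0 : 'F_2); last by case: (u).
  rewrite big1_seq // => x /= xP; rewrite cats1 coaug_rcons.
  move: pW; rewrite positive_cat !positive_cons => /and4P[_ a0 b0 _].
  have [_] := adem_good a0 b0 ab xP.
  case: x {xP} => [|k x]; first by move=> /= E; move: a0; rewrite -ltnS; lia.
  by case: (u).
have E x : l1 ++ x :: rcons l2 z = rcons (l1 ++ x :: l2) z by rewrite rcons_cat rcons_cons.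
rewrite E in aL; have [_ bw] := wf_args_unit aL.
under eq_bigr do rewrite E coaug_rcons.
rewrite E coaug_rcons; case: z aL bw {E} => [|k z] aL bw; last by rewrite big1.
exact: (Ic _ _ _ _ _ _ (bw erefl) ab).
Qed.

(** In this range Z/2 is the cokernel of [d1], so cochains killed by [pull d1] are those that factor
    through the augmentation. The primitive found for [coaug c] is therefore itself a bar cochain,
    followed by an empty coefficient. *)
Lemma bar_exact s B B1 g1 d1 h0 :
  closed_ok B -> adem_ok B -> gens_ok [:: 0%N] g1 d1 -> table_ok [:: 0%N] g1 h0 ->
  aug_ok B1 d1 h0 -> (B1 <= B)%N -> (d <= B1 + s)%N -> all (leq 1) g1 ->
  kernel_exact [:: 0%N] g1 d1 d s ->
  forall c, bar_cochain d s.+1 c ->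
  (forall ws, bar_word d s.+2 ws -> \sum_(ws' <- merges ws) c ws' = 0) ->
  exists2 b, bar_cochain d s b &
    forall ws, bar_word d s.+1 ws -> \sum_(ws' <- merges ws) b ws' = c ws.
Proof.
move=> clo ado ok tok aug B1B dB1 g1pos ke c Ic zc.
have [||L v aL|b [Ib cb pb]] := ke (coaug c).
- exact: coch_coaug.
- move=> L v aL; have [ws [a E]] := wf_argsP aL; move: aL; rewrite {}E.
  case/lastP: ws => [|ws w] aL; first by move: aL; rewrite wf_args_rcons.
  have [_ bw] := wf_args_unit aL.
  have w0 : w != [::].
    move: aL; rewrite wf_args_rcons => /and5P[_ _ _ + _].
    by rewrite mem_rcons in_cons negb_or eq_sym => /andP[].
  rewrite /cobd merges_rcons2 big_rcons /= coaug_rcons big_map.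
  have -> : (if w ++ a is [::] then c ws else 0) = 0 by case: (w) w0.
  rewrite addr0; under eq_bigr do rewrite coaug_rcons.
  by case: a aL bw => [|k a] _ bw; [apply/zc/bw | rewrite big1].
- have [ws [a E]] := wf_argsP aL; move: aL; rewrite {}E => aL.
  have := aL; rewrite wf_args_rcons => /and5P[_ _ _ _ /andP[vg _]].
  rewrite /pull big1_seq // => y /= yv; rewrite apl_rcons coaug_rcons.
  have [_ yg] := gens_okP ok vg yv; move: yg; rewrite /= ltnS leqn0 => /eqP -> /=.
  have /= := all_nthP 0%N g1pos v vg.
  rewrite addn0 => + E; rewrite -E; case: (y.1) => //= k r _; by case: (a).
(* [aug] rewrites w through [d1], and b vanishes on the image of [d1]. *)
have b0 ws w : w != [::] -> wf_args [:: 0%N] d s (rcons ws w) 0 -> b (rcons ws w) 0%N = 0.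
  move=> w0 aL; have := aL; rewrite wf_args_rcons => /and5P[/eqP sw pws pw nw /andP[_ /eqP dL]].
  rewrite /= addn0 in dL.
  have wB1 : (sumn w <= B1)%N by move: (sumn_ge nw pws) dB1; rewrite -dL sw; clear; lia.
  have inv k : (sumn (map sumn ws) + k = d)%N -> ademinv k (fun t => b (rcons ws t) 0%N).
    by move=> kd; apply: (ademinv_last Ib) => //=; rewrite addn0.
  rewrite -[LHS](nf_inv (u := [::]) (inv _ dL) pw erefl) big1_seq // => t /= tP.
  have [pt st] := nf_good pw tP.
  have tb : t \in bas (sumn w) by apply: (nf_bas clo ado pw (leq_trans wB1 B1B) tP).
  have e_in : sumn w \in iota 1 B1.
    rewrite mem_iota add1n ltnS wB1 andbT; case: (w) w0 pw => //= k r _.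
    by rewrite positive_cons => /andP[k0 _]; rewrite addn_gt0 k0.
  have := aug => /allP/(_ _ e_in)/allP/(_ t tb).
  set l := _ :: _ => nl.
  pose beta (x : word * nat) := b (rcons ws x.1) 0%N.
  have : \sum_(x <- nfe l) beta x = 0 by move/nilP: nl => ->; rewrite big_nil.
  rewrite /nfe sum_normF sum_flat.
  have nfE x : positive x.1 -> sumn x.1 = sumn w ->
      \sum_(y <- [seq (z, x.2) | z <- nf x.1]) beta y = beta x.
    move=> px sx; rewrite big_map; apply: (nf_inv (u := [::]) (inv (sumn x.1) _)) => //.
    by rewrite sx.
  rewrite /l big_cons nfE // => /F2_add0 E; rewrite -[LHS]/(beta (t, 0%N)) E {E}.
  rewrite /dap sum_flat big1_seq // => z /= zP; rewrite big_map /=.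
  have [pz zg sz] := table_okP tok (isT : (0 < size [:: 0%N])%N) zP.
  rewrite -[RHS](pb (rcons ws z.1) z.2); last first.
    by rewrite wf_args_rcons sw eqxx pws pz nw zg -addnA sz /= addn0 st dL eqxx.
  apply: eq_big_seq => y yv; have [py yg sy] := gens_okP ok zg yv.
  move: yg sy; rewrite /= ltnS leqn0 => /eqP y0; rewrite y0 /= addn0 => sy.
  rewrite [LHS](nfE (z.1 ++ y.1, 0%N)) /=; first by rewrite /beta /= apl_rcons.
    by rewrite positive_cat pz.
  by rewrite sumn_cat sy sz /= addn0 st.
exists (fun ws => b (rcons ws [::]) 0%N).
  move=> l1 l2 u a b' w bw ab; have := bar_word_wf_args bw.
  rewrite rcons_cat rcons_cons => /Ib /(_ ab) <-.
  by apply: eq_bigr => x _; rewrite rcons_cat rcons_cons.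
move=> ws bw; have aL := bar_word_wf_args bw; have := cb _ _ aL.
rewrite coaug_rcons => <-; case/lastP: ws bw aL => // ws w bw aL.
rewrite /cobd merges_rcons2 big_rcons /= big_map cats0 b0 ?addr0 //.
  by move: bw => /and4P[_ _ + _]; rewrite mem_rcons in_cons negb_or eq_sym => /andP[].
by apply: (wf_args_merges aL); rewrite merges_rcons2 mem_rcons cats0 mem_head.
Qed.
End Augmentation.

(** * The bar construction of the ground field *)

Lemma set_nth_cat (T : Type) (x0 : T) l1 w l2 w' :
  set_nth x0 (l1 ++ w :: l2) (size l1) w' = l1 ++ w' :: l2.
Proof. by elim: l1 => //= z l1 ->. Qed.

Lemma bar_relatorsP ws m r : reflect
  (exists l1 l2 u a b w, [/\ ws = l1 ++ (u ++ [:: a, b & w]) :: l2, (a < b.*2)%N &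
     r = [seq (l1 ++ (u ++ x ++ w) :: l2, m) | x <- [:: a; b] :: adem a b]])
  (r \in bar_relators (ws, m)).
Proof.
apply: (iffP flatten_mapP) => /=.
  case=> j; rewrite mem_iota => /andP[_ jw] /mapP[_ /mapP[i + ->] ->].
  rewrite mem_filter mem_iota => /and3P[ab _ iw].
  set W := nth [::] ws j in ab iw *.
  have Ew : ws = take j ws ++ W :: drop j.+1 ws by rewrite -drop_nth // cat_take_drop.
  have i1 : (i.+1 < size W)%N by move: iw; rewrite add0n; case: (size W).
  have EW : W = take i W ++ [:: nth 0%N W i, nth 0%N W i.+1 & drop i.+2 W].
    by rewrite -!drop_nth ?cat_take_drop // ltnW.
  exists (take j ws), (drop j.+1 ws), (take i W), (nth 0%N W i), (nth 0%N W i.+1), (drop i.+2 W).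
  split=> //; first by rewrite -EW.
  rewrite -map_comp; apply: eq_map => x /=; congr pair.
  rewrite [in LHS]Ew -[X in set_nth _ _ X](_ : size (take j ws) = j) ?set_nth_cat //.
  by rewrite size_take jw.
case=> l1 [l2 [u [a [b [w [-> ab ->]]]]]].
exists (size l1); first by rewrite mem_iota size_cat /=; lia.
rewrite nth_cat ltnn subnn /=; apply/mapP.
exists [seq u ++ x ++ w | x <- [:: a; b] :: adem a b]; last first.
  rewrite /= set_nth_cat -map_comp; congr (_ :: _).
  by apply: eq_map => x /=; rewrite set_nth_cat.
have n1 : nth 0%N (u ++ [:: a, b & w]) (size u) = a by rewrite nth_cat ltnn subnn.
have n2 : nth 0%N (u ++ [:: a, b & w]) (size u).+1 = b.
  by rewrite nth_cat ltnNge leqnSn /= subSnn.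
apply/mapP; exists (size u).
  by rewrite mem_filter n1 n2 ab mem_iota size_cat /=; lia.
have E x : take (size u) (u ++ [:: a, b & w]) ++ x ++ drop (size u).+2 (u ++ [:: a, b & w]) =
    u ++ x ++ w.
  rewrite take_size_cat // -addn2 drop_cat -[X in (_ < X)%N]addn0 ltn_add2l /=.
  by rewrite addKn /= drop0.
rewrite n1 n2 /=; congr (_ :: _); first exact/esym/(E [:: a; b]).
by apply: eq_map => x; rewrite E.
Qed.

Section Vec.
Variables (M : monmod) (s d : nat).

Lemma vec_cat r1 r2 : vec M s d (r1 ++ r2) = vec M s d r1 + vec M s d r2.
Proof. by apply/ffunP => x; rewrite !ffunE count_cat natrD. Qed.

Lemma vec_nil : vec M s d [::] = 0.
Proof. by apply/ffunP => x; rewrite !ffunE. Qed.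

Lemma vec_sum r : vec M s d r = \sum_(l <- r) vec M s d [:: l].
Proof.
elim: r => [|l r IH]; first by rewrite big_nil vec_nil.
by rewrite big_cons -IH -vec_cat.
Qed.

Lemma vec_label (x y : barbasis M s d) : vec M s d [:: label x] y = (y == x)%:R.
Proof. by rewrite ffunE /= addn0 eq_sym (inj_eq (@label_inj M s d)) eq_sym. Qed.

Lemma prebar_sum (v : prebar M s d) : v = \sum_x v x *: vec M s d [:: label x].
Proof.
apply/ffunP => y; rewrite sum_ffunE (bigD1 y) //= big1 ?addr0 => [|x xy].
  by rewrite ffunE vec_label eqxx; apply/esym/mulr1.
by rewrite ffunE vec_label eq_sym (negPf xy); apply: mulr0.
Qed.

Lemma prebar_ext (W : vectType 'F_2) (f g : 'Hom(prebar M s d, W)) :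
  (forall x : barbasis M s d, f (vec M s d [:: label x]) = g (vec M s d [:: label x])) -> f = g.
Proof.
move=> E; apply/lfunP => v; rewrite (prebar_sum v) !linear_sum.
by apply: eq_bigr => x _; rewrite !linearZ /= E.
Qed.

Lemma extend_label M' s' d' f (x : barbasis M s d) :
  extend M M' s d s' d' f (vec M s d [:: label x]) = vec M' s' d' (f (label x)).
Proof.
rewrite lfunE /= /extend_fun (bigD1 x) //= big1 ?addr0 => [|y yx].
  by rewrite vec_label eqxx scale1r.
by rewrite vec_label (negPf yx) scale0r.
Qed.

End Vec.

Section DualExact.
Variables (F : fieldType) (X3 X2 X1 Q3 Q2 Q1 : vectType F).
Variables (p3 : 'Hom(X3, Q3)) (p2 : 'Hom(X2, Q2)) (p1 : 'Hom(X1, Q1)).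
Variables (i3 : 'Hom(Q3, X3)) (i2 : 'Hom(Q2, X2)) (i1 : 'Hom(Q1, X1)).
Hypotheses (i3K : cancel i3 p3) (i2K : cancel i2 p2) (i1K : cancel i1 p1).
Variables (e3 : 'Hom(X3, X2)) (e2 : 'Hom(X2, X1)).

Lemma lker_section (V W Q : vectType F) (p : 'Hom(V, Q)) (i : 'Hom(Q, V)) (f : 'Hom(V, W)) v :
  cancel i p -> (lker p <= lker f)%VS -> f (i (p v)) = f v.
Proof.
move=> iK pf; apply/eqP; rewrite -subr_eq0 -linearB -memv_ker; apply: (subvP pf).
by rewrite memv_ker linearB /= iK subrr.
Qed.

(** A linear form on a quotient is a form on the large space that kills the kernel of p. On such
    forms the chosen section i is invisible, by [lker_section], so exactness can be proved before
    passing to quotients. *)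
Lemma dual_exact :
  (forall f : dual X2, (lker p2 <= lker f)%VS -> (lker p3 <= lker (f \o e3))%VS) ->
  (forall f : dual X2, (lker p2 <= lker f)%VS -> (f \o e3)%VF = 0 ->
     exists2 h : dual X1, (lker p1 <= lker h)%VS & (h \o e2)%VF = f) ->
  \dim {: homology (dualmap (p1 \o e2 \o i2)%VF) (dualmap (p2 \o e3 \o i3)%VF)} = 0%N.
Proof.
move=> closed_e ex.
apply/eqP; rewrite dimv_eq0 -subv0; apply/subvP => z _; rewrite memv0.
rewrite -(hrepK z) hcls_eq0; last by rewrite memv_ker hrep_cycle.
move: (hrep _ _ z) (hrep_cycle z) => phi; rewrite lfunE => phi0.
pose f : dual X2 := (phi \o p2)%VF.
have fE v : f v = phi (p2 v) by rewrite comp_lfunE.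
have fR : (lker p2 <= lker f)%VS.
  by apply/subvP => v; rewrite !memv_ker fE => /eqP ->; rewrite linear0.
have [|h hR hf] := ex f fR.
  apply/lfunP => v; rewrite -(lker_section _ i3K (closed_e f fR)) comp_lfunE fE.
  by have /lfunP/(_ (p3 v)) := phi0; rewrite !comp_lfunE lfunE => ->; rewrite lfunE.
apply/memv_imgP; exists (h \o i1)%VF; first exact: memvf.
rewrite lfunE; apply/lfunP => y.
by rewrite !comp_lfunE (lker_section _ i1K hR) -[RHS]comp_lfunE hf fE i2K.
Qed.
End DualExact.

Section FunctionalDef.
Variables (M : monmod) (s d : nat) (c : barlabel -> 'F_2).

Definition functional_fun (v : prebar M s d) : ('F_2)^o := \sum_x v x * c (label x).

Fact functional_is_linear : linear functional_fun.
Proof.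
move=> k u v; rewrite /functional_fun scaler_sumr -big_split /=.
by apply: eq_bigr => x _; rewrite !ffunE mulrDl -mulrA.
Qed.
HB.instance Definition _ :=
  GRing.isSemilinear.Build 'F_2 (prebar M s d) ('F_2)^o _ functional_fun
    (GRing.semilinear_linear functional_is_linear).

Definition functional : dual (prebar M s d) := linfun functional_fun.

Lemma functional_label (x : barbasis M s d) : functional (vec M s d [:: label x]) = c (label x).
Proof.
rewrite lfunE /= /functional_fun (bigD1 x) //= big1 ?addr0 => [|y yx].
  by rewrite vec_label eqxx mul1r.
by rewrite vec_label (negPf yx) mul0r.
Qed.
End FunctionalDef.

Section Functional.
Variable d : nat.
Let P := Ppow 0.

Lemma is_label_unit s ws : is_label P s d (ws, [::]) = bar_word d s ws.
Proof.
rewrite /is_label /bar_word /bardeg /= big_nil addr0 eqz_nat.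
case: eqP => //= _; rewrite !andbA; congr (_ && _).
elim: ws => //= w ws ->; rewrite in_cons negb_or eq_sym /positive.
by case: (_ == _); case: (_ \in w); case: (all _ _) => //=; rewrite ?andbF.
Qed.

Lemma label_unit s (x : barbasis P s d) : label x = ((label x).1, [::]) /\ bar_word d s (label x).1.
Proof.
have := valP x; rewrite -/(label x) -is_label_unit.
case: (label x) => ws m lab; have := lab; case/and5P=> _ _ + _ _.
by move/nilP => /= E; move: lab; rewrite E.
Qed.

Lemma bar_word_label s ws : bar_word d s ws -> exists x : barbasis P s d, label x = (ws, [::]).
Proof. by rewrite -is_label_unit; apply: (label_surj (i := 0)); left. Qed.

Definition val_at s (f : dual (prebar P s d)) (ws : seq word) : 'F_2 :=
  f (vec P s d [:: (ws, [::])]).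

Lemma val_at_sum s (f : dual (prebar P s d)) (rs : seq (seq word)) :
  f (vec P s d [seq (ws, [::]) | ws <- rs]) = \sum_(ws <- rs) val_at f ws.
Proof. by rewrite vec_sum linear_sum big_map. Qed.

(** The dictionary between linear forms on the bar construction and functions of words. *)
Lemma relations_ker s (f : dual (prebar P s d)) :
  (bar_relations P s d <= lker f)%VS <-> bar_cochain d s (val_at f).
Proof.
have relE l1 l2 u a b w : f (vec P s d [seq (l1 ++ (u ++ x ++ w) :: l2, [::]) | x <- [:: a; b] :: adem a b])
    = val_at f (l1 ++ (u ++ [:: a, b & w]) :: l2) +
      \sum_(x <- adem a b) val_at f (l1 ++ (u ++ x ++ w) :: l2).
  by rewrite vec_sum linear_sum /= big_cons big_map.
split=> [H l1 l2 u a b w bw ab | If].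
  have [x Ex] := bar_word_label bw.
  suff : vec P s d [seq (l1 ++ (u ++ x ++ w) :: l2, [::]) | x <- [:: a; b] :: adem a b] \in lker f.
    by rewrite memv_ker relE => /eqP/F2_add0.
  apply: (subvP H); apply: (subvP (sumv_sup x _ (subvv _))) => //; apply: memv_span.
  by apply: map_f; rewrite Ex; apply/bar_relatorsP; exists l1, l2, u, a, b, w.
apply/subv_sumP => x _; apply/span_subvP => _ /mapP[r rx ->]; rewrite memv_ker.
have [Ex bw] := label_unit x; rewrite Ex in rx.
have [l1 [l2 [u [a [b [w [Ews ab ->]]]]]]] := bar_relatorsP _ _ _ rx.
rewrite Ews in bw; rewrite relE (If _ _ _ _ _ _ bw ab); apply/eqP; exact: F2D.
Qed.

(** Squares of positive degree kill the unit of Z/2, so the face acting on the coefficient drops out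
    of [bardiff]. *)
Lemma act_unit w : positive w -> w != [::] -> act w [::] = [::].
Proof.
case: w => // k w; rewrite positive_cons => /andP[k0 pw] _.
have sq0 l : (0 < l)%N -> flatten (map (sq l) [:: [::]]) = [::] by case: l.
have : act w [::] = [::] \/ act w [::] = [:: [::]].
  elim: w pw => [|l w IH]; first by right.
  rewrite positive_cons => /andP[l0 /IH[]] E; left; rewrite /act /= -/(act w [::]) E //.
  exact: sq0.
by rewrite /act /= -/(act w [::]); case=> -> //; apply: sq0.
Qed.

Lemma bardiff_unit s ws : bar_word d s ws ->
  bardiff (ws, [::]) = [seq (b, [::]) | b <- merges ws].
Proof.
case/and4P=> _ pw nw _; rewrite /bardiff /=.
case: ws pw nw => [|w b] pw nw; rewrite ?cats0 //.
rewrite act_unit ?cats0 //; first by apply: (allP pw); apply: mem_last.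
by apply: contraNneq nw => <-; apply: mem_last.
Qed.

Lemma val_at_bardiff s (f : dual (prebar P s d)) ws : bar_word d s.+1 ws ->
  val_at (f \o extend P P s.+1 d s d bardiff)%VF ws = \sum_(ws' <- merges ws) val_at f ws'.
Proof.
move=> bw; have [x Ex] := bar_word_label bw.
rewrite /val_at -Ex comp_lfunE extend_label Ex (bardiff_unit bw).
exact: val_at_sum.
Qed.

(** Reduced to [coch_cobd] by appending an empty coefficient: [coaug] vanishes on the one extra
    merge, as it makes the coefficient nonempty. *)
Lemma bar_cochain_cobd s c : bar_cochain d s.+1 c ->
  bar_cochain d s.+2 (fun ws => \sum_(ws' <- merges ws) c ws').
Proof.
move=> /coch_coaug/coch_cobd Ic.
have E ws w : w != [::] -> cobd (coaug c) (rcons (rcons ws w) [::]) 0%N =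
    \sum_(ws' <- merges (rcons ws w)) c ws'.
  move=> w0; rewrite /cobd merges_rcons2 big_rcons /= coaug_rcons cats0 big_map.
  rewrite [X in _ + X](_ : _ = 0); last by case: (w) w0.
  by rewrite addr0; apply: eq_bigr => M _; rewrite coaug_rcons.
have E' l1 l2 x : [::] \notin x :: l2 -> \sum_(ws' <- merges (l1 ++ x :: l2)) c ws' =
    cobd (coaug c) (l1 ++ x :: rcons l2 [::]) 0%N.
  rewrite -rcons_cons -rcons_cat; case/lastP: l2 => [|l2 z].
    by rewrite cats1 inE eq_sym => /E.
  rewrite -rcons_cons mem_rcons in_cons negb_or eq_sym => /andP[/E z0 _].
  by rewrite -rcons_cat z0.
move=> l1 l2 u a b w bw ab.
have n2 : [::] \notin l2.
  by case/and4P: bw => _ _ + _; rewrite mem_cat in_cons !negb_or => /and3P[].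
rewrite E'; last by rewrite in_cons negb_or n2 andbT; case: (u).
rewrite -(Ic l1 (rcons l2 [::])) //; last first.
  by have := bar_word_wf_args bw; rewrite rcons_cat rcons_cons.
apply: eq_big_seq => x xP; rewrite E' // in_cons negb_or n2 andbT.
have : positive (u ++ [:: a, b & w]).
  by case/and4P: bw => _ + _ _; rewrite all_cat /= => /and3P[].
rewrite positive_cat !positive_cons => /and4P[_ a0 b0 _].
have [_] := adem_good a0 b0 ab xP; case: x {xP} => [|k x _]; last by case: (u).
by move: a0; clear; rewrite /=; lia.
Qed.

Lemma bar_word_adem s l1 l2 u a b w x : bar_word d s (l1 ++ (u ++ [:: a, b & w]) :: l2) ->
  (a < b.*2)%N -> x \in adem a b -> bar_word d s (l1 ++ (u ++ x ++ w) :: l2).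
Proof.
move=> /and4P[sz + + +] ab xP; rewrite /bar_word.
rewrite !size_cat /= in sz *; rewrite sz !all_cat !mem_cat !in_cons !map_cat !sumn_cat /=.
rewrite !positive_cat !positive_cons => /and3P[-> /and4P[-> a0 b0 ->] ->].
have [px sx] := adem_good a0 b0 ab xP.
rewrite !sumn_cat /= sx /positive px !negb_or -!addnA => /and3P[-> _ ->] -> /=.
rewrite !andbT; case: x {xP px} sx => [|k x _]; last by case: (u).
by move: a0; clear; rewrite /=; lia.
Qed.

Lemma eq_bar_cochain s c c' : (forall ws, bar_word d s ws -> c ws = c' ws) ->
  bar_cochain d s c -> bar_cochain d s c'.
Proof.
move=> E Ic l1 l2 u a b w bw ab; rewrite -E // -(Ic _ _ _ _ _ _ bw ab).
by apply: eq_big_seq => x xP; rewrite E //; apply: bar_word_adem bw ab xP.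
Qed.

Lemma Ext_eq0 s :
  (forall c, bar_cochain d s.+2 c ->
    (forall ws, bar_word d s.+3 ws -> \sum_(ws' <- merges ws) c ws' = 0) ->
    exists2 b, bar_cochain d s.+1 b &
      forall ws, bar_word d s.+2 ws -> \sum_(ws' <- merges ws) b ws' = c ws) ->
  \dim {: Ext s.+2 d} = 0%N.
Proof.
move=> exact_d; apply: (dual_exact (@piqK _ _ _) (@piqK _ _ _) (@piqK _ _ _)) => f;
  rewrite !lker_piq => /relations_ker If.
  apply/relations_ker; apply: eq_bar_cochain (bar_cochain_cobd If) => ws bw.
  by rewrite (val_at_bardiff f bw).
move=> f0; have [ws bw|b Ib bf] := exact_d _ If.
  by rewrite -(val_at_bardiff f bw) f0 /val_at lfunE.
pose h : dual (prebar P s.+1 d) := functional P s.+1 d (fun l => b l.1).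
have hb ws : bar_word d s.+1 ws -> val_at h ws = b ws.
  by case/bar_word_label => x Ex; rewrite /val_at -Ex functional_label Ex.
exists h; first by apply/relations_ker; apply: eq_bar_cochain Ib => ws /hb.
apply: prebar_ext => x; have [-> bw] := label_unit x.
rewrite -[LHS]/(val_at (h \o _)%VF _) -[RHS]/(val_at f _) (val_at_bardiff h bw) -bf //.
apply: eq_big_seq => ws' wm; apply/hb; move: bw wm => /and4P[/eqP sz pw nw /eqP dw] wm.
have := size_merges wm; rewrite sz /bar_word => -[<-].
by rewrite eqxx (positive_merges wm) // (nonempty_merges wm) // (sumn_merges wm) dw eqxx.
Qed.
End Functional.

Lemma dim0_eq (F : fieldType) (V : vectType F) : \dim {: V} = 0%N -> forall x y : V, x = y.
Proof.
move=> /eqP; rewrite dimv_eq0 => /eqP V0 x y.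
by apply/eqP; rewrite -subr_eq0 -memv0 -V0 memvf.
Qed.

Lemma dim_dual_subvs0 (F : fieldType) (V : vectType F) (S : {vspace V}) : S = 0%VS ->
  \dim {: dual (subvs_of S)} = 0%N.
Proof.
move=> ->; apply/eqP; rewrite dimv_eq0 -subv0; apply/subvP => f _; rewrite memv0.
apply/eqP/lfunP => u; rewrite lfunE /=.
suff -> : u = 0 by rewrite linear0.
by apply: val_inj; apply/eqP; rewrite -memv0; apply: subvsP.
Qed.

Local Close Scope ring_scope.

(** * Certificates *)

Definition steps6 : seq (seq nat * seq (nat * seq nat)) := [:: ].
(** The tested monomial has weight 66, not divisible by 63: the functional sees only the part of the
    image under 1 + s + s^3 that leaves the invariant weights. *)
Definition rows6 : seq (seq nat * seq (seq nat)) := [:: ([::1;1;1;1;1;1],[::[::0;1;2;1;1;1]])].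
Definition steps7 : seq (seq nat * seq (nat * seq nat)) := [:: ([::3;0;1;1;1;1],[::(1,[::1;1;1;1;1;1])])].
Definition rows7 : seq (seq nat * seq (seq nat)) := [:: ([::1;1;1;3;0;1],[::[::2;1;1;1;1;1]]);
 ([::1;1;1;1;3;0],[::[::0;3;1;1;1;1]]);
 ([::1;3;0;1;1;1],[::[::1;2;1;1;1;1]]);
 ([::0;1;1;1;1;3],[::[::1;0;0;2;1;3]]);
 ([::1;1;3;0;1;1],[::[::1;1;2;1;1;1]])].
Definition steps8 : seq (seq nat * seq (nat * seq nat)) := [:: ([::3;0;1;1;3;0],[::(1,[::3;0;1;1;1;1])]);
 ([::1;1;3;2;0;1],[::(1,[::1;1;3;0;1;1])]);
 ([::0;1;1;1;3;2],[::(1,[::1;1;1;1;3;0])]);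
 ([::0;1;1;3;0;3],[::(1,[::1;3;0;1;1;1]);(2,[::1;1;1;1;1;1])]);
 ([::0;3;0;1;1;3],[::(1,[::0;1;1;1;1;3])]);
 ([::1;3;0;3;0;1],[::(1,[::1;3;0;1;1;1])])].
Definition rows8 : seq (seq nat * seq (seq nat)) := [:: ([::3;2;0;1;1;1],[::[::3;1;0;1;2;1]]);
 ([::1;1;1;3;2;0],[::[::1;2;1;2;1;1]]);
 ([::2;0;1;1;1;3],[::[::1;0;1;2;1;3]]);
 ([::3;0;3;0;1;1],[::[::1;1;0;2;1;3]]);
 ([::0;1;3;0;1;3],[::[::3;1;0;0;0;4]]);
 ([::1;3;0;1;3;0],[::[::0;2;3;1;1;1]]);
 ([::1;3;2;0;1;1],[::[::1;1;1;0;2;3]]);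
 ([::1;1;3;0;3;0],[::[::1;0;2;1;1;3]]);
 ([::3;0;1;3;0;1],[::[::4;3;1;0;0;0]])].
Definition steps9 : seq (seq nat * seq (nat * seq nat)) := [:: ([::2;0;1;1;3;2],[::(1,[::0;1;1;1;3;2])]);
 ([::2;0;1;3;0;3],[::(1,[::0;1;1;3;0;3])]);
 ([::2;0;3;0;1;3],[::(1,[::0;1;3;0;1;3])]);
 ([::2;2;0;1;1;3],[::(1,[::0;3;0;1;1;3])]);
 ([::3;0;1;3;2;0],[::(1,[::1;1;1;3;2;0])]);
 ([::3;0;3;0;3;0],[::(1,[::1;1;3;0;3;0])]);
 ([::3;0;3;2;0;1],[::(1,[::1;1;3;2;0;1])]);
 ([::3;2;0;1;3;0],[::(1,[::1;3;0;1;3;0])]);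
 ([::3;2;0;3;0;1],[::(1,[::1;3;0;3;0;1])]);
 ([::3;2;2;0;1;1],[::(1,[::1;3;2;0;1;1])]);
 ([::0;1;1;1;5;1],[::(2,[::0;1;1;1;1;3])]);
 ([::1;0;1;1;1;5],[::(2,[::3;0;1;1;1;1])]);
 ([::1;1;1;5;1;0],[::(2,[::1;1;1;1;3;0])]);
 ([::1;1;5;1;0;1],[::(2,[::1;1;1;3;0;1])]);
 ([::1;5;1;0;1;1],[::(2,[::1;1;3;0;1;1])]);
 ([::5;1;0;1;1;1],[::(2,[::1;3;0;1;1;1])])].
Definition rows9 : seq (seq nat * seq (seq nat)) := [:: ([::1;3;0;3;2;0],[::[::0;0;3;5;1;0];[::0;4;1;1;3;0];[::0;6;0;1;1;1];[::2;1;2;3;0;1];[::4;0;2;1;1;1]]);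
 ([::1;3;2;0;3;0],[::[::0;0;7;1;1;0];[::0;4;1;3;1;0]]);
 ([::0;3;0;1;3;2],[::[::0;5;3;1;0;0]]);
 ([::0;3;2;0;1;3],[::[::1;3;1;0;0;4];[::7;1;1;0;0;0]]);
 ([::1;3;2;2;0;1],[::[::3;1;3;0;0;2];[::3;3;0;1;0;2]]);
 ([::1;1;3;2;2;0],[::[::1;0;0;4;3;1]]);
 ([::0;1;1;3;2;2],[::[::1;2;1;2;1;2]]);
 ([::0;3;0;3;0;3],[::[::1;2;1;0;2;3]]);
 ([::0;1;3;2;0;3],[::[::3;1;0;0;2;3]]);
 ([::0;1;3;0;3;2],[::[::2;1;2;1;2;1]])].
Definition steps10 : seq (seq nat * seq (nat * seq nat)) := [:: ([::1;3;2;2;2;0],[::(1,[::0;1;1;3;2;2]);(1,[::0;1;3;0;3;2]);(1,[::0;1;3;2;0;3]);(1,[::0;3;0;1;3;2]);(1,[::0;3;0;3;0;3]);(1,[::0;3;2;0;1;3]);(1,[::1;1;3;2;2;0]);(1,[::1;3;0;3;2;0]);(1,[::1;3;2;0;3;0]);(1,[::1;3;2;2;0;1]);(4,[::1;1;1;1;1;1])]);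
 ([::2;0;1;3;2;2],[::(1,[::0;1;1;3;2;2])]);
 ([::2;0;3;0;3;2],[::(1,[::0;1;3;0;3;2])]);
 ([::2;0;3;2;0;3],[::(1,[::0;1;3;2;0;3])]);
 ([::2;2;0;1;3;2],[::(1,[::0;3;0;1;3;2])]);
 ([::2;2;0;3;0;3],[::(1,[::0;3;0;3;0;3])]);
 ([::2;2;2;0;1;3],[::(1,[::0;3;2;0;1;3])]);
 ([::3;0;3;2;2;0],[::(1,[::1;1;3;2;2;0])]);
 ([::3;2;0;3;2;0],[::(1,[::1;3;0;3;2;0])]);
 ([::3;2;2;0;3;0],[::(1,[::1;3;2;0;3;0])]);
 ([::3;2;2;2;0;1],[::(1,[::1;3;2;2;0;1])]);
 ([::0;1;5;1;0;3],[::(2,[::0;1;1;3;0;3])]);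
 ([::0;3;0;1;5;1],[::(2,[::0;3;0;1;1;3])]);
 ([::0;5;1;0;1;3],[::(2,[::0;1;3;0;1;3])]);
 ([::1;0;3;0;1;5],[::(2,[::3;0;3;0;1;1])]);
 ([::1;2;0;1;1;5],[::(1,[::0;1;1;1;5;1]);(1,[::1;0;1;1;1;5]);(2,[::0;1;1;1;3;2]);(2,[::2;0;1;1;1;3])]);
 ([::1;3;0;5;1;0],[::(1,[::1;1;1;5;1;0]);(2,[::1;1;1;3;2;0]);(2,[::3;0;1;1;3;0])]);
 ([::1;5;1;0;3;0],[::(2,[::1;1;3;0;3;0])]);
 ([::1;5;1;2;0;1],[::(1,[::1;1;5;1;0;1]);(2,[::1;1;3;2;0;1]);(2,[::3;0;1;3;0;1])]);
 ([::2;0;1;1;5;1],[::(1,[::0;1;1;1;5;1]);(2,[::0;1;1;1;3;2])]);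
 ([::3;0;1;5;1;0],[::(1,[::1;1;1;5;1;0]);(2,[::1;1;1;3;2;0])]);
 ([::3;0;5;1;0;1],[::(1,[::1;1;5;1;0;1]);(2,[::1;1;3;2;0;1])]);
 ([::5;1;0;1;3;0],[::(2,[::1;3;0;1;3;0])]);
 ([::5;1;0;3;0;1],[::(2,[::1;3;0;3;0;1])]);
 ([::5;1;2;0;1;1],[::(1,[::1;5;1;0;1;1]);(2,[::1;3;2;0;1;1])]);
 ([::0;0;1;1;1;7],[::(1,[::1;0;1;1;1;5])]);
 ([::0;1;1;1;7;0],[::(1,[::0;1;1;1;5;1])]);
 ([::1;1;1;7;0;0],[::(1,[::1;1;1;5;1;0])]);
 ([::1;1;7;0;0;1],[::(1,[::1;1;5;1;0;1])]);
 ([::1;7;0;0;1;1],[::(1,[::1;5;1;0;1;1])]);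
 ([::7;0;0;1;1;1],[::(1,[::5;1;0;1;1;1])])].
Definition rows10 : seq (seq nat * seq (seq nat)) := [:: ([::1;0;1;1;3;4],[::[::6;3;1;0;0;0]]);
 ([::1;1;3;4;1;0],[::[::1;0;0;7;1;1];[::1;0;4;1;3;1]]);
 ([::0;1;3;0;5;1],[::[::1;0;0;3;5;1];[::1;0;4;1;1;3]]);
 ([::0;1;1;5;1;2],[::[::1;0;0;0;6;3]]);
 ([::4;1;0;1;1;3],[::[::1;5;3;1;0;0]]);
 ([::0;1;1;3;4;1],[::[::1;1;0;0;7;1];[::1;1;0;4;1;3]]);
 ([::1;0;1;3;0;5],[::[::3;1;0;0;0;6]]);
 ([::3;4;1;0;1;1],[::[::0;0;6;3;1;0]]);
 ([::1;3;4;1;0;1],[::[::0;0;7;1;1;1];[::0;4;1;3;1;1]]);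
 ([::1;1;5;1;2;0],[::[::0;0;0;6;3;1]]);
 ([::0;3;2;0;3;2],[::[::2;1;0;0;2;5];[::3;1;0;0;4;2]]);
 ([::0;1;3;2;2;2],[::[::2;5;2;1;0;0];[::4;2;3;1;0;0]]);
 ([::0;3;0;3;2;2],[::[::2;3;1;0;0;4];[::5;2;1;0;0;2]]);
 ([::0;3;2;2;0;3],[::[::2;1;1;0;0;6];[::3;3;0;0;0;4]])].
Definition steps11 : seq (seq nat * seq (nat * seq nat)) := [:: ([::0;1;5;1;2;2],[::(1,[::0;0;1;1;1;7]);(1,[::0;1;1;5;1;2]);(1,[::0;1;5;1;0;3]);(1,[::0;3;2;0;3;2]);(1,[::0;3;2;2;0;3]);(1,[::0;5;1;0;1;3]);(1,[::4;1;0;1;1;3]);(2,[::0;1;3;0;3;2]);(2,[::0;1;3;2;0;3]);(2,[::0;3;0;1;3;2]);(2,[::0;3;0;3;0;3]);(2,[::0;3;2;0;1;3]);(2,[::2;0;1;1;3;2]);(2,[::2;0;1;3;0;3]);(2,[::2;0;3;0;1;3]);(2,[::2;2;0;1;1;3]);(4,[::0;1;1;1;1;3])]);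
 ([::0;2;0;1;1;7],[::(1,[::0;0;1;1;1;7])]);
 ([::0;3;0;5;1;2],[::(1,[::0;1;1;1;7;0]);(1,[::0;1;1;5;1;2]);(1,[::0;3;2;0;3;2]);(2,[::0;1;1;3;2;2]);(2,[::2;0;1;1;3;2])]);
 ([::0;3;2;0;5;1],[::(1,[::0;1;1;3;4;1]);(1,[::0;1;3;0;5;1]);(1,[::0;1;5;1;0;3]);(1,[::0;3;0;1;5;1]);(1,[::0;3;2;0;3;2]);(1,[::0;5;1;0;1;3]);(1,[::4;1;0;1;1;3]);(2,[::0;1;3;0;3;2]);(2,[::0;1;3;2;0;3]);(2,[::0;3;0;1;3;2]);(2,[::0;3;0;3;0;3]);(2,[::0;3;2;0;1;3]);(2,[::2;0;1;3;0;3]);(2,[::2;0;3;0;1;3]);(2,[::2;2;0;1;1;3])]);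
 ([::0;3;2;2;2;2],[::(1,[::0;1;3;2;2;2]);(1,[::0;3;0;3;2;2]);(2,[::0;1;1;3;2;2])]);
 ([::0;3;4;1;0;3],[::(1,[::0;1;1;3;4;1]);(1,[::0;1;3;2;2;2]);(1,[::0;1;5;1;0;3]);(1,[::0;3;0;3;2;2]);(1,[::0;3;2;2;0;3]);(2,[::2;0;1;3;0;3])]);
 ([::0;5;1;0;3;2],[::(1,[::0;1;3;2;2;2]);(1,[::0;3;2;0;3;2]);(2,[::0;1;3;0;3;2])]);
 ([::0;5;1;2;0;3],[::(1,[::0;1;3;2;2;2]);(1,[::0;3;2;2;0;3]);(2,[::0;1;3;2;0;3])]);
 ([::0;7;0;0;1;3],[::(1,[::0;1;3;0;5;1]);(1,[::0;1;3;2;2;2]);(1,[::0;3;2;0;3;2]);(1,[::0;3;2;2;0;3]);(1,[::0;5;1;0;1;3]);(2,[::2;0;3;0;1;3])]);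
 ([::1;0;3;2;0;5],[::(1,[::0;1;3;2;2;2]);(1,[::0;3;0;3;2;2]);(1,[::0;3;2;0;3;2]);(1,[::0;3;2;2;0;3]);(1,[::1;0;1;1;3;4]);(1,[::1;0;1;3;0;5]);(1,[::1;0;3;0;1;5]);(1,[::1;1;1;7;0;0]);(1,[::1;1;3;4;1;0]);(1,[::1;1;5;1;2;0]);(1,[::1;1;7;0;0;1]);(1,[::1;3;0;5;1;0]);(1,[::1;3;4;1;0;1]);(1,[::1;5;1;0;3;0]);(1,[::1;5;1;2;0;1]);(1,[::1;7;0;0;1;1]);(1,[::5;1;0;1;3;0]);(1,[::5;1;0;3;0;1]);(1,[::5;1;2;0;1;1]);(2,[::0;3;0;1;3;2]);(2,[::0;3;0;3;0;3]);(2,[::0;3;2;0;1;3]);(2,[::3;0;1;3;2;0]);(2,[::3;0;3;0;3;0]);(2,[::3;0;3;2;0;1]);(2,[::3;2;0;1;3;0]);(2,[::3;2;0;3;0;1]);(2,[::3;2;2;0;1;1])]);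
 ([::1;2;0;1;3;4],[::(1,[::1;0;1;1;3;4])]);
 ([::1;2;0;3;0;5],[::(1,[::1;0;1;3;0;5])]);
 ([::1;2;2;0;1;5],[::(1,[::1;0;3;0;1;5])]);
 ([::1;3;2;4;1;0],[::(1,[::0;1;3;2;2;2]);(1,[::1;1;1;7;0;0]);(1,[::1;1;3;4;1;0]);(1,[::1;1;5;1;2;0]);(1,[::1;3;0;5;1;0]);(1,[::1;5;1;0;3;0]);(1,[::5;1;0;1;3;0]);(2,[::0;3;0;1;3;2]);(2,[::1;1;3;2;2;0]);(2,[::1;3;0;3;2;0]);(2,[::1;3;2;0;3;0]);(2,[::3;0;1;3;2;0]);(2,[::3;0;3;0;3;0]);(2,[::3;2;0;1;3;0])]);
 ([::1;3;4;1;2;0],[::(1,[::0;1;3;2;2;2]);(1,[::0;3;0;3;2;2]);(1,[::1;1;1;7;0;0]);(1,[::1;1;5;1;2;0]);(1,[::1;3;2;2;2;0]);(2,[::3;0;1;3;2;0])]);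
 ([::1;3;6;0;0;1],[::(1,[::0;3;0;3;2;2]);(1,[::1;1;7;0;0;1]);(1,[::1;3;2;2;2;0]);(1,[::1;3;4;1;0;1]);(1,[::1;5;1;2;0;1]);(1,[::5;1;0;3;0;1]);(2,[::0;3;0;3;0;3]);(2,[::1;1;3;2;2;0]);(2,[::1;3;0;3;2;0]);(2,[::1;3;2;2;0;1]);(2,[::3;0;3;2;0;1]);(2,[::3;2;0;3;0;1])]);
 ([::1;5;1;2;2;0],[::(1,[::0;1;3;2;2;2]);(1,[::1;3;2;2;2;0]);(2,[::1;1;3;2;2;0])]);
 ([::1;7;0;0;3;0],[::(1,[::0;1;3;2;2;2]);(1,[::0;3;2;0;3;2]);(1,[::1;1;3;4;1;0]);(1,[::1;3;2;2;2;0]);(1,[::1;5;1;0;3;0]);(2,[::3;0;3;0;3;0])]);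
 ([::1;7;0;2;0;1],[::(1,[::0;1;3;2;2;2]);(1,[::0;3;2;2;0;3]);(1,[::1;1;7;0;0;1]);(1,[::1;3;2;2;2;0]);(1,[::1;5;1;2;0;1]);(2,[::3;0;3;2;0;1])]);
 ([::2;0;1;1;7;0],[::(1,[::0;1;1;1;7;0])]);
 ([::2;0;1;3;4;1],[::(1,[::0;1;1;3;4;1])]);
 ([::2;0;1;5;1;2],[::(1,[::0;1;1;5;1;2])]);
 ([::2;0;3;0;5;1],[::(1,[::0;1;3;0;5;1])]);
 ([::2;0;3;2;2;2],[::(1,[::0;1;3;2;2;2])]);
 ([::2;0;5;1;0;3],[::(1,[::0;1;5;1;0;3])]);
 ([::2;2;0;1;5;1],[::(1,[::0;3;0;1;5;1])]);
 ([::2;2;0;3;2;2],[::(1,[::0;3;0;3;2;2])]);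
 ([::2;2;2;0;3;2],[::(1,[::0;3;2;0;3;2])]);
 ([::2;2;2;2;0;3],[::(1,[::0;3;2;2;0;3])]);
 ([::2;4;1;0;1;3],[::(1,[::0;5;1;0;1;3])]);
 ([::3;0;1;7;0;0],[::(1,[::1;1;1;7;0;0])]);
 ([::3;0;3;4;1;0],[::(1,[::1;1;3;4;1;0])]);
 ([::3;0;5;1;2;0],[::(1,[::1;1;5;1;2;0])]);
 ([::3;0;7;0;0;1],[::(1,[::1;1;7;0;0;1])]);
 ([::3;2;0;5;1;0],[::(1,[::1;3;0;5;1;0])]);
 ([::3;2;2;2;2;0],[::(1,[::1;3;2;2;2;0])]);
 ([::3;2;4;1;0;1],[::(1,[::1;3;4;1;0;1])]);
 ([::3;4;1;0;3;0],[::(1,[::1;5;1;0;3;0])]);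
 ([::3;4;1;2;0;1],[::(1,[::1;5;1;2;0;1])]);
 ([::3;6;0;0;1;1],[::(1,[::1;7;0;0;1;1])]);
 ([::4;1;0;1;3;2],[::(2,[::0;3;0;1;3;2])]);
 ([::4;1;0;3;0;3],[::(2,[::0;3;0;3;0;3])]);
 ([::4;1;2;0;1;3],[::(2,[::0;3;2;0;1;3])]);
 ([::5;1;0;3;2;0],[::(2,[::1;3;0;3;2;0])]);
 ([::5;1;2;0;3;0],[::(2,[::1;3;2;0;3;0])]);
 ([::5;1;2;2;0;1],[::(2,[::1;3;2;2;0;1])]);
 ([::6;0;0;1;1;3],[::(1,[::4;1;0;1;1;3])]);
 ([::7;0;0;1;3;0],[::(1,[::5;1;0;1;3;0])]);
 ([::7;0;0;3;0;1],[::(1,[::5;1;0;3;0;1])]);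
 ([::7;0;2;0;1;1],[::(1,[::5;1;2;0;1;1])])].
Definition rows11 : seq (seq nat * seq (seq nat)) := [:: ([::1;5;3;1;0;1],[::[::0;1;6;3;1;0]]);
 ([::1;1;5;3;1;0],[::[::0;0;1;6;3;1]]);
 ([::0;1;1;5;3;1],[::[::1;0;0;1;6;3]]);
 ([::1;0;1;1;5;3],[::[::0;5;3;1;1;1]]);
 ([::3;1;0;1;1;5],[::[::1;0;5;3;1;1]]);
 ([::5;3;1;0;1;1],[::[::1;6;3;1;0;0]]);
 ([::0;3;0;1;7;0],[::[::1;2;1;0;4;3]]);
 ([::0;1;3;0;7;0],[::[::0;6;3;1;0;1]]);
 ([::0;1;1;7;0;2],[::[::2;1;0;4;3;1]]);
 ([::0;1;3;2;4;1],[::[::0;1;2;7;0;1];[::0;5;0;3;2;1];[::2;0;2;5;1;1];[::2;2;1;3;2;1];[::2;4;0;1;3;1];[::4;1;1;1;3;1]]);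
 ([::0;3;0;3;4;1],[::[::0;4;3;1;2;1]]);
 ([::0;1;1;3;6;0],[::[::0;0;7;1;1;2];[::0;4;1;3;1;2];[::1;2;6;1;1;0];[::1;6;0;3;1;0]]);
 ([::1;1;3;6;0;0],[::[::1;0;0;2;5;3]]);
 ([::1;1;7;0;2;0],[::[::0;0;2;5;3;1]]);
 ([::0;1;7;0;0;3],[::[::3;1;0;0;6;1];[::3;1;0;2;3;2];[::3;1;0;4;0;3]]);
 ([::0;0;3;0;1;7],[::[::3;1;2;1;0;4]]);
 ([::0;0;1;3;0;7],[::[::1;0;6;3;1;0]]);
 ([::0;0;1;1;3;6],[::[::0;5;3;0;2;1];[::0;7;0;1;2;1];[::4;1;2;1;2;1]]);
 ([::1;0;1;3;2;4],[::[::3;1;0;0;2;5]]);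
 ([::1;0;3;0;3;4],[::[::0;2;5;3;1;0]]);
 ([::1;3;0;7;0;0],[::[::7;3;1;0;0;0]]);
 ([::0;1;3;4;1;2],[::[::2;7;1;1;0;0];[::6;1;3;1;0;0]])].
Definition steps12 : seq (seq nat * seq (nat * seq nat)) := [:: ([::0;0;1;1;5;5],[::(1,[::0;1;1;3;6;0]);(1,[::0;1;3;0;7;0]);(1,[::0;1;3;2;4;1]);(1,[::0;3;0;1;7;0]);(1,[::0;3;0;3;4;1]);(1,[::0;3;2;0;5;1]);(2,[::0;0;1;1;1;7]);(2,[::0;1;1;1;7;0]);(2,[::0;1;1;3;4;1]);(2,[::0;1;3;0;5;1]);(2,[::0;1;3;2;2;2]);(2,[::0;3;0;1;5;1]);(2,[::0;3;0;3;2;2]);(2,[::0;3;2;0;3;2]);(2,[::0;3;2;2;0;3]);(2,[::2;0;1;3;2;2]);(2,[::2;0;3;0;3;2]);(2,[::2;0;3;2;0;3]);(2,[::2;2;0;1;3;2]);(2,[::2;2;0;3;0;3]);(2,[::2;2;2;0;1;3]);(4,[::0;1;1;1;3;2]);(4,[::0;1;1;3;0;3]);(4,[::0;1;3;0;1;3]);(4,[::0;3;0;1;1;3])]);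
 ([::0;0;1;3;2;6],[::(1,[::0;1;1;7;0;2]);(1,[::0;1;3;0;7;0]);(1,[::0;1;3;2;4;1]);(1,[::0;1;5;1;2;2]);(1,[::0;3;0;1;7;0]);(1,[::0;3;0;3;4;1]);(1,[::0;3;2;0;5;1]);(1,[::0;3;2;2;2;2]);(1,[::0;7;0;0;1;3]);(1,[::1;7;0;0;3;0]);(1,[::1;7;0;2;0;1]);(1,[::4;1;2;0;1;3]);(1,[::5;1;2;0;3;0]);(1,[::5;1;2;2;0;1]);(2,[::0;0;1;1;1;7]);(2,[::0;1;1;1;7;0]);(2,[::0;1;1;3;4;1]);(2,[::0;3;2;0;3;2]);(2,[::0;3;2;2;0;3]);(2,[::1;1;3;4;1;0]);(2,[::1;1;7;0;0;1]);(2,[::1;3;0;5;1;0]);(2,[::1;3;4;1;0;1]);(2,[::2;0;3;0;3;2]);(2,[::2;0;3;2;0;3]);(2,[::2;2;0;1;3;2]);(2,[::2;2;0;3;0;3]);(2,[::2;2;2;0;1;3]);(4,[::0;1;1;1;3;2]);(4,[::0;1;1;3;0;3]);(4,[::1;1;3;0;3;0]);(4,[::1;1;3;2;0;1]);(4,[::1;3;0;1;3;0]);(4,[::1;3;0;3;0;1])]);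
 ([::0;0;3;0;3;6],[::(1,[::0;0;1;1;3;6]);(1,[::0;0;1;3;0;7]);(1,[::0;0;3;0;1;7]);(1,[::0;1;1;7;0;2]);(1,[::0;1;3;0;7;0]);(1,[::0;1;3;2;4;1]);(1,[::0;1;5;1;2;2]);(1,[::0;1;7;0;0;3]);(1,[::0;3;0;5;1;2]);(1,[::0;5;1;2;0;3]);(1,[::0;7;0;0;1;3]);(1,[::1;0;1;3;2;4]);(1,[::1;0;3;0;3;4]);(1,[::1;1;7;0;2;0]);(1,[::1;3;0;7;0;0]);(1,[::1;3;2;4;1;0]);(1,[::1;5;1;2;2;0]);(1,[::1;7;0;0;3;0]);(1,[::1;7;0;2;0;1]);(1,[::4;1;0;1;3;2]);(1,[::4;1;2;0;1;3]);(1,[::5;1;2;0;3;0]);(1,[::5;1;2;2;0;1]);(2,[::0;0;1;1;1;7]);(2,[::0;1;1;1;7;0]);(2,[::0;1;3;0;5;1]);(2,[::0;3;2;0;3;2]);(2,[::0;3;2;2;0;3]);(2,[::1;1;1;7;0;0]);(2,[::1;1;7;0;0;1]);(2,[::1;3;0;5;1;0]);(2,[::1;7;0;0;1;1]);(2,[::2;0;3;0;3;2]);(2,[::2;0;3;2;0;3]);(2,[::3;2;0;3;2;0]);(2,[::3;2;2;0;3;0]);(4,[::0;1;1;1;3;2]);(4,[::0;1;3;0;1;3]);(4,[::1;1;1;3;2;0]);(4,[::1;1;3;2;0;1]);(4,[::1;3;0;1;3;0]);(4,[::1;3;2;0;1;1])]);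
 ([::0;0;3;2;0;7],[::(1,[::0;0;1;1;3;6]);(1,[::0;0;1;3;0;7]);(1,[::0;0;3;0;1;7]);(2,[::0;0;1;1;1;7])]);
 ([::0;1;1;5;5;0],[::(1,[::0;0;1;1;3;6]);(1,[::0;1;5;1;2;2]);(1,[::0;3;2;2;2;2]);(1,[::0;5;1;0;3;2]);(1,[::4;1;0;1;3;2]);(2,[::0;1;3;2;2;2]);(2,[::0;3;0;3;2;2]);(2,[::0;3;2;0;3;2]);(2,[::2;0;1;3;2;2]);(2,[::2;0;3;0;3;2]);(2,[::2;2;0;1;3;2]);(4,[::0;1;1;1;3;2])]);
 ([::0;1;3;2;6;0],[::(1,[::0;0;1;3;0;7]);(1,[::0;0;3;0;1;7]);(1,[::0;1;1;7;0;2]);(1,[::0;1;3;4;1;2]);(1,[::0;1;7;0;0;3]);(1,[::0;3;0;1;7;0]);(1,[::0;3;0;3;4;1]);(1,[::0;3;2;0;5;1]);(1,[::0;5;1;2;0;3]);(1,[::4;1;0;3;0;3]);(1,[::4;1;2;0;1;3]);(2,[::0;1;1;1;7;0]);(2,[::0;1;1;3;4;1]);(2,[::0;1;3;0;5;1]);(2,[::0;3;0;3;2;2]);(2,[::0;3;2;0;3;2]);(2,[::2;0;1;3;2;2]);(2,[::2;0;3;0;3;2]);(2,[::2;2;0;3;0;3]);(2,[::2;2;2;0;1;3]);(4,[::0;1;1;3;0;3]);(4,[::0;1;3;0;1;3])]);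
 ([::0;1;3;6;0;2],[::(1,[::0;0;1;1;3;6]);(1,[::0;1;1;3;6;0]);(1,[::0;1;3;0;7;0]);(1,[::0;1;5;1;2;2]);(1,[::0;3;0;5;1;2]);(1,[::0;5;1;0;3;2]);(1,[::1;0;1;3;2;4]);(1,[::1;0;3;0;3;4]);(1,[::1;1;7;0;2;0]);(1,[::1;3;0;7;0;0]);(1,[::1;3;2;4;1;0]);(1,[::1;5;1;2;2;0]);(1,[::4;1;0;1;3;2]);(1,[::5;1;0;3;2;0]);(1,[::5;1;2;0;3;0]);(2,[::0;1;1;1;7;0]);(2,[::0;1;3;2;2;2]);(2,[::1;1;1;7;0;0]);(2,[::1;1;3;4;1;0]);(2,[::2;2;0;1;3;2]);(2,[::3;2;0;3;2;0]);(2,[::3;2;2;0;3;0]);(4,[::1;1;1;3;2;0]);(4,[::1;1;3;0;3;0])]);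
 ([::0;1;5;1;4;1],[::(1,[::0;0;1;3;0;7]);(1,[::0;1;1;7;0;2]);(1,[::0;3;2;2;2;2]);(1,[::0;5;1;2;0;3]);(1,[::4;1;0;3;0;3]);(2,[::0;1;3;2;2;2]);(2,[::0;3;0;3;2;2]);(2,[::0;3;2;2;0;3]);(2,[::2;0;1;3;2;2]);(2,[::2;0;3;2;0;3]);(2,[::2;2;0;3;0;3]);(4,[::0;1;1;3;0;3])]);
 ([::0;1;7;0;2;2],[::(1,[::0;0;1;1;3;6]);(1,[::0;0;3;0;1;7]);(1,[::0;1;1;3;6;0]);(1,[::0;1;3;0;7;0]);(1,[::0;1;3;4;1;2]);(1,[::0;1;5;1;2;2]);(1,[::0;1;7;0;0;3]);(1,[::0;3;0;1;7;0]);(1,[::0;3;0;3;4;1]);(1,[::0;3;0;5;1;2]);(1,[::0;3;2;0;5;1]);(1,[::0;3;2;2;2;2]);(1,[::0;5;1;0;3;2]);(1,[::0;7;0;0;1;3]);(1,[::1;0;1;3;2;4]);(1,[::1;0;3;0;3;4]);(1,[::1;1;7;0;2;0]);(1,[::1;3;0;7;0;0]);(1,[::1;3;2;4;1;0]);(1,[::1;5;1;2;2;0]);(1,[::1;7;0;0;3;0]);(1,[::1;7;0;2;0;1]);(1,[::4;1;0;1;3;2]);(1,[::4;1;2;0;1;3]);(1,[::5;1;0;3;2;0]);(1,[::5;1;2;0;3;0]);(2,[::0;1;1;3;4;1]);(2,[::0;1;3;2;2;2]);(2,[::0;3;2;0;3;2]);(2,[::0;3;2;2;0;3]);(2,[: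:1;1;1;7;0;0]);(2,[::1;1;7;0;0;1]);(2,[::2;0;3;0;3;2]);(2,[::2;0;3;2;0;3]);(2,[::2;2;0;1;3;2]);(2,[::2;2;2;0;1;3]);(2,[::3;2;0;3;2;0]);(2,[::3;2;2;0;3;0]);(4,[::1;1;1;3;2;0]);(4,[::1;1;3;2;0;1])]);
 ([::0;2;0;1;3;6],[::(1,[::0;0;1;1;3;6])]);
 ([::0;2;0;3;0;7],[::(1,[::0;0;1;3;0;7])]);
 ([::0;2;2;0;1;7],[::(1,[::0;0;3;0;1;7])]);
 ([::0;3;0;3;6;0],[::(1,[::0;1;1;3;6;0]);(1,[::0;1;1;7;0;2]);(1,[::0;1;3;4;1;2]);(1,[::0;1;5;1;2;2]);(1,[::0;1;7;0;0;3]);(1,[::0;3;0;5;1;2]);(1,[::0;3;2;0;5;1]);(1,[::0;3;4;1;0;3]);(1,[::0;5;1;0;3;2]);(1,[::0;5;1;2;0;3]);(1,[::0;7;0;0;1;3]);(1,[::4;1;0;1;3;2]);(1,[::4;1;0;3;0;3]);(1,[::4;1;2;0;1;3]);(2,[::0;1;1;1;7;0]);(2,[::0;1;1;3;4;1]);(2,[::2;0;1;3;2;2]);(2,[::2;0;3;0;3;2]);(2,[::2;0;3;2;0;3]);(2,[::2;2;0;1;3;2]);(2,[::2;2;0;3;0;3]);(2,[::2;2;2;0;1;3])]);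
 ([::0;3;0;7;0;2],[::(1,[::0;1;1;3;6;0]);(1,[::0;1;3;4;1;2]);(1,[::0;1;5;1;2;2]);(1,[::0;3;0;1;7;0]);(1,[::0;5;1;0;3;2]);(1,[::1;0;3;0;3;4]);(1,[::1;1;3;6;0;0]);(1,[::1;3;2;4;1;0]);(1,[::1;3;4;1;2;0]);(1,[::1;5;1;2;2;0]);(1,[::1;7;0;0;3;0]);(1,[::4;1;0;1;3;2]);(1,[::5;1;0;3;2;0]);(2,[::0;1;1;1;7;0]);(2,[::0;3;0;3;2;2]);(2,[::1;1;1;7;0;0]);(2,[::1;3;0;5;1;0]);(2,[::2;0;3;0;3;2]);(2,[::3;0;3;2;2;0]);(2,[::3;2;2;0;3;0]);(4,[::1;1;1;3;2;0]);(4,[::1;3;0;1;3;0])]);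
 ([::0;3;2;0;7;0],[::(1,[::0;1;1;3;6;0]);(1,[::0;1;3;0;7;0]);(1,[::0;3;0;1;7;0]);(2,[::0;1;1;1;7;0])]);
 ([::0;3;2;2;4;1],[::(1,[::0;1;1;3;6;0]);(1,[::0;1;1;7;0;2]);(1,[::0;1;3;0;7;0]);(1,[::0;1;3;2;4;1]);(1,[::0;1;3;4;1;2]);(1,[::0;1;5;1;2;2]);(1,[::0;1;7;0;0;3]);(1,[::0;3;0;1;7;0]);(1,[::0;3;0;3;4;1]);(1,[::0;3;0;5;1;2]);(1,[::0;3;2;0;5;1]);(1,[::0;3;4;1;0;3]);(1,[::0;5;1;0;3;2]);(1,[::0;5;1;2;0;3]);(1,[::0;7;0;0;1;3]);(1,[::4;1;0;1;3;2]);(1,[::4;1;0;3;0;3]);(1,[::4;1;2;0;1;3]);(2,[::2;0;1;3;2;2]);(2,[::2;0;3;0;3;2]);(2,[::2;0;3;2;0;3]);(2,[::2;2;0;1;3;2]);(2,[::2;2;0;3;0;3]);(2,[::2;2;2;0;1;3])]);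
 ([::0;3;2;4;1;2],[::(1,[::0;1;1;3;6;0]);(1,[::0;1;1;7;0;2]);(1,[::0;1;3;0;7;0]);(1,[::0;1;3;4;1;2]);(1,[::0;1;5;1;2;2]);(1,[::0;3;0;1;7;0]);(1,[::0;3;0;5;1;2]);(1,[::0;5;1;0;3;2]);(1,[::4;1;0;1;3;2]);(2,[::0;1;3;2;2;2]);(2,[::0;3;0;3;2;2]);(2,[::0;3;2;0;3;2]);(2,[::2;0;1;3;2;2]);(2,[::2;0;3;0;3;2]);(2,[::2;2;0;1;3;2])]);
 ([::0;3;4;1;2;2],[::(1,[::0;1;1;3;6;0]);(1,[::0;1;1;7;0;2]);(1,[::0;1;5;1;2;2]);(1,[::0;3;2;2;2;2]);(2,[::2;0;1;3;2;2])]);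
 ([::0;3;6;0;0;3],[::(1,[::0;1;3;2;4;1]);(1,[::0;1;7;0;0;3]);(1,[::0;3;0;3;4;1]);(1,[::0;3;2;2;2;2]);(1,[::0;3;4;1;0;3]);(1,[::0;5;1;2;0;3]);(1,[::4;1;0;3;0;3]);(2,[::0;1;3;2;2;2]);(2,[::0;3;0;3;2;2]);(2,[::0;3;2;2;0;3]);(2,[::2;0;3;2;0;3]);(2,[::2;2;0;3;0;3])]);
 ([::0;5;1;0;5;1],[::(1,[::0;1;3;0;7;0]);(1,[::0;1;3;2;4;1]);(1,[::0;3;2;0;5;1]);(2,[::0;1;3;0;5;1])]);
 ([::0;5;1;2;2;2],[::(1,[::0;3;2;2;2;2]);(2,[::0;1;3;2;2;2])]);
 ([::0;7;0;0;3;2],[::(1,[::0;1;3;0;7;0]);(1,[::0;1;3;4;1;2]);(1,[::0;3;2;2;2;2]);(1,[::0;5;1;0;3;2]);(2,[::2;0;3;0;3;2])]);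
 ([::0;7;0;2;0;3],[::(1,[::0;1;3;2;4;1]);(1,[::0;1;7;0;0;3]);(1,[::0;3;2;2;2;2]);(1,[::0;5;1;2;0;3]);(2,[::2;0;3;2;0;3])]);
 ([::1;0;1;5;1;4],[::(1,[::0;1;5;1;2;2]);(1,[::1;0;1;3;2;4]);(1,[::1;1;7;0;2;0]);(1,[::1;3;2;4;1;0]);(1,[::1;3;4;1;2;0]);(1,[::1;7;0;0;3;0]);(1,[::5;1;2;0;3;0]);(2,[::0;3;2;0;3;2]);(2,[::1;0;1;1;3;4]);(2,[::1;1;1;7;0;0]);(2,[::1;3;2;2;2;0]);(2,[::3;2;2;0;3;0]);(4,[::1;1;1;3;2;0])]);
 ([::1;0;3;2;2;4],[::(1,[::1;0;1;3;2;4]);(1,[::1;0;3;0;3;4]);(2,[::1;0;1;1;3;4])]);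
 ([::1;0;5;1;0;5],[::(1,[::1;0;1;3;2;4]);(1,[::1;0;3;2;0;5]);(2,[::1;0;1;3;0;5])]);
 ([::1;1;5;5;0;0],[::(1,[::0;1;1;7;0;2]);(1,[::0;3;2;2;2;2]);(1,[::1;0;1;3;2;4]);(1,[::1;0;3;0;3;4]);(1,[::1;1;7;0;2;0]);(1,[::1;3;2;4;1;0]);(1,[::1;3;4;1;2;0]);(1,[::1;5;1;2;2;0]);(1,[::1;7;0;0;3;0]);(1,[::5;1;0;3;2;0]);(1,[::5;1;2;0;3;0]);(2,[::0;3;0;3;2;2]);(2,[::0;3;2;0;3;2]);(2,[::1;1;1;7;0;0]);(2,[::3;0;3;2;2;0]);(2,[::3;2;0;3;2;0]);(2,[::3;2;2;0;3;0])]);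
 ([::1;2;0;1;5;3],[::(1,[::1;0;1;1;5;3])]);
 ([::1;2;0;3;2;4],[::(1,[::1;0;1;3;2;4])]);
 ([::1;2;2;0;3;4],[::(1,[::1;0;3;0;3;4])]);
 ([::1;2;2;2;0;5],[::(1,[::1;0;3;2;0;5])]);
 ([::1;3;2;6;0;0],[::(1,[::0;3;2;2;2;2]);(1,[::1;1;3;6;0;0]);(1,[::1;1;7;0;2;0]);(1,[::1;3;0;7;0;0]);(1,[::1;3;2;4;1;0]);(1,[::1;3;4;1;2;0]);(1,[::1;5;1;2;2;0]);(1,[::1;7;0;0;3;0]);(1,[::5;1;0;3;2;0]);(1,[::5;1;2;0;3;0]);(2,[::0;3;0;3;2;2]);(2,[::0;3;2;0;3;2]);(2,[::3;0;3;2;2;0]);(2,[::3;2;0;3;2;0]);(2,[::3;2;2;0;3;0])]);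
 ([::1;3;6;0;2;0],[::(1,[::1;1;3;6;0;0]);(1,[::1;1;7;0;2;0]);(1,[::1;3;0;7;0;0]);(1,[::1;3;4;1;2;0]);(1,[::1;5;1;2;2;0]);(1,[::5;1;0;3;2;0]);(2,[::0;3;0;3;2;2]);(2,[::1;3;2;2;2;0]);(2,[::3;0;3;2;2;0]);(2,[::3;2;0;3;2;0])]);
 ([::1;4;1;0;1;5],[::(2,[::1;0;3;0;1;5])]);
 ([::1;5;1;4;1;0],[::(1,[::0;1;3;4;1;2]);(1,[::1;1;3;6;0;0]);(1,[::1;3;2;4;1;0]);(2,[::1;1;3;4;1;0])]);
 ([::1;5;5;0;0;1],[::(1,[::0;1;7;0;0;3]);(1,[::1;1;7;0;2;0]);(1,[::1;3;6;0;0;1]);(2,[::1;1;7;0;0;1])]);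
 ([::1;7;0;2;2;0],[::(1,[::0;3;2;2;2;2]);(1,[::1;1;3;6;0;0]);(1,[::1;1;7;0;2;0]);(1,[::1;5;1;2;2;0]);(2,[::3;0;3;2;2;0])]);
 ([::2;0;1;3;6;0],[::(1,[::0;1;1;3;6;0])]);
 ([::2;0;1;5;3;1],[::(1,[::0;1;1;5;3;1])]);
 ([::2;0;1;7;0;2],[::(1,[::0;1;1;7;0;2])]);
 ([::2;0;3;0;7;0],[::(1,[::0;1;3;0;7;0])]);
 ([::2;0;3;2;4;1],[::(1,[::0;1;3;2;4;1])]);
 ([::2;0;3;4;1;2],[::(1,[::0;1;3;4;1;2])]);
 ([::2;0;5;1;2;2],[::(1,[::0;1;5;1;2;2])]);
 ([::2;0;7;0;0;3],[::(1,[::0;1;7;0;0;3])]);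
 ([::2;2;0;1;7;0],[::(1,[::0;3;0;1;7;0])]);
 ([::2;2;0;3;4;1],[::(1,[::0;3;0;3;4;1])]);
 ([::2;2;0;5;1;2],[::(1,[::0;3;0;5;1;2])]);
 ([::2;2;2;0;5;1],[::(1,[::0;3;2;0;5;1])]);
 ([::2;2;2;2;2;2],[::(1,[::0;3;2;2;2;2])]);
 ([::2;2;4;1;0;3],[::(1,[::0;3;4;1;0;3])]);
 ([::2;4;1;0;3;2],[::(1,[::0;5;1;0;3;2])]);
 ([::2;4;1;2;0;3],[::(1,[::0;5;1;2;0;3])]);
 ([::2;6;0;0;1;3],[::(1,[::0;7;0;0;1;3])]);
 ([::3;0;3;6;0;0],[::(1,[::1;1;3;6;0;0])]);
 ([::3;0;5;3;1;0],[::(1,[::1;1;5;3;1;0])]);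
 ([::3;0;7;0;2;0],[::(1,[::1;1;7;0;2;0])]);
 ([::3;1;2;0;1;5],[::(1,[::3;1;0;1;1;5]);(2,[::1;2;0;1;1;5])]);
 ([::3;2;0;7;0;0],[::(1,[::1;3;0;7;0;0])]);
 ([::3;2;2;4;1;0],[::(1,[::1;3;2;4;1;0])]);
 ([::3;2;4;1;2;0],[::(1,[::1;3;4;1;2;0])]);
 ([::3;2;6;0;0;1],[::(1,[::1;3;6;0;0;1])]);
 ([::3;4;1;2;2;0],[::(1,[::1;5;1;2;2;0])]);
 ([::3;4;3;1;0;1],[::(1,[::1;5;3;1;0;1])]);
 ([::3;6;0;0;3;0],[::(1,[::1;7;0;0;3;0])]);
 ([::3;6;0;2;0;1],[::(1,[::1;7;0;2;0;1])]);
 ([::4;1;0;1;5;1],[::(2,[::0;3;0;1;5;1])]);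
 ([::4;1;0;3;2;2],[::(2,[::0;3;0;3;2;2])]);
 ([::4;1;2;0;3;2],[::(2,[::0;3;2;0;3;2])]);
 ([::4;1;2;2;0;3],[::(2,[::0;3;2;2;0;3])]);
 ([::5;0;0;1;1;5],[::(1,[::3;1;0;1;1;5])]);
 ([::5;1;0;5;1;0],[::(2,[::1;3;0;5;1;0])]);
 ([::5;1;2;2;2;0],[::(2,[::1;3;2;2;2;0])]);
 ([::5;1;4;1;0;1],[::(2,[::1;3;4;1;0;1])]);
 ([::5;5;0;0;1;1],[::(2,[::1;7;0;0;1;1])]);
 ([::6;0;0;1;3;2],[::(1,[::4;1;0;1;3;2])]);
 ([::6;0;0;3;0;3],[::(1,[::4;1;0;3;0;3])]);
 ([::6;0;2;0;1;3],[::(1,[::4;1;2;0;1;3])]);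
 ([::7;0;0;3;2;0],[::(1,[::5;1;0;3;2;0])]);
 ([::7;0;2;0;3;0],[::(1,[::5;1;2;0;3;0])]);
 ([::7;0;2;2;0;1],[::(1,[::5;1;2;2;0;1])]);
 ([::7;2;1;0;1;1],[::(1,[::5;3;1;0;1;1])])].
Definition rows12 : seq (seq nat * seq (seq nat)) := [:: ([::1;5;3;1;2;0],[::[::0;3;5;3;1;0]]);
 ([::0;5;3;1;0;3],[::[::1;1;6;3;1;0]]);
 ([::1;3;4;3;1;0],[::[::0;1;1;6;3;1]]);
 ([::0;1;1;7;2;1],[::[::0;2;1;5;3;1]]);
 ([::5;3;1;2;0;1],[::[::1;1;0;6;3;1]]);
 ([::1;0;3;0;5;3],[::[::2;5;3;1;0;1]]);
 ([::0;1;5;3;1;2],[::[::0;0;3;5;3;1]]);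
 ([::1;1;7;2;1;0],[::[::2;1;5;3;1;0]]);
 ([::5;3;1;0;3;0],[::[::0;1;2;5;3;1]]);
 ([::4;3;1;0;1;3],[::[::1;6;3;1;0;1]]);
 ([::1;0;1;3;4;3],[::[::1;1;0;2;5;3]]);
 ([::2;1;0;1;1;7],[::[::3;1;0;2;1;5]]);
 ([::1;7;2;1;0;1],[::[::1;0;7;3;1;0]]);
 ([::3;1;0;3;0;5],[::[::1;2;5;3;1;0]]);
 ([::3;1;0;1;3;4],[::[::6;3;1;0;1;1]]);
 ([::1;0;1;1;7;2],[::[::0;7;3;1;0;1]]);
 ([::0;1;3;4;3;1],[::[::1;0;0;7;3;1]]);
 ([::0;3;0;5;3;1],[::[::1;0;2;5;3;1]])].

Lemma QPinv6_eq0 n : (0 < n <= 12)%N -> QPinv 6 n = 0%VS.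
Proof.
case/andP=> n0 n12.
have : n \in iota 1 12 by rewrite mem_iota n0.
rewrite !inE => /or4P[/eqP->|/eqP->|/eqP->|].
(* Below degree 6 no monomial qualifies: a positive multiple of 63 is never a sum of fewer than six
   powers of 2. *)
- by apply: (@QPinv_eq0 _ [::] [::]); vm_compute.
- by apply: (@QPinv_eq0 _ [::] [::]); vm_compute.
- by apply: (@QPinv_eq0 _ [::] [::]); vm_compute.
case/or4P=> [/eqP->|/eqP->|/eqP->|].
- by apply: (@QPinv_eq0 _ [::] [::]); vm_compute.
- by apply: (@QPinv_eq0 _ [::] [::]); vm_compute.
- by apply: (@QPinv_eq0 _ steps6 rows6); vm_compute.
case/or4P=> [/eqP->|/eqP->|/eqP->|].
- by apply: (@QPinv_eq0 _ steps7 rows7); vm_compute.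
- by apply: (@QPinv_eq0 _ steps8 rows8); vm_compute.
- by apply: (@QPinv_eq0 _ steps9 rows9); vm_compute.
case/or3P=> /eqP->.
- by apply: (@QPinv_eq0 _ steps10 rows10); vm_compute.
- by apply: (@QPinv_eq0 _ steps11 rows11); vm_compute.
- by apply: (@QPinv_eq0 _ steps12 rows12); vm_compute.
Qed.

(** * A minimal resolution of Z/2 in low degrees *)

Definition gens0 : seq nat := [::0].
Definition gens1 : seq nat := [::1;2;4;8].
Definition diff1 : gen_map := [:: [::([::1],0)];
 [::([::2],0)];
 [::([::4],0)];
 [::([::8],0)]].
Definition gens2 : seq nat := [::2;4;5;8;9;10].
Definition diff2 : gen_map := [:: [::([::1],0)];
 [::([::2],1);([::3],0)];
 [::([::1],2);([::2;1],1);([::4],0)];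
 [::([::4],2);([::6],1);([::7],0)];
 [::([::1],3);([::4;2;1],1);([::6;2],0);([::7],1);([::8],0)];
 [::([::2],3);([::4;2],2);([::7;2],0);([::8],1)]].
Definition gens3 : seq nat := [::3;6;10;11;12].
Definition diff3 : gen_map := [:: [::([::1],0)];
 [::([::1],2);([::2],1);([::4],0)];
 [::([::1],4);([::4;2],1);([::6;2],0);([::8],0)];
 [::([::2;1],3);([::4;2;1],1);([::6],2);([::7],1)];
 [::([::2],5);([::3],4);([::4],3);([::7],2);([::8],1)]].
Definition gens4 : seq nat := [::4;11;13].
Definition diff4 : gen_map := [:: [::([::1],0)];
 [::([::1],2);([::4;1],1);([::8],0)];
 [::([::2],3);([::4;2;1],1);([::7],1);([::8;2],0);([::10],0)]].
Definition gens5 : seq nat := [::5;14;16].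
Definition diff5 : gen_map := [:: [::([::1],0)];
 [::([::2;1],1);([::10],0)];
 [::([::3],2);([::4;1],1);([::12],0)]].
(** The internal degrees of h_0^6, h_1 P h_1 and h_0 P h_2 in Ext; the last two account for n = 10
    and n = 11. *)
Definition gens6 : seq nat := [::6;16;17].
Definition diff6 : gen_map := [:: [::([::1],0)];
 [::([::2],1);([::11],0)];
 [::([::1],2);([::2;1],1);([::12],0)]].
Definition htpy0 : table := [:: [::([::1],[::([::],0)]);
  ([::2],[::([::],1)]);
  ([::2;1],[::([::2],0)]);
  ([::3],[::([::1],1)]);
  ([::3;1],[::([::3],0)]);
  ([::4],[::([::],2)]);
  ([::4;1],[::([::4],0)]);
  ([::4;2],[::([::4],1)]);
  ([::4;2;1],[::([::4;2],0)]);
  ([::5],[::([::2;1],1);([::4],0)]);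
  ([::5;1],[::([::5],0)]);
  ([::5;2],[::([::4;1],1)]);
  ([::5;2;1],[::([::5;2],0)]);
  ([::6],[::([::2],2);([::5],0)]);
  ([::6;1],[::([::6],0)]);
  ([::6;2],[::([::6],1)]);
  ([::6;2;1],[::([::6;2],0)]);
  ([::6;3],[::([::6;1],1)]);
  ([::6;3;1],[::([::6;3],0)]);
  ([::7],[::([::3],2)]);
  ([::7;1],[::([::7],0)]);
  ([::7;2],[::([::7],1)]);
  ([::7;2;1],[::([::7;2],0)]);
  ([::7;3],[::([::7;1],1)]);
  ([::7;3;1],[::([::7;3],0)]);
  ([::8],[::([::],3)]);
  ([::8;1],[::([::8],0)]);
  ([::8;2],[::([::8],1)]);
  ([::8;2;1],[::([::8;2],0)]);
  ([::8;3],[::([::8;1],1)]);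
  ([::8;3;1],[::([::8;3],0)]);
  ([::8;4],[::([::8],2)]);
  ([::8;4;1],[::([::8;4],0)]);
  ([::8;4;2],[::([::8;4],1)]);
  ([::9],[::([::4;2;1],1);([::6;2],0);([::7],1);([::8],0)]);
  ([::9;1],[::([::9],0)]);
  ([::9;2],[::([::6;2;1],1);([::7;3],0);([::8;1],1)]);
  ([::9;2;1],[::([::9;2],0)]);
  ([::9;3],[::([::7;2;1],1)]);
  ([::9;3;1],[::([::9;3],0)]);
  ([::9;4],[::([::8;2;1],1);([::8;4],0)]);
  ([::9;4;1],[::([::9;4],0)]);
  ([::10],[::([::4;2],2);([::7;2],0);([::8],1);([::9],0)]);
  ([::10;1],[::([::10],0)]);
  ([::10;2],[::([::10],1)]);
  ([::10;2;1],[::([::10;2],0)]);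
  ([::10;3],[::([::10;1],1)]);
  ([::10;3;1],[::([::10;3],0)]);
  ([::10;4],[::([::8;2],2);([::9;4],0);([::11;1],1)]);
  ([::11],[::([::5;2],2);([::6;2;1],1);([::7;3],0);([::8;1],1)]);
  ([::11;1],[::([::11],0)]);
  ([::11;2],[::([::11],1)]);
  ([::11;2;1],[::([::11;2],0)]);
  ([::11;3],[::([::11;1],1)]);
  ([::12],[::([::4],3);([::10],1);([::11],0)]);
  ([::12;1],[::([::12],0)]);
  ([::12;2],[::([::12],1)]);
  ([::13],[::([::6;3],2);([::10;1],1);([::12],0)]);
  ([::13;1],[::([::13],0)]);
  ([::14],[::([::6],3);([::11;1],1);([::13],0)])]].
Definition htpy1 : table := [:: [::([::1],[::([::],0)]);
  ([::2;1],[::([::2],0)]);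
  ([::3;1],[::([::3],0)]);
  ([::4;1],[::([::4],0)]);
  ([::4;2;1],[::([::4;2],0)]);
  ([::5;1],[::([::5],0)]);
  ([::5;2;1],[::([::5;2],0)]);
  ([::6;1],[::([::6],0)]);
  ([::6;2;1],[::([::6;2],0)]);
  ([::6;3;1],[::([::6;3],0)]);
  ([::7;1],[::([::7],0)]);
  ([::7;2;1],[::([::7;2],0)]);
  ([::7;3;1],[::([::7;3],0)]);
  ([::8;1],[::([::8],0)]);
  ([::8;2;1],[::([::8;2],0)]);
  ([::8;3;1],[::([::8;3],0)]);
  ([::8;4;1],[::([::8;4],0)]);
  ([::9;1],[::([::9],0)]);
  ([::9;2;1],[::([::9;2],0)]);
  ([::9;3;1],[::([::9;3],0)]);
  ([::9;4;1],[::([::9;4],0)]);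
  ([::10;1],[::([::10],0)]);
  ([::10;2;1],[::([::10;2],0)]);
  ([::10;3;1],[::([::10;3],0)]);
  ([::11;1],[::([::11],0)]);
  ([::11;2;1],[::([::11;2],0)]);
  ([::12;1],[::([::12],0)]);
  ([::13;1],[::([::13],0)])];
 [::([::2],[::([::],1)]);
  ([::3],[::([::1],1)]);
  ([::3;1],[::([::2],1);([::4],0)]);
  ([::4;2],[::([::4],1)]);
  ([::5],[::([::2;1],1)]);
  ([::5;1],[::([::3;1],1)]);
  ([::5;2],[::([::4;1],1)]);
  ([::5;2;1],[::([::4;2],1);([::6;2],0);([::8],0)]);
  ([::6;2],[::([::6],1)]);
  ([::6;3],[::([::6;1],1)]);
  ([::6;3;1],[::([::6;2],1);([::7;3],0)]);
  ([::7;2],[::([::7],1)]);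
  ([::7;3],[::([::7;1],1)]);
  ([::7;3;1],[::([::7;2],1)]);
  ([::8;2],[::([::8],1)]);
  ([::8;3],[::([::8;1],1)]);
  ([::8;3;1],[::([::8;2],1);([::8;4],0)]);
  ([::9],[::([::4;2;1],1);([::7],1)]);
  ([::9;1],[::([::5;2;1],1)]);
  ([::9;2],[::([::6;2;1],1);([::7;2],1);([::8;1],1)]);
  ([::9;2;1],[::([::6;3;1],1);([::8;2],1);([::8;4],0)]);
  ([::9;3],[::([::7;2;1],1)]);
  ([::9;3;1],[::([::7;3;1],1)]);
  ([::9;4],[::([::8;2;1],1)]);
  ([::10;2],[::([::10],1)]);
  ([::10;3],[::([::10;1],1)]);
  ([::11;2],[::([::11],1)])];
 [::([::1],[::([::],2)]);
  ([::2;1],[::([::2],2);([::5],0)]);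
  ([::3;1],[::([::3],2)]);
  ([::4],[::([::],3)]);
  ([::4;1],[::([::4],2);([::7],0)]);
  ([::4;2;1],[::([::4;2],2);([::7;2],0);([::9],0)]);
  ([::5],[::([::1],3)]);
  ([::5;1],[::([::4;2],1);([::5],2);([::6;2],0);([::8],0)]);
  ([::5;2;1],[::([::5;2],2)]);
  ([::6],[::([::2],3);([::4;2],1);([::5],2);([::6;2],0)]);
  ([::6;1],[::([::6],2)]);
  ([::6;2],[::([::4],3);([::7],2);([::8],1)]);
  ([::6;2;1],[::([::6;2],2);([::8;3],0);([::9;2],0);([::11],0)]);
  ([::6;3;1],[::([::6;3],2);([::12],0)]);
  ([::7],[::([::3],3);([::9],0)]);
  ([::7;1],[::([::7],2)]);
  ([::7;2],[::([::5],3);([::6;2;1],1);([::7;2],1);([::8;1],1)]);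
  ([::7;2;1],[::([::7;2],2);([::9;3],0)]);
  ([::7;3],[::([::6],3);([::7;2;1],1);([::10],1);([::12],0)]);
  ([::7;3;1],[::([::7;3],2);([::13],0)]);
  ([::8;1],[::([::8],2)]);
  ([::8;2;1],[::([::8;2],2);([::9;4],0)]);
  ([::8;3],[::([::6;1],3);([::10;1],1)]);
  ([::9],[::([::4;1],3);([::5],3);([::8],2)]);
  ([::9;1],[::([::6;3;1],1);([::8;2],1);([::8;4],0);([::9],2)]);
  ([::10],[::([::4;2],3);([::7;2],2);([::9],2);([::9;3],0);([::10;2],0)]);
  ([::10;1],[::([::10],2)]);
  ([::11],[::([::5;2],3);([::11;2],0)])];
 [::([::1],[::([::],4)]);
  ([::2],[::([::],5)]);
  ([::2;1],[::([::2],4);([::4;2;1],1);([::7],1);([::9],0)]);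
  ([::3],[::([::1],5);([::4;2;1],1);([::7],1)]);
  ([::3;1],[::([::3],4);([::5;2;1],1)]);
  ([::4;1],[::([::4],4);([::6;2;1],1);([::8;1],1);([::8;3],0);([::11],0)]);
  ([::4;2],[::([::4],5);([::6],3);([::6;3],2);([::7;2;1],1);([::9;3],0)]);
  ([::4;2;1],[::([::4;2],4);([::9;4],0);([::11],1);([::11;2],0)]);
  ([::5],[::([::2;1],5);([::4],4);([::6;2;1],1);([::8;1],1);([::8;3],0);([::11],0)]);
  ([::5;1],[::([::5],4);([::9;3],0)]);
  ([::5;2],[::([::4;1],5);([::6;1],3);([::7;3],2);([::10;1],1);([::11],1);([::13],0)]);
  ([::6;1],[::([::6],4);([::10;1],1);([::10;3],0);([::13],0)])]].
Definition htpy2 : table := [:: [::([::1],[::([::],0)]);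
  ([::2;1],[::([::2],0)]);
  ([::3;1],[::([::3],0)]);
  ([::4;1],[::([::4],0)]);
  ([::4;2;1],[::([::4;2],0)]);
  ([::5;1],[::([::5],0)]);
  ([::5;2;1],[::([::5;2],0)]);
  ([::6;1],[::([::6],0)]);
  ([::6;2;1],[::([::6;2],0)]);
  ([::6;3;1],[::([::6;3],0)]);
  ([::7;1],[::([::7],0)]);
  ([::7;2;1],[::([::7;2],0)]);
  ([::7;3;1],[::([::7;3],0)]);
  ([::8;1],[::([::8],0)]);
  ([::8;2;1],[::([::8;2],0)]);
  ([::8;3;1],[::([::8;3],0)]);
  ([::8;4;1],[::([::8;4],0)]);
  ([::9;1],[::([::9],0)]);
  ([::9;2;1],[::([::9;2],0)]);
  ([::9;3;1],[::([::9;3],0)]);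
  ([::9;4;1],[::([::9;4],0)]);
  ([::10;1],[::([::10],0)]);
  ([::10;2;1],[::([::10;2],0)]);
  ([::10;3;1],[::([::10;3],0)]);
  ([::11;1],[::([::11],0)]);
  ([::11;2;1],[::([::11;2],0)]);
  ([::12;1],[::([::12],0)]);
  ([::13;1],[::([::13],0)])];
 [::([::3],[::([::1],1)]);
  ([::5],[::([::2;1],1);([::6],0)]);
  ([::5;1],[::([::3;1],1);([::7],0)]);
  ([::5;2],[::([::4;1],1);([::8],0)]);
  ([::6;3],[::([::6;1],1)]);
  ([::7;3],[::([::7;1],1)]);
  ([::8;3],[::([::8;1],1)]);
  ([::8;3;1],[::([::6;3;1],1);([::10;3],0);([::13],0)]);
  ([::9],[::([::4;2;1],1);([::8;2],0);([::10],0)]);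
  ([::9;1],[::([::5;2;1],1);([::9;2],0);([::11],0)]);
  ([::9;2],[::([::6;2;1],1);([::8;1],1);([::9;3],0);([::10;2],0)]);
  ([::9;3],[::([::7;2;1],1);([::11;2],0)])];
 [::([::1],[::([::],1)]);
  ([::2;1],[::([::2],1);([::5],0)]);
  ([::3;1],[::([::3],1)]);
  ([::4;1],[::([::4],1);([::7],0)]);
  ([::4;2;1],[::([::4;2],1);([::7;2],0);([::9],0)]);
  ([::5;1],[::([::4;1],1);([::5],1);([::8],0)]);
  ([::5;2;1],[::([::5;2],1)]);
  ([::6;1],[::([::6],1)]);
  ([::6;2;1],[::([::6;2],1);([::8;3],0);([::9;2],0);([::11],0)]);
  ([::6;3;1],[::([::6;3],1);([::12],0)]);
  ([::7;1],[::([::7],1)]);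
  ([::7;2;1],[::([::7;2],1);([::9;3],0)]);
  ([::7;3;1],[::([::7;3],1);([::13],0)]);
  ([::8;1],[::([::8],1)]);
  ([::8;2;1],[::([::6;3;1],1);([::8;2],1);([::9;4],0);([::10;3],0);([::13],0)]);
  ([::9;1],[::([::6;2;1],1);([::8;1],1);([::9],1);([::9;3],0);([::10;2],0)]);
  ([::10;1],[::([::10],1)])];
 [::([::2;1],[::([::],3)]);
  ([::3;1],[::([::1],3)]);
  ([::4;2;1],[::([::4],3);([::6;2;1],1);([::8;1],1);([::9;3],0);([::10;2],0)]);
  ([::5;1],[::([::2;1],3);([::8],1)]);
  ([::5;2;1],[::([::4;1],3);([::6;3;1],1);([::10;3],0);([::13],0)]);
  ([::7],[::([::3],4);([::5],2);([::6;2;1],1);([::8;1],1);([::9],1);([::10;2],0)])];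
 [::([::1],[::([::],2)]);
  ([::2;1],[::([::2],2);([::9],0)]);
  ([::3;1],[::([::3],2)]);
  ([::4;1],[::([::4],2);([::7;1],1);([::8;3],0);([::11],0)]);
  ([::4;2;1],[::([::4;2],2);([::6;3;1],1);([::9;4],0);([::10;3],0);([::11;2],0);([::13],0)]);
  ([::5;1],[::([::5],2);([::9;3],0)]);
  ([::6;1],[::([::6],2);([::10;3],0);([::13],0)])];
 [::([::2],[::([::],4)]);
  ([::3],[::([::1],4);([::4;2;1],1);([::8;2],0);([::10],0)]);
  ([::3;1],[::([::2],4);([::2;1],3);([::4],2);([::5;2;1],1);([::7;1],1);([::8;3],0);([::9;2],0)]);
  ([::4;2],[::([::4],4)]);
  ([::5],[::([::2;1],4)]);
  ([::5;1],[::([::3;1],4)])]].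
Definition htpy3 : table := [:: [::([::1],[::([::],0)]);
  ([::2;1],[::([::2],0)]);
  ([::3;1],[::([::3],0)]);
  ([::4;1],[::([::4],0)]);
  ([::4;2;1],[::([::4;2],0)]);
  ([::5;1],[::([::5],0)]);
  ([::5;2;1],[::([::5;2],0)]);
  ([::6;1],[::([::6],0)]);
  ([::6;2;1],[::([::6;2],0)]);
  ([::6;3;1],[::([::6;3],0)]);
  ([::7;1],[::([::7],0)]);
  ([::7;2;1],[::([::7;2],0)]);
  ([::7;3;1],[::([::7;3],0)]);
  ([::8;1],[::([::8],0)]);
  ([::8;2;1],[::([::8;2],0)]);
  ([::8;3;1],[::([::8;3],0)]);
  ([::8;4;1],[::([::8;4],0)]);
  ([::9;1],[::([::9],0)]);
  ([::9;2;1],[::([::9;2],0)]);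
  ([::9;3;1],[::([::9;3],0)]);
  ([::9;4;1],[::([::9;4],0)]);
  ([::10;1],[::([::10],0)]);
  ([::10;2;1],[::([::10;2],0)]);
  ([::10;3;1],[::([::10;3],0)]);
  ([::11;1],[::([::11],0)]);
  ([::11;2;1],[::([::11;2],0)]);
  ([::12;1],[::([::12],0)]);
  ([::13;1],[::([::13],0)])];
 [::([::5;1],[::([::1],1)]);
  ([::9;1],[::([::4;1],1);([::12],0)])];
 [::([::1],[::([::],1)]);
  ([::2;1],[::([::2],1);([::9],0)]);
  ([::3;1],[::([::3],1)]);
  ([::4;1],[::([::4],1);([::11],0)]);
  ([::4;2;1],[::([::4;2],1);([::11;2],0)]);
  ([::5;1],[::([::5],1)]);
  ([::6;1],[::([::6],1);([::13],0)])];
 [::([::2],[::([::],2)]);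
  ([::3],[::([::1],2)]);
  ([::3;1],[::([::2],2);([::11],0)]);
  ([::4;2],[::([::4],2);([::10;3],0)]);
  ([::5],[::([::2;1],2);([::12],0)]);
  ([::5;1],[::([::3;1],2);([::13],0)])];
 [::]].
Definition htpy4 : table := [:: [::([::1],[::([::],0)]);
  ([::2;1],[::([::2],0)]);
  ([::3;1],[::([::3],0)]);
  ([::4;1],[::([::4],0)]);
  ([::4;2;1],[::([::4;2],0)]);
  ([::5;1],[::([::5],0)]);
  ([::5;2;1],[::([::5;2],0)]);
  ([::6;1],[::([::6],0)]);
  ([::6;2;1],[::([::6;2],0)]);
  ([::6;3;1],[::([::6;3],0)]);
  ([::7;1],[::([::7],0)]);
  ([::7;2;1],[::([::7;2],0)]);
  ([::7;3;1],[::([::7;3],0)]);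
  ([::8;1],[::([::8],0)]);
  ([::8;2;1],[::([::8;2],0)]);
  ([::8;3;1],[::([::8;3],0)]);
  ([::8;4;1],[::([::8;4],0)]);
  ([::9;1],[::([::9],0)]);
  ([::9;2;1],[::([::9;2],0)]);
  ([::9;3;1],[::([::9;3],0)]);
  ([::9;4;1],[::([::9;4],0)]);
  ([::10;1],[::([::10],0)]);
  ([::10;2;1],[::([::10;2],0)]);
  ([::10;3;1],[::([::10;3],0)]);
  ([::11;1],[::([::11],0)]);
  ([::11;2;1],[::([::11;2],0)]);
  ([::12;1],[::([::12],0)]);
  ([::13;1],[::([::13],0)])];
 [::([::2;1],[::([::],1)]);
  ([::3;1],[::([::1],1)]);
  ([::4;2;1],[::([::4],1)]);
  ([::5;1],[::([::2;1],1);([::12],0)])];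
 [::([::3],[::([::],2)]);
  ([::5],[::([::2],2);([::13],0)])]].
Definition htpy5 : table := [:: [::([::1],[::([::],0)]);
  ([::2;1],[::([::2],0)]);
  ([::3;1],[::([::3],0)]);
  ([::4;1],[::([::4],0)]);
  ([::4;2;1],[::([::4;2],0)]);
  ([::5;1],[::([::5],0)]);
  ([::5;2;1],[::([::5;2],0)]);
  ([::6;1],[::([::6],0)]);
  ([::6;2;1],[::([::6;2],0)]);
  ([::6;3;1],[::([::6;3],0)]);
  ([::7;1],[::([::7],0)]);
  ([::7;2;1],[::([::7;2],0)]);
  ([::7;3;1],[::([::7;3],0)]);
  ([::8;1],[::([::8],0)]);
  ([::8;2;1],[::([::8;2],0)]);
  ([::8;3;1],[::([::8;3],0)]);
  ([::8;4;1],[::([::8;4],0)]);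
  ([::9;1],[::([::9],0)]);
  ([::9;2;1],[::([::9;2],0)]);
  ([::9;3;1],[::([::9;3],0)]);
  ([::9;4;1],[::([::9;4],0)]);
  ([::10;1],[::([::10],0)]);
  ([::10;2;1],[::([::10;2],0)]);
  ([::10;3;1],[::([::10;3],0)]);
  ([::11;1],[::([::11],0)]);
  ([::11;2;1],[::([::11;2],0)]);
  ([::12;1],[::([::12],0)]);
  ([::13;1],[::([::13],0)])];
 [::([::2],[::([::],1)]);
  ([::3],[::([::1],1)]);
  ([::3;1],[::([::2],1);([::12],0)]);
  ([::5],[::([::2;1],1)])];
 [::([::1],[::([::],2)]);
  ([::2;1],[::([::2],2);([::13],0)])]].

Lemma steenrod14_ok : closed_ok 14 && adem_ok 14.
Proof. by vm_compute. Qed.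

Lemma resolution_ok :
  [&& gens_ok gens0 gens1 diff1 && table_ok gens0 gens1 htpy0,
      gens_ok gens1 gens2 diff2 && table_ok gens1 gens2 htpy1,
      gens_ok gens2 gens3 diff3 && table_ok gens2 gens3 htpy2,
      gens_ok gens3 gens4 diff4 && table_ok gens3 gens4 htpy3,
      gens_ok gens4 gens5 diff5 && table_ok gens4 gens5 htpy4,
      gens_ok gens5 gens6 diff6 && table_ok gens5 gens6 htpy5 &
      [&& dd_ok diff1 diff2, dd_ok diff2 diff3, dd_ok diff3 diff4, dd_ok diff4 diff5 &
          dd_ok diff5 diff6]].
Proof. by vm_compute. Qed.

Lemma resolution_exact :
  [&& aug_ok 13 diff1 htpy0, exact_ok 14 gens1 diff1 diff2 htpy0 htpy1,
      exact_ok 15 gens2 diff2 diff3 htpy1 htpy2, exact_ok 16 gens3 diff3 diff4 htpy2 htpy3,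
      exact_ok 17 gens4 diff4 diff5 htpy3 htpy4 & exact_ok 18 gens5 diff5 diff6 htpy4 htpy5].
Proof. by vm_compute. Qed.

Lemma leq_nth i g v : all (leq i) g -> v < size g -> i <= nth 0 g v.
Proof. by move=> /(all_nthP 0)/(_ v). Qed.

(** When the shifting has reached V_i, 5 - i bars remain and take degree at least 5 - i. So
    exactness at V_i is required only through degree 13 + i, which gives the bounds from 13 to
    18. *)
Lemma bar_exact6 d : d <= 18 -> d \notin gens6 -> forall c, bar_cochain d 6 c ->
  (forall ws, bar_word d 7 ws -> \sum_(ws' <- merges ws) c ws' = 0)%R ->
  exists2 b, bar_cochain d 5 b &
    forall ws, bar_word d 6 ws -> (\sum_(ws' <- merges ws) b ws' = c ws)%R.
Proof.
move=> d18 dg; have /andP[clo ado] := steenrod14_ok.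
have /and5P[/andP[ok1 tok0] /andP[ok2 tok1] /andP[ok3 tok2] /andP[ok4 tok3]] := resolution_ok.
case/and3P=> /andP[ok5 tok4] /andP[ok6 tok5] /and5P[dd1 dd2 dd3 dd4 dd5].
have /and5P[aug ex1 ex2 ex3 /andP[ex4 ex5]] := resolution_exact.
have K5 := kernel_exact0 ok6 dg.
(* A descended cochain on V_i carries 4 - i bars and generators of degree at least i, so its
   coefficient words have degree at most 18 - 4 = 14. *)
have b1 i s v g : 4 <= i + s -> all (leq i) g -> v < size g -> d <= 14 + s + nth 0 g v.
  by move=> iss H /(leq_nth H); move: d18 iss; clear; lia.
have b2 i v g : all (leq i.+1) g -> v < size g -> 14 + i <= 14 + nth 0 g v.
  by move=> H /(leq_nth H); clear; lia.
have K4 : kernel_exact gens4 gens5 diff5 d 1.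
  apply: (kernel_exactS (B1 := 18) clo ado tok4 tok5 ok5 ok6 dd5 ex5) K5.
  - by move=> v; apply: (b1 4 0).
  - by rewrite addn0.
  - by move=> v; apply: (b2 4).
have K3 : kernel_exact gens3 gens4 diff4 d 2.
  apply: (kernel_exactS (B1 := 17) clo ado tok3 tok4 ok4 ok5 dd4 ex4) K4.
  - by move=> v; apply: (b1 3 1).
  - exact: d18.
  - by move=> v; apply: (b2 3).
have K2 : kernel_exact gens2 gens3 diff3 d 3.
  apply: (kernel_exactS (B1 := 16) clo ado tok2 tok3 ok3 ok4 dd3 ex3) K3.
  - by move=> v; apply: (b1 2 2).
  - exact: d18.
  - by move=> v; apply: (b2 2).
have K1 : kernel_exact gens1 gens2 diff2 d 4.
  apply: (kernel_exactS (B1 := 15) clo ado tok1 tok2 ok2 ok3 dd2 ex2) K2.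
  - by move=> v; apply: (b1 1 3).
  - exact: d18.
  - by move=> v; apply: (b2 1).
have K0 : kernel_exact gens0 gens1 diff1 d 5.
  apply: (kernel_exactS (B1 := 14) clo ado tok0 tok1 ok1 ok2 dd1 ex1) K1.
  - by move=> v; apply: (b1 0 4).
  - exact: d18.
  - by move=> v; apply: (b2 0).
exact: (bar_exact clo ado ok1 tok0 aug).
Qed.

Lemma Ext6_eq0 d : (d <= 18)%N -> d \notin gens6 -> \dim {: Ext 6 d} = 0%N.
Proof. by move=> d18 dg; apply: (Ext_eq0 (s := 4)); apply: bar_exact6. Qed.

Theorem theorem4p2p1 (n : nat) (hn : (0 < n <= 12)%N) :
  (n \in [:: 10; 11] -> injective (Tr 6 n)) /\
  (n \notin [:: 10; 11] ->
     [/\ \dim {: dual (subvs_of (QPinv 6 n))} = 0%N,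
         \dim {: Ext 6 (6 + n)} = 0%N
       & bijective (Tr 6 n)]).
Proof.
have dual0 := dim_dual_subvs0 (QPinv6_eq0 hn).
split=> [_ x y _|n10]; first exact: (dim0_eq dual0).
have ext0 : \dim {: Ext 6 (6 + n)} = 0%N.
  apply: Ext6_eq0; first by case/andP: hn; rewrite (leq_add2l 6 n 12).
  (* The degree 6 + n avoids 6 because n > 0, and avoids 16 and 17 because n is neither 10 nor
     11. *)
  move: hn n10; rewrite !inE; lia.
split=> //; exists (fun _ => 0%R) => z; [exact: (dim0_eq dual0) | exact: (dim0_eq ext0)].
Qed.
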